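(* Let $m,n,r$ be positive integers with $r\le\min\{m,n\}$, let $\mathfrak g=\mathfrak{gl}_{m|n}$ over $\mathbb C$, and let $p,q\in\mathbb C$ satisfy: $p-q\notin\mathbb Z$ or $p-q\le-m$ or $p-q\ge n$. Let $M_{pq}^{r0}=V^{\otimes r}\otimes K_{\lambda_{pq}}$. Then there is a bijection between the set of dominant weights of $M_{pq}^{r0}$ (the weights of its $\mathfrak g$-highest weight vectors) and the set $\Lambda_2^+(r)$ of bipartitions of $r$, with $\lambda\in\Lambda_2^+(r)$ corresponding to $\bar\lambda=\lambda_{pq}+(\lambda^{(1)}_1,\dots,\lambda^{(1)}_m\,|\,\lambda^{(2)}_1,\dots,\lambda^{(2)}_n)$. Further, for each $\lambda\in\Lambda_2^+(r)$, the $\mathbb C$-space $V_{\bar\lambda}$ of $\mathfrak g$-highest weight vectors of $M_{pq}^{r0}$ with highest weight $\bar\lambda$ has a basis $\{v_{\mathfrak t}\mid\mathfrak t\in\mathcal T^s(\lambda')\}$.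
   Context: **Lie superalgebra.** $I_0=\{1,\dots,m\}$, $I_1=\{m+1,\dots,m+n\}$, $I=I_0\cup I_1$, $[i]=a$ for $i\in I_a$. $\mathfrak g$ has basis $E_{ij}$ ($i,j\in I$) of parity $[i]+[j]$; $\mathfrak g_0=\mathfrak{gl}_m\oplus\mathfrak{gl}_n$, $\mathfrak g_1$ is spanned by $E_{ij}$, $i\in I_0,j\in I_1$. $V=\mathbb C^{m|n}$ is the natural module with basis $v_i$, $[v_i]=[i]$. Weights are written $(\xi_1,\dots,\xi_m|\xi_{m+1},\dots,\xi_{m+n})$ in the basis dual to the $E_{ii}$. $\lambda_{pq}=(p,\dots,p|-q,\dots,-q)$; $K_{\lambda_{pq}}=U(\mathfrak g)\otimes_{U(\mathfrak g_0\oplus\mathfrak g_1)}L^0(\lambda_{pq})$ is the Kac module, with highest weight vector $v_{pq}$. A $\mathfrak g$-highest weight vector of weight $\xi$ is a vector of weight $\xi$ killed by all $E_{ij}$ with $i<j$. **Right action.** Label the tensor factors of $M_{pq}^{r0}$ from left to right $r,\dots,2,1,0$ ($0$ for $K_{\lambda_{pq}}$). Let $\Omega=\sum_{i,j\in I}(-1)^{[j]}E_{ij}\otimes E_{ji}$ and $\pi_{ab}(\Omega)$ be $\Omega$ acting in positions $a,b$ ($a$ left of $b$, usual sign rule). Let $s_i=\pi_{i+1,i}(\Omega)$ ($1\le i<r$) and $x_1=-\pi_{10}(\Omega)$ act on the right of $M_{pq}^{r0}$, and $x_{i+1}=s_ix_is_i-s_i$. The $s_i$ give a right action of $\mathfrak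 S_r$ (which acts on the right on $\{1,\dots,r\}$), commuting with $\mathfrak g$. **Tableaux.** For $\lambda=(\lambda^{(1)},\lambda^{(2)})\in\Lambda_2^+(r)$: a standard $\lambda$-tableau is a filling of the two diagrams with $1,\dots,r$, each used once, increasing along rows and down columns in each component; $\mathcal T^s(\lambda)$ is the set of these. $\mathfrak t^\lambda$ has $1,\dots,r$ entered along the rows of $\lambda^{(1)}$ and then of $\lambda^{(2)}$; $\mathfrak t_\lambda$ has $1,\dots,r$ entered down the columns of $\lambda^{(2)}$ and then of $\lambda^{(1)}$. $\mathfrak S_r$ acts on the right by permuting entries; $d(\mathfrak s)$ is defined by $\mathfrak t^\lambda d(\mathfrak s)=\mathfrak s$, and $w_\lambda=d(\mathfrak t_\lambda)$. The conjugate of $\lambda$ is the bipartition $\lambda'$ whose first (second) component is the conjugate partition of $\lambda^{(2)}$ ($\lambda^{(1)}$). For a bipartition $\mu$ of $r$, $x_{\mu^{(1)}}$ is the sum of the elements of the row stabilizer of the first component of $\mathfrak t^\mu$, $y_{\mu^{(2)}}$ is the sum of $(-1)^{\ell(w)}w$ over the row stabilizer of the second component of $\mathfrak t^\mu$, and $\mathfrak y_\mu=\prod_{i=1}^{|\mu^{(1)}|}(x_i+p)\;x_{\mu^{(1)}}y_{\mu^{(2)}}$. **Vectors.** For $\lambda\in\Lambda_2^+(r)$ let $(i_1,\dots,i_r)$ be the sequence $(1^{\lambda^{(1)}_1},2^{\lambda^{(1)}_2},\dots,m^{\lambda^{(1)}_m},(m+1)^{\lambda^{(2)}_1},\dots,(m+n)^{\lambda^{(2)}_n})$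 (exponents denote multiplicities) and $v_{\tilde\lambda}=v_{i_r}\otimes v_{i_{r-1}}\otimes\cdots\otimes v_{i_1}$. For $\mathfrak t\in\mathcal T^s(\lambda')$, $v_{\mathfrak t}=(v_{\tilde\lambda}\otimes v_{pq})\,w_\lambda\,\mathfrak y_{\lambda'}\,d(\mathfrak t)$. *)

(* Defs.v *)
From HB Require Import structures.
From mathcomp Require Import all_boot all_order all_fingroup all_algebra.
From mathcomp Require Import boolp classical_sets functions reals complex.
From mathcomp Require Import monalg.

Set Implicit Arguments.
Unset Strict Implicit.
Unset Printing Implicit Defensive.

Import GRing.Theory.
Local Open Scope ring_scope.
Local Open Scope quotient_scope.

Section QuotMod.
Variables (C : fieldType) (A : lmodType C) (G : A -> Prop).

Inductive lspan : A -> Prop :=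
| lspan_gen x : G x -> lspan x
| lspan0 : lspan 0
| lspanD x y : lspan x -> lspan y -> lspan (x + y)
| lspanZ c x : lspan x -> lspan (c *: x).

Definition lspanb : {pred A} := fun x => `[< lspan x >].

Lemma lspanP x : reflect (lspan x) (x \in lspanb).
Proof. exact: asboolP. Qed.

Lemma lspanb_zmod_closed : zmod_closed lspanb.
Proof.
split=> [|x y /lspanP hx /lspanP hy]; apply/lspanP; first exact: lspan0.
by apply: lspanD hx _; rewrite -scaleN1r; apply: lspanZ.
Qed.

HB.instance Definition _ :=
  GRing.isZmodClosed.Build A lspanb lspanb_zmod_closed.

Definition quotmod : Type := (Quotient.quot lspanb).

HB.instance Definition _ := GRing.Zmodule.on quotmod.

Definition qpi (x : A) : quotmod := \pi_(Quotient.quot lspanb) x.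
Definition qrepr (x : quotmod) : A := generic_quotient.repr x.

Lemma qreprK : cancel qrepr qpi.
Proof. exact: reprK. Qed.

Lemma qpi_eqP (x y : A) : qpi x = qpi y <-> lspan (x - y).
Proof.
rewrite /qpi; split=> [/eqmodP|h]; first by rewrite /= /Quotient.equiv => /lspanP.
by apply/eqmodP; rewrite /= /Quotient.equiv; apply/lspanP.
Qed.

Lemma qpiD (x y : A) : qpi (x + y) = qpi x + qpi y.
Proof. exact: (raddfD \pi_(Quotient.quot lspanb)). Qed.

Lemma qrepr_qpi (x : A) : lspan (qrepr (qpi x) - x).
Proof. by apply/qpi_eqP; rewrite qreprK. Qed.

Definition qscale (c : C) (x : quotmod) : quotmod := qpi (c *: qrepr x).

Lemma qscaleE c (x : A) : qscale c (qpi x) = qpi (c *: x).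
Proof. by apply/qpi_eqP; rewrite -scalerBr; apply/lspanZ/qrepr_qpi. Qed.

Lemma qscaleA a b v : qscale a (qscale b v) = qscale (a * b) v.
Proof. by rewrite -[v]qreprK !qscaleE scalerA. Qed.

Lemma qscale1 : left_id 1 qscale.
Proof. by move=> v; rewrite -[v]qreprK qscaleE scale1r. Qed.

Lemma qscaleDr : right_distributive qscale +%R.
Proof.
move=> c u v; rewrite -[u]qreprK -[v]qreprK -qpiD !qscaleE.
by rewrite scalerDr qpiD.
Qed.

Lemma qscaleDl v : {morph qscale^~ v : a b / a + b}.
Proof. by move=> a b; rewrite -[v]qreprK !qscaleE scalerDl qpiD. Qed.

HB.instance Definition _ := GRing.Zmodule_isLmodule.Build C quotmod
  qscaleA qscale1 qscaleDr qscaleDl.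

Lemma qpiZ c (x : A) : qpi (c *: x) = c *: qpi x.
Proof. exact/esym/qscaleE. Qed.

End QuotMod.
Arguments qpi {C A} G x.


Section QuotAlg.
Variables (C : fieldType) (A : algType C) (G : A -> Prop).

Definition ideal_gen (x : A) : Prop := exists a g b, G g /\ x = a * g * b.

Lemma ideal_genMl a x : lspan ideal_gen x -> lspan ideal_gen (a * x).
Proof.
elim=> [y [u [g [v [hg ->]]]]||y z _ hy _ hz|c y _ hy].
- by apply: lspan_gen; exists (a * u), g, v; rewrite !mulrA.
- by rewrite mulr0; exact: lspan0.
- by rewrite mulrDr; exact: lspanD.
- by rewrite -scalerAr; exact: lspanZ.
Qed.

Lemma ideal_genMr a x : lspan ideal_gen x -> lspan ideal_gen (x * a).
Proof.
elim=> [y [u [g [v [hg ->]]]]||y z _ hy _ hz|c y _ hy].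
- by apply: lspan_gen; exists u, g, (v * a); rewrite !mulrA.
- by rewrite mul0r; exact: lspan0.
- by rewrite mulrDl; exact: lspanD.
- by rewrite -scalerAl; exact: lspanZ.
Qed.

Definition qmul (x y : quotmod ideal_gen) : quotmod ideal_gen :=
  qpi ideal_gen (qrepr x * qrepr y).

Lemma qmulE (x y : A) :
  qmul (qpi ideal_gen x) (qpi ideal_gen y) = qpi ideal_gen (x * y).
Proof.
apply/qpi_eqP; set x' := qrepr _; set y' := qrepr _.
have -> : x' * y' - x * y = x' * (y' - y) + (x' - x) * y.
  by rewrite mulrBr mulrBl addrA subrK.
by apply: lspanD; [apply: ideal_genMl|apply: ideal_genMr]; apply: qrepr_qpi.
Qed.

Lemma qmulA : associative qmul.
Proof.
by move=> x y z; rewrite -[x]qreprK -[y]qreprK -[z]qreprK !qmulE mulrA.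
Qed.

Lemma qmul1 : left_id (qpi ideal_gen 1) qmul.
Proof. by move=> x; rewrite -[x]qreprK qmulE mul1r. Qed.

Lemma qmulr1 : right_id (qpi ideal_gen 1) qmul.
Proof. by move=> x; rewrite -[x]qreprK qmulE mulr1. Qed.

Lemma qmulDl : left_distributive qmul +%R.
Proof.
move=> x y z; rewrite -[x]qreprK -[y]qreprK -[z]qreprK.
by rewrite !qmulE -!qpiD qmulE mulrDl.
Qed.

Lemma qmulDr : right_distributive qmul +%R.
Proof.
move=> x y z; rewrite -[x]qreprK -[y]qreprK -[z]qreprK.
by rewrite !qmulE -!qpiD qmulE mulrDr.
Qed.

Lemma qmulAl (c : C) x y : c *: qmul x y = qmul (c *: x) y.
Proof.
by rewrite -[x]qreprK -[y]qreprK -[in RHS]qpiZ !qmulE -qpiZ scalerAl.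
Qed.

Lemma qmulAr (c : C) x y : c *: qmul x y = qmul x (c *: y).
Proof.
by rewrite -[x]qreprK -[y]qreprK -[in RHS]qpiZ !qmulE -qpiZ scalerAr.
Qed.

Lemma qmul_nontrivial (e : A -> C) :
    scalar e -> {morph e : x y / x * y} -> e 1 = 1 ->
    (forall g, G g -> e g = 0) ->
  qpi ideal_gen 1 != 0 :> quotmod ideal_gen.
Proof.
move=> eL eM e1 eG.
have eD u v : e (u + v) = e u + e v by rewrite -[u]scale1r eL scale1r mul1r.
have e0 : e 0 = 0 by apply: (@addrI _ (e 0)); rewrite -eD !addr0.
have eZ c u : e (c *: u) = c * e u by rewrite -[_ *: _]addr0 eL e0 addr0.
have hI x : lspan ideal_gen x -> e x = 0.
  elim=> [y [u [g [v [hg ->]]]]||y z _ hy _ hz|c y _ hy] //.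
  - by rewrite !eM (eG _ hg) mulr0 mul0r.
  - by rewrite eD hy hz addr0.
  - by rewrite eZ hy mulr0.
apply/eqP => h0; have : qpi ideal_gen 1 = qpi ideal_gen 0.
  by rewrite h0 -(scale0r (0 : A)) qpiZ scale0r.
by move/qpi_eqP; rewrite subr0 => /hI/eqP; rewrite e1 oner_eq0.
Qed.

End QuotAlg.

(* Let [S a c] mean that a, running over generators of a subalgebra B of A,
   acts on the one-dimensional B-module L = C by the scalar c.  Then
   A (x)_B L is the quotient of A (x)_C L = A by the subspace spanned by the
   elements (u a) (x) 1 - u (x) (a 1) = u a - c u. *)
Section Induced.
Variables (C : fieldType) (A : algType C) (S : A -> C -> Prop).

Definition ind_rel (x : A) : Prop :=
  exists u a c, S a c /\ x = u * a - c *: u.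

Definition induced : Type := quotmod ind_rel.
HB.instance Definition _ := GRing.Lmodule.on induced.

Lemma ind_relMl a x : lspan ind_rel x -> lspan ind_rel (a * x).
Proof.
elim=> [y [u [b [c [h ->]]]]||y z _ hy _ hz|c y _ hy].
- apply: lspan_gen; exists (a * u), b, c; split=> //.
  by rewrite mulrBr mulrA -scalerAr.
- by rewrite mulr0; exact: lspan0.
- by rewrite mulrDr; exact: lspanD.
- by rewrite -scalerAr; exact: lspanZ.
Qed.

Definition ind_act (u : A) (x : induced) : induced :=
  qpi ind_rel (u * qrepr x).

Lemma ind_actE u x : ind_act u (qpi ind_rel x) = qpi ind_rel (u * x).
Proof. by apply/qpi_eqP; rewrite -mulrBr; apply/ind_relMl/qrepr_qpi. Qed.

End Induced.

Section Superalgebra.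
Variables (C : fieldType) (m n : nat).
Notation I := 'I_(m + n).

Definition par (i : I) : bool := (m <= i)%N.

Section Relations.
Variables (A : algType C) (t : I -> I -> A).

(* E_ij E_kl - (-1)^{[E_ij][E_kl]} E_kl E_ij - [E_ij, E_kl] *)
Definition gl_rel (i j k l : I) : A :=
  let s : C := (-1) ^+ ((par i (+) par j) && (par k (+) par l)) in
  t i j * t k l - s *: (t k l * t i j)
  - ((j == k)%:R *: t i l - (s * (l == i)%:R) *: t k j).

Definition gl_rels (x : A) : Prop := exists i j k l, x = gl_rel i j k l.

Lemma gl_rels_aug (e : A -> C) :
    scalar e -> {morph e : x y / x * y} -> (forall i j, e (t i j) = 0) ->
  forall x, gl_rels x -> e x = 0.
Proof.
move=> eL eM et _ [i [j [k [l ->]]]].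
have eD u v : e (u + v) = e u + e v by rewrite -[u]scale1r eL scale1r mul1r.
have e0 : e 0 = 0 by apply: (@addrI _ (e 0)); rewrite -eD !addr0.
have eZ c u : e (c *: u) = c * e u by rewrite -[_ *: _]addr0 eL e0 addr0.
have eB u v : e (u - v) = e u - e v by rewrite -scaleN1r eD eZ mulN1r.
by rewrite /gl_rel !(eB, eZ, eM, et) !mulr0 !subr0.
Qed.

End Relations.

Lemma malg_scalerAr (K : monomType) (c : C) (x y : {malg C[K]}) :
  c *: (x * y) = x * (c *: y).
Proof.
rewrite -!mul_malgC !mulrA; congr (_ * _).
rewrite [LHS]malgM_def fgmulUg [RHS]malgM_def fgmulgU.
by apply: eq_bigr => k _; rewrite mulrC mulm1 mul1m.
Qed.

(* The free associative algebra on the symbols E_ij. *)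
Definition tens_gl : Type := {malg C[{fmonom (I * I)%type}]}.
HB.instance Definition _ := GRing.Lalgebra.on tens_gl.
HB.instance Definition _ :=
  GRing.Lalgebra_isAlgebra.Build C tens_gl (@malg_scalerAr _).

Definition tE (i j : I) : tens_gl := << fmu (i, j) >>.

Definition gl_ideal : tens_gl -> Prop := ideal_gen (gl_rels tE).

Lemma Ugl_nontrivial : qpi gl_ideal 1 != 0 :> quotmod gl_ideal.
Proof.
pose e (x : tens_gl) : C := @mcoeff {fmonom (I * I)%type} C mone x.
have eL : scalar e by move=> c x y; rewrite /e mcoeffD mcoeffZ.
have [eM e1] : multiplicative e.
  exact: (@mcoeff1g_is_multiplicative {fmonom (I * I)%type} C).
apply: (@qmul_nontrivial C tens_gl (gl_rels tE) e) => //.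
apply: gl_rels_aug => // i j; rewrite /e mcoeffU.
by case: eqP => // /(congr1 (@fdeg _)); rewrite fdegU fdeg1.
Qed.

Definition Ugl : Type := quotmod gl_ideal.
HB.instance Definition _ := GRing.Lmodule.on Ugl.
HB.instance Definition _ := GRing.Zmodule_isNzRing.Build Ugl
  (@qmulA C tens_gl (gl_rels tE)) (@qmul1 C tens_gl (gl_rels tE))
  (@qmulr1 C tens_gl (gl_rels tE)) (@qmulDl C tens_gl (gl_rels tE))
  (@qmulDr C tens_gl (gl_rels tE)) Ugl_nontrivial.
HB.instance Definition _ := GRing.Lmodule_isLalgebra.Build C Ugl
  (@qmulAl C tens_gl (gl_rels tE)).
HB.instance Definition _ := GRing.Lalgebra_isAlgebra.Build C Ugl
  (@qmulAr C tens_gl (gl_rels tE)).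

Definition E_gl (i j : I) : Ugl := qpi gl_ideal (tE i j).

Section Kac.
Variables p q : C.

Definition lam_pq (i : I) : C := if par i then - q else p.

(* The simple g_0-module L^0(lam_pq) is one-dimensional, with g_1 acting by 0:
   E_ij acts by 0 if i != j and by lam_pq i if i = j.  The first condition
   excludes the E_ij with i in I_1 and j in I_0, which are the basis elements
   outside g_0 + g_1. *)
Definition L0_char (a : Ugl) (c : C) : Prop :=
  exists i j, [/\ ~~ (par i && ~~ par j), a = E_gl i j
                & c = (i == j)%:R * lam_pq i].

Definition kac : Type := induced L0_char.
HB.instance Definition _ := GRing.Lmodule.on kac.

Definition kact : Ugl -> kac -> kac := @ind_act C Ugl L0_char.

Definition v_pq : kac := qpi (ind_rel L0_char) 1.

End Kac.
End Superalgebra.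

Definition is_part (s : seq nat) : bool := sorted geq s && (0%N \notin s).

Record bipart (r : nat) := Bipart {
  bp :> seq nat * seq nat;
  bpP : [&& is_part bp.1, is_part bp.2 & sumn bp.1 + sumn bp.2 == r]%N
}.
HB.instance Definition _ r := [isSub for @bp r].
HB.instance Definition _ r := [Choice of bipart r by <:].

(* A node is (component, row, column), everything counted from 0; [false] is
   the first component. *)
Definition node : Type := (bool * nat * nat)%type.
HB.instance Definition _ := Choice.on node.
Definition ncomp (x : node) : bool := x.1.1.
Definition nrow (x : node) : nat := x.1.2.
Definition ncol (x : node) : nat := x.2.

Definition row_cells (c : bool) (s : seq nat) : seq node :=
  [seq (c, i, j) | i <- iota 0 (size s), j <- iota 0 (nth 0%N s i)].
Definition col_cells (c : bool) (s : seq nat) : seq node :=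
  [seq (c, i, j) | j <- iota 0 (head 0%N s),
                   i <- [seq i <- iota 0 (size s) | (j < nth 0%N s i)%N]].

Definition rowread (la : seq nat * seq nat) : seq node :=
  row_cells false la.1 ++ row_cells true la.2.
Definition colread (la : seq nat * seq nat) : seq node :=
  col_cells true la.2 ++ col_cells false la.1.

Lemma size_row_cells c s : size (row_cells c s) = sumn s.
Proof.
rewrite size_allpairs_dep; congr sumn; apply: (@eq_from_nth _ 0%N).
  by rewrite size_map size_iota.
move=> i; rewrite size_map size_iota => hi.
by rewrite (nth_map 0%N) ?size_iota // nth_iota.
Qed.

Lemma uniq_row_cells c s : uniq (row_cells c s).
Proof.
apply: allpairs_uniq_dep => [|i _|]; rewrite ?iota_uniq //.
by move=> [i j] [i' j'] _ _ /= [-> ->].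
Qed.

Lemma uniq_col_cells c s : uniq (col_cells c s).
Proof.
apply: allpairs_uniq_dep => [|i _|]; rewrite ?filter_uniq ?iota_uniq //.
by move=> [i j] [i' j'] _ _ /= [-> ->].
Qed.

Lemma nth_le_head s i : is_part s -> (nth 0 s i <= head 0 s)%N.
Proof.
case/andP=> ss _; case: s ss i => [|x s] ss [|i] //=.
move: ss; rewrite /= path_sortedE; last by move=> a b d /= h1 /leq_trans; exact.
case/andP=> /allP hs _; have [hi|hi] := ltnP i (size s).
  exact/hs/mem_nth.
by rewrite nth_default.
Qed.

Lemma col_row_perm c s : is_part s -> perm_eq (col_cells c s) (row_cells c s).
Proof.
move=> hs; apply: uniq_perm; rewrite ?uniq_col_cells ?uniq_row_cells // => x.
apply/allpairsPdep/allpairsPdep => [[j [i []]]|[i [j []]]].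
  rewrite mem_filter !mem_iota /= !add0n => hj /andP[hij hi] ->.
  by exists i, j; rewrite !mem_iota.
rewrite !mem_iota /= !add0n => hi hj ->.
exists j, i; rewrite mem_filter !mem_iota /= !add0n hi hj; split=> //.
exact: leq_trans hj (nth_le_head i hs).
Qed.

Definition conj_part (s : seq nat) : seq nat :=
  mkseq (fun j => count (fun x => (j < x)%N) s) (head 0%N s).

Lemma sumn_conj_part s : is_part s -> sumn (conj_part s) = sumn s.
Proof.
move=> hs; rewrite -(size_row_cells true s) -(perm_size (col_row_perm true hs)).
rewrite size_allpairs_dep /conj_part /mkseq; congr sumn.
apply: eq_map => j; rewrite size_filter -[in LHS](mkseq_nth 0%N s) count_map.
exact: eq_count.
Qed.

Lemma conj_part_is_part s : is_part s -> is_part (conj_part s).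
Proof.
move=> _; apply/andP; split.
  apply/(sortedP 0%N) => i; rewrite size_mkseq => hi.
  rewrite /= !nth_mkseq //; last exact: ltnW.
  by apply: sub_count => x /= /ltnW.
apply/negP => /mapP[j]; rewrite mem_iota /= add0n => hj.
by case: s hj => //= x s ->.
Qed.

Lemma conj_bipart_subproof r (la : bipart r) :
  [&& is_part (conj_part la.2, conj_part la.1).1,
      is_part (conj_part la.2, conj_part la.1).2 &
      sumn (conj_part la.2, conj_part la.1).1
      + sumn (conj_part la.2, conj_part la.1).2 == r]%N.
Proof.
case: la => [[s t] /= /and3P[hs ht /eqP hr]].
by rewrite !conj_part_is_part // !sumn_conj_part // addnC hr eqxx.
Qed.

Definition conj_bipart r (la : bipart r) : bipart r :=
  Bipart (conj_bipart_subproof la).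

Section Tableaux.
Variables (r : nat) (la : bipart r).

Lemma size_rowread : size (rowread la) = r.
Proof.
by case: la => [[s t] /= /and3P[_ _ /eqP <-]]; rewrite size_cat !size_row_cells.
Qed.

Lemma colread_perm : perm_eq (colread la) (rowread la).
Proof.
case: la => [[s t] /= /and3P[hs ht _]]; rewrite /colread /rowread /=.
by rewrite perm_catC; apply: perm_cat; exact: col_row_perm.
Qed.

Definition cell : finType := seq_sub (rowread la).

(* A filling by 1, ..., r, the entry k being represented by k - 1 : 'I_r. *)
Definition tableau : finType := {ffun cell -> 'I_r}.

Lemma tab_of_subproof (s : seq node) (hs : perm_eq s (rowread la)) (x : cell) :
  (index (ssval x) s < r)%N.
Proof.
by rewrite -[X in (_ < X)%N]size_rowread -(perm_size hs) index_mem
           (perm_mem hs) ssvalP.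
Qed.

(* The entries 1, ..., r are placed along the list [s]; below, [tab_row] is
   t^la and [tab_col] is t_la. *)
Definition tab_of (s : seq node) (hs : perm_eq s (rowread la)) : tableau :=
  [ffun x : cell => Ordinal (tab_of_subproof hs x)].

Definition tab_row : tableau := tab_of (perm_refl (rowread la)).
Definition tab_col : tableau := tab_of colread_perm.

Definition tab_act (t : tableau) (w : 'S_r) : tableau :=
  [ffun x : cell => w ((t : {ffun cell -> 'I_r}) x)].

(* There is exactly one such w when the entries of t are pairwise distinct. *)
Definition tab_perm (t : tableau) : 'S_r :=
  odflt 1%g [pick w : 'S_r | tab_act tab_row w == t].

Definition standard (t : tableau) : bool :=
  let e (x : cell) := (t : {ffun cell -> 'I_r}) x in
  [&& injectiveb e,
      [forall x : cell, forall y : cell,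
         [&& ncomp (ssval x) == ncomp (ssval y),
             nrow (ssval x) == nrow (ssval y)
           & (ncol (ssval x) < ncol (ssval y))%N] ==> (e x < e y)%N]
    & [forall x : cell, forall y : cell,
         [&& ncomp (ssval x) == ncomp (ssval y),
             ncol (ssval x) == ncol (ssval y)
           & (nrow (ssval x) < nrow (ssval y))%N] ==> (e x < e y)%N]].

(* The permutations of the entries of t^la which preserve the rows of
   component [c] and fix the entries of the other component. *)
Definition row_stab (c : bool) : {set 'S_r} :=
  let e (x : cell) := (tab_row : {ffun cell -> 'I_r}) x in
  [set w : 'S_r | [forall x : cell, forall y : cell, (w (e x) == e y) ==>
     if ncomp (ssval x) == c
     then (ncomp (ssval y) == c) && (nrow (ssval y) == nrow (ssval x))
     else x == y]].

End Tableaux.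
Arguments standard {r la} t.

Section MixedTensor.
Variables (C : fieldType) (m n r : nat) (p q : C).
Notation I := 'I_(m + n).

(* V^{(x) r} has the basis v_{f r} (x) ... (x) v_{f 1}, the factor with label
   k (1 <= k <= r) being indexed by the ordinal of value k - 1; an element
   sum_f v_{f r} (x) ... (x) v_{f 1} (x) x_f is represented by f |-> x_f. *)
Notation M := {ffun {ffun 'I_r -> I} -> kac m n p q}.

Definition upd (f : {ffun 'I_r -> I}) (k : 'I_r) (j : I) : {ffun 'I_r -> I} :=
  [ffun l => if l == k then j else f l].

(* E_ij acting on the factor with label [a], with the sign obtained by moving
   E_ij past the factors on its left, namely those with label c.+1 > a. *)
Definition E_at (a : nat) (i j : I) (x : M) : M :=
  [ffun f : {ffun 'I_r -> I} =>
    (-1) ^+ ((par i + par j) * \sum_(c < r | a <= c) par (f c))%N *: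
    if a is b.+1 then
      if insub b is Some k then if f k == i then x (upd f k j) else 0 else 0
    else kact (E_gl C i j) (x f)].

Definition gact (i j : I) (x : M) : M := \sum_(a < r.+1) E_at a i j x.

Definition hw_space (xi : {ffun I -> C}) (x : M) : Prop :=
  (forall i : I, gact i i x = xi i *: x) /\
  (forall i j : I, (i < j)%N -> gact i j x = 0).

Definition dominant_weight (xi : {ffun I -> C}) : Prop :=
  exists x : M, x != 0 /\ hw_space xi x.

Definition Omega_at (a b : nat) (x : M) : M :=
  \sum_(i : I) \sum_(j : I) (-1) ^+ par j *: E_at a i j (E_at b j i x).

(* All operators below are right operators: x s_i is [s_op i x]. *)
Definition s_op (i : nat) (x : M) : M := Omega_at i.+1 i x.

Fixpoint x_op (i : nat) (x : M) : M :=
  match i with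
  | 0 => 0
  | 1 => - Omega_at 1 0 x
  | (_.+1 as j).+1 => s_op j (x_op j (s_op j x)) - s_op j x
  end.

(* The transposition of i and i+1, for 1 <= i < r. *)
Definition s_perm (i : nat) : 'S_r :=
  if (insub i.-1, insub i) is (Some a, Some b) then tperm a b else 1%g.

(* A word (i_1, ..., i_k) with w = s_{i_1} ... s_{i_k}; such words exist and,
   the s_i giving a right action of the symmetric group, [perm_op w] does not
   depend on the one selected by [xget]. *)
Definition s_word (w : 'S_r) : seq nat :=
  xget [::] [set u : seq nat | all (fun i => 0 < i < r)%N u /\
                               (\prod_(i <- u) s_perm i)%g = w].

Definition perm_op (w : 'S_r) (x : M) : M :=
  foldl (fun y i => s_op i y) x (s_word w).

Definition sym_op (A : {set 'S_r}) (x : M) : M := \sum_(w in A) perm_op w x.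
(* (-1)^{l(w)} is the signature of w. *)
Definition alt_op (A : {set 'S_r}) (x : M) : M :=
  \sum_(w in A) (-1) ^+ w *: perm_op w x.

Definition y_op (mu : bipart r) (x : M) : M :=
  alt_op (row_stab mu true) (sym_op (row_stab mu false)
    (foldl (fun y i => x_op i y + p *: y) x (iota 1 (sumn mu.1)))).

Definition part_at (la : bipart r) (i : I) : nat :=
  if par i then nth 0%N la.2 (i - m) else nth 0%N la.1 i.

Definition bar_weight (la : bipart r) : {ffun I -> C} :=
  [ffun i => lam_pq p q i + (part_at la i)%:R].

Definition i_seq (la : bipart r) : seq I :=
  flatten [seq nseq (part_at la i) i | i <- enum I].

Definition v_tilde (la : bipart r) : M :=
  [ffun f : {ffun 'I_r -> I} => if codom f == i_seq la then v_pq m n p q else 0].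

Definition v_tab (la : bipart r) (t : tableau (conj_bipart la)) : M :=
  perm_op (tab_perm t)
    (y_op (conj_bipart la) (perm_op (tab_perm (tab_col la)) (v_tilde la))).

End MixedTensor.
Arguments hw_space {C m n} r p q xi x.
Arguments dominant_weight {C m n} r p q xi.
Arguments bar_weight {C} m n {r} p q la.
Arguments v_tab {C} m n {r} p q la t.

(* The family v, indexed by the t such that P t, is a basis of W. *)
Definition is_basis_of (C : fieldType) (V : lmodType C) (T : finType)
    (P : pred T) (v : T -> V) (W : V -> Prop) : Prop :=
  [/\ forall t, P t -> W (v t),
      forall c : T -> C, \sum_(t | P t) c t *: v t = 0 ->
        forall t, P t -> c t = 0
    & forall x, W x -> exists c : T -> C, x = \sum_(t | P t) c t *: v t].

(* Main.v *)
Require Import Defs.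
From HB Require Import structures.
From mathcomp Require Import all_boot all_order all_fingroup all_algebra.
From mathcomp Require Import boolp classical_sets functions reals complex.
From mathcomp Require Import finmap monalg.
From mathcomp Require Import ring lra zify fintype finset.

Set Implicit Arguments.
Unset Strict Implicit.
Unset Printing Implicit Defensive.

Import Order.TTheory GRing.Theory Num.Theory.
Local Open Scope ring_scope.

(* The Kac module K is realized on a Grassmann algebra: the lowering elements
   E_ai (a odd, i even) act by creation operators, g_0 by quadratic terms and
   the raising elements by a cubic correction of annihilation operators.  The
   hypothesis on p - q says that no scalar p - q - a + b with 0 <= a < n and
   0 <= b < m vanishes; raising up to the top degree then shows that the only
   vectors of K killed by g_1 whose vacuum coefficient vanishes are 0.

   The vector P u, where u is the word v_(la) w_la and P = prod (x_i + p), is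
   killed by g_1 because the factors of P push an even letter down to position
   1, where x_1 + p kills it.  It is killed by the raising elements of g_0 after
   row symmetrization, since raising a letter repeats one in its row.

   Independence: attach to t the word f_t whose letter in the position of a
   cell of t is the column of the cell (column and component, read as a letter
   of I).  The term of the row symmetrizer indexed by s meets the word f_t
   only if f_s <= f_t lexicographically, and the coefficient of P at words
   with even letters only detects the words on which P acted.

   Spanning: taking vacuum coefficients is injective on vectors killed by g_1
   and yields a singular vector for g_0 in the tensor space.  Fixing the
   letters on the left to be as large as possible leaves singular vectors of
   the shorter tensor powers, whose weights are dominant because
   |E_ji y|^2 = (c_i - c_j) |y|^2 for i < j.  Hence some f_t occurs in every
   nonzero highest weight vector, and the dimension is at most the number of
   standard tableaux. *)

(** * Linear endomorphisms *)

(** The condition r <= m provides r distinct even letters: the odd letters on which P acts can be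
    traded for even letters that differ from one another and from the rest of the word, and a
    coefficient of P u at such a word returns one vacuum coefficient of u up to sign. Together with
    r <= n it bounds the numbers of rows of every bipartition of r by m and n. The condition on p -
    q enters through the injectivity of the vacuum coefficients: the component of a highest weight
    vector at a word with as few even letters as possible is a singular vector of K.

    Standard tableaux are never counted. Reading a highest weight vector at the words f_t embeds the
    highest weight space into a space with one coordinate for each standard t, so the independent
    vectors v_t, equally many, must form a basis.

    Signs are hardly computed either: place permutations are characterized by how they conjugate the
    operators of the single factors, and their coefficients are used only up to a sign that does not
    depend on the vector. *)

Section Endomorphisms.
Variables (C : fieldType) (V : lmodType C).

(** Bundled so that operator identities become equations in a ring; 1 = 0 is allowed there, because
    V may be the zero module. *)
Record endo := Endo { endo_fun :> V -> V; endo_linear : linear endo_fun }.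

HB.instance Definition _ := gen_eqMixin endo.
HB.instance Definition _ := gen_choiceMixin endo.

Lemma endoP (f g : endo) : f =1 g <-> f = g.
Proof.
split=> [|-> //]; case: f g => f hf [g hg] /= /funext h.
by rewrite -h in hg *; congr Endo; apply: Prop_irrelevance.
Qed.

HB.instance Definition _ (f : endo) :=
  GRing.isLinear.Build C V V *:%R (endo_fun f) (endo_linear f).

Lemma endo0_linear : linear (fun _ : V => 0 : V).
Proof. by move=> c x y; rewrite scaler0 addr0. Qed.
Lemma endo1_linear : linear (fun x : V => x).
Proof. by []. Qed.
Lemma endoD_linear (f g : endo) : linear (fun x => f x + g x).
Proof. by move=> c x y; rewrite !linearP scalerDr addrACA. Qed.
Lemma endoN_linear (f : endo) : linear (fun x => - f x).
Proof. by move=> c x y; rewrite linearP opprD scalerN. Qed.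
Lemma endoM_linear (f g : endo) : linear (fun x => f (g x)).
Proof. by move=> c x y; rewrite !linearP. Qed.
Lemma endoZ_linear a (f : endo) : linear (fun x => a *: f x).
Proof. by move=> c x y; rewrite linearP scalerDr !scalerA mulrC. Qed.

Definition endo0 := Endo endo0_linear.
Definition endo1 := Endo endo1_linear.
Definition endoD f g := Endo (endoD_linear f g).
Definition endoN f := Endo (endoN_linear f).
Definition endoM f g := Endo (endoM_linear f g).
Definition endoZ a f := Endo (endoZ_linear a f).

Fact endo_addA : associative endoD.
Proof. by move=> f g h; apply/endoP => x /=; rewrite addrA. Qed.
Fact endo_addC : commutative endoD.
Proof. by move=> f g; apply/endoP => x /=; rewrite addrC. Qed.
Fact endo_add0 : left_id endo0 endoD.
Proof. by move=> f; apply/endoP => x /=; rewrite add0r. Qed.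
Fact endo_addN : left_inverse endo0 endoN endoD.
Proof. by move=> f; apply/endoP => x /=; rewrite addNr. Qed.
Fact endo_mulA : associative endoM.
Proof. by move=> f g h; apply/endoP. Qed.
Fact endo_mul1 : left_id endo1 endoM.
Proof. by move=> f; apply/endoP. Qed.
Fact endo_mulr1 : right_id endo1 endoM.
Proof. by move=> f; apply/endoP. Qed.
Fact endo_mulDl : left_distributive endoM endoD.
Proof. by move=> f g h; apply/endoP. Qed.
Fact endo_mulDr : right_distributive endoM endoD.
Proof. by move=> f g h; apply/endoP => x /=; rewrite linearD. Qed.

HB.instance Definition _ := GRing.isZmodule.Build endo
  endo_addA endo_addC endo_add0 endo_addN.
HB.instance Definition _ := GRing.Zmodule_isPzRing.Build endo
  endo_mulA endo_mul1 endo_mulr1 endo_mulDl endo_mulDr.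

Fact endo_scaleA a b f : endoZ a (endoZ b f) = endoZ (a * b) f.
Proof. by apply/endoP => x /=; rewrite scalerA. Qed.
Fact endo_scale1 : left_id 1 endoZ.
Proof. by move=> f; apply/endoP => x /=; rewrite scale1r. Qed.
Fact endo_scaleDr : right_distributive endoZ +%R.
Proof. by move=> a f g; apply/endoP => x /=; rewrite scalerDr. Qed.
Fact endo_scaleDl f : {morph endoZ^~ f : a b / a + b}.
Proof. by move=> a b; apply/endoP => x /=; rewrite scalerDl. Qed.
HB.instance Definition _ := GRing.Zmodule_isLmodule.Build C endo
  endo_scaleA endo_scale1 endo_scaleDr endo_scaleDl.

Implicit Types f g h : endo.

Lemma endo0E x : (0 : endo) x = 0. Proof. by []. Qed.
Lemma endo1E x : (1 : endo) x = x. Proof. by []. Qed.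
Lemma endoDE f g x : (f + g) x = f x + g x. Proof. by []. Qed.
Lemma endoNE f x : (- f) x = - f x. Proof. by []. Qed.
Lemma endoME f g x : (f * g) x = f (g x). Proof. by []. Qed.
Lemma endoZE a f x : (a *: f) x = a *: f x. Proof. by []. Qed.
Lemma endo_sumE (T : Type) (s : seq T) (P : pred T) (F : T -> endo) x :
  (\sum_(i <- s | P i) F i) x = \sum_(i <- s | P i) F i x.
Proof. by elim/big_rec2: _ => //= i f y _ <-. Qed.

Lemma endo_apD f x y : f (x + y) = f x + f y. Proof. exact: linearD. Qed.
Lemma endo_apZ a f x : f (a *: x) = a *: f x. Proof. exact: linearZ. Qed.
Lemma endo_apN f x : f (- x) = - f x. Proof. exact: linearN. Qed.
Lemma endo_ap0 f : f 0 = 0. Proof. exact: linear0. Qed.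
Lemma endo_apsum (T : Type) (s : seq T) (P : pred T) (F : T -> V) f :
  f (\sum_(i <- s | P i) F i) = \sum_(i <- s | P i) f (F i).
Proof. exact: linear_sum. Qed.

Lemma endoZl a f g : (a *: f) * g = a *: (f * g).
Proof. by apply/endoP. Qed.
Lemma endoZr a f g : f * (a *: g) = a *: (f * g).
Proof. by apply/endoP => x; rewrite /= linearZ. Qed.

End Endomorphisms.
Definition endoE := (endo0E, endo1E, endoDE, endoNE, endoME, endoZE, endo_sumE).
Definition endo_ap := (endo_apD, endo_apZ, endo_apN, endo_ap0, endo_apsum).

(* Linear identities in a module V over C become identities in the commutative
   ring C + V with V V = 0, where the ring tactic applies. *)
Section SquareZero.
Variables (C : fieldType) (V : lmodType C).

Record sqz := Sqz { sqz_fst : C; sqz_snd : V }.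
HB.instance Definition _ := gen_eqMixin sqz.
HB.instance Definition _ := gen_choiceMixin sqz.

Definition sqz_add a b := Sqz (sqz_fst a + sqz_fst b) (sqz_snd a + sqz_snd b).
Definition sqz_opp a := Sqz (- sqz_fst a) (- sqz_snd a).
Definition sqz_mul a b := Sqz (sqz_fst a * sqz_fst b)
  (sqz_fst a *: sqz_snd b + sqz_fst b *: sqz_snd a).

Fact sqz_addA : associative sqz_add.
Proof. by move=> [a x] [b y] [c z]; rewrite /sqz_add /= !addrA. Qed.
Fact sqz_addC : commutative sqz_add.
Proof. by move=> [a x] [b y]; rewrite /sqz_add /= addrC [x + y]addrC. Qed.
Fact sqz_add0 : left_id (Sqz 0 0) sqz_add.
Proof. by move=> [a x]; rewrite /sqz_add /= !add0r. Qed.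
Fact sqz_addN : left_inverse (Sqz 0 0) sqz_opp sqz_add.
Proof. by move=> [a x]; rewrite /sqz_add /= !addNr. Qed.
HB.instance Definition _ := GRing.isZmodule.Build sqz
  sqz_addA sqz_addC sqz_add0 sqz_addN.

Fact sqz_mulA : associative sqz_mul.
Proof.
move=> [a x] [b y] [c z]; rewrite /sqz_mul /= mulrA; congr Sqz.
by rewrite !scalerDr !scalerA -addrA [c * a]mulrC [c * b]mulrC.
Qed.
Fact sqz_mulC : commutative sqz_mul.
Proof. by move=> [a x] [b y]; rewrite /sqz_mul /= mulrC addrC. Qed.
Fact sqz_mul1 : left_id (Sqz 1 0) sqz_mul.
Proof. by move=> [a x]; rewrite /sqz_mul /= mul1r scale1r scaler0 addr0. Qed.
Fact sqz_mulDl : left_distributive sqz_mul sqz_add.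
Proof.
move=> [a x] [b y] [c z]; rewrite /sqz_mul /sqz_add /= mulrDl; congr Sqz.
by rewrite scalerDl scalerDr addrACA.
Qed.
Fact sqz_1neq0 : Sqz 1 0 != 0.
Proof. by apply/eqP => -[] /eqP; rewrite oner_eq0. Qed.
HB.instance Definition _ := GRing.Zmodule_isComNzRing.Build sqz
  sqz_mulA sqz_mulC sqz_mul1 sqz_mulDl sqz_1neq0.

Definition sqz_sc (c : C) := Sqz c 0.
Fact sqz_sc_zmod : zmod_morphism sqz_sc.
Proof. by move=> a b; congr Sqz; rewrite /= subr0. Qed.
Fact sqz_sc_monoid : monoid_morphism sqz_sc.
Proof. by split=> // a b; congr Sqz; rewrite /= !scaler0 addr0. Qed.
HB.instance Definition _ := GRing.isZmodMorphism.Build C sqz sqz_sc sqz_sc_zmod.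
HB.instance Definition _ := GRing.isMonoidMorphism.Build C sqz sqz_sc sqz_sc_monoid.

Definition sqz_emb (x : V) := Sqz 0 x.
Lemma sqz_emb_inj : injective sqz_emb. Proof. by move=> x y []. Qed.
Lemma sqz_embD x y : sqz_emb (x + y) = sqz_emb x + sqz_emb y.
Proof. by congr Sqz; rewrite /= addr0. Qed.
Lemma sqz_embN x : sqz_emb (- x) = - sqz_emb x.
Proof. by congr Sqz; rewrite /= oppr0. Qed.
Lemma sqz_embZ c x : sqz_emb (c *: x) = sqz_sc c * sqz_emb x.
Proof. by congr Sqz; rewrite /= ?mulr0 // scale0r addr0. Qed.
Lemma sqz_emb0 : sqz_emb 0 = 0. Proof. by []. Qed.
End SquareZero.

Ltac lmod_ring :=
  apply: sqz_emb_inj; rewrite ?(sqz_embD, sqz_embN, sqz_embZ, sqz_emb0); ring.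
Ltac endo_ring := apply/endoP => ?; rewrite ?endoE ?endo_ap; lmod_ring.

(** * The Grassmann model of the Kac module *)

Lemma regZ (C : fieldType) (c : C) (x : C^o) : c *: x = c * x.
Proof. by []. Qed.

Section Fermions.
Variables (C : fieldType) (X : finType).
Implicit Types (x y : X) (S T : {set X}).

Local Notation grass := {ffun {set X} -> C^o}.

(** An arbitrary total order on X, which fixes the signs in the exterior algebra on X. *)
Definition before x y := (enum_rank x < enum_rank y)%N.

Definition nbefore x S := #|[set y in S | before y x]|.

Lemma nbeforeD1 x y S : y \in S -> nbefore x S = (before y x + nbefore x (S :\ y))%N.
Proof.
move=> yS; rewrite /nbefore (cardsD1 y) inE yS; congr (_ + _)%N.
by apply: eq_card => z; rewrite !inE andbA.
Qed.

Lemma nbeforeU1 x y S :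
  y \notin S -> nbefore x (y |: S) = (before y x + nbefore x S)%N.
Proof.
by move=> yS; rewrite (@nbeforeD1 _ y) ?setU11 // setU1K.
Qed.

Lemma before_asym x y : x != y -> before y x = ~~ before x y.
Proof. by move=> xy; rewrite /before ltnNge leq_eqVlt (inj_eq val_inj)
  (inj_eq enum_rank_inj) (negbTE xy). Qed.

Lemma beforexx x : before x x = false.
Proof. exact: ltnn. Qed.

(** A function on the subsets of X is read as a vector of the exterior algebra in the basis of
    ordered monomials; [cr_fun x] is left multiplication by x and [an_fun x] is the contraction. *)
Definition cr_fun x (g : grass) : grass := [ffun S : {set X} =>
  if x \in S then (-1) ^+ nbefore x S * g (S :\ x) else 0].
Definition an_fun x (g : grass) : grass := [ffun S : {set X} =>
  if x \in S then 0 else (-1) ^+ nbefore x S * g (x |: S)].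

Fact cr_linear x : linear (cr_fun x).
Proof.
move=> c g h; apply/ffunP => S; rewrite !ffunE; rewrite !regZ; case: ifP => _; ring.
Qed.
Fact an_linear x : linear (an_fun x).
Proof.
move=> c g h; apply/ffunP => S; rewrite !ffunE; rewrite !regZ; case: ifP => _; ring.
Qed.
Definition cr x : endo grass := Endo (cr_linear x).
Definition an x : endo grass := Endo (an_linear x).

Lemma cr_cr x y : cr x * cr y = - (cr y * cr x).
Proof.
apply/endoP => g; apply/ffunP => S; rewrite !endoE ffunE [RHS]ffunE !ffunE.
have [->|xy] := eqVneq x y.
  by rewrite !inE eqxx /= !mulr0 !if_same oppr0.
have yx : y != x by rewrite eq_sym.
case: (boolP (x \in S)) => xS; case: (boolP (y \in S)) => yS;
  rewrite ?inE ?xy ?yx ?xS ?yS /= ?(negbTE xS) ?(negbTE yS) ?mulr0 ?oppr0 //.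
rewrite !mulrA (nbeforeD1 x yS) (nbeforeD1 y xS) (before_asym xy).
rewrite setDDl setUC -setDDl !exprD.
by case: (before x y); rewrite /= ?expr0 ?expr1; ring.
Qed.

Lemma an_cr x y : an x * cr y = (x == y)%:R *: (1 : endo grass) - cr y * an x.
Proof.
apply/endoP => g; apply/ffunP => S; rewrite !endoE !ffunE.
have [->|xy] := eqVneq x y.
  case: (boolP (y \in S)) => yS; rewrite !inE eqxx /=.
    rewrite !setD1K // (nbeforeD1 y yS) beforexx add0n regZ.
    by rewrite mulrA -exprMn mulrNN mulr1 expr1n; ring.
  rewrite setU1K // mulrA nbeforeU1 // beforexx add0n regZ.
  by rewrite -exprMn mulrNN mulr1 expr1n; ring.
have yx : y != x by rewrite eq_sym.
case: (boolP (x \in S)) => xS; case: (boolP (y \in S)) => yS;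
  rewrite ?inE ?xy ?yx ?xS ?yS /= ?(negbTE xS) ?(negbTE yS) /=;
  rewrite ?(negbTE yx) ?orbT ?(mulr0, mul0r, scale0r, oppr0, addr0, subr0, add0r) /= ?mulr0 //.
have -> : (x |: S) :\ y = x |: (S :\ y).
  by apply/setP => z; rewrite !inE; case: (eqVneq z x) => [->|] /=; rewrite ?xy ?andbT ?orbF.
rewrite nbeforeU1 // (nbeforeD1 x yS) (before_asym xy) !exprD.
by case: (before x y); rewrite /= ?expr0 ?expr1; ring.
Qed.

Definition bas S : grass := [ffun T : {set X} => (T == S)%:R].

Lemma cr_bas x S : x \notin S -> cr x (bas S) = (-1) ^+ nbefore x S *: bas (x |: S).
Proof.
move=> xS; apply/ffunP => T; rewrite !ffunE; case: ifP => xT; last first.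
  by case: eqP => [h|_]; [rewrite h setU11 in xT|rewrite scaler0].
have -> : (T :\ x == S) = (T == x |: S).
  by apply/eqP/eqP => [<-|->]; rewrite ?setD1K ?setU1K.
by case: eqP => [->|_]; rewrite ?mulr0 ?scaler0 // nbeforeU1 // beforexx.
Qed.

Lemma cr_bas0 x S : x \in S -> cr x (bas S) = 0.
Proof.
move=> xS; apply/ffunP => T; rewrite !ffunE; case: ifP => // xT.
by case: eqP => [h|_]; rewrite ?mulr0 //; rewrite -h !inE eqxx in xS.
Qed.

Lemma an_vac x : an x (bas set0) = 0.
Proof.
apply/ffunP => T; rewrite !ffunE; case: ifP => // xT; case: eqP => [h|_].
  by have := setU11 x T; rewrite h inE.
by rewrite mulr0.
Qed.

Lemma bas_rec x S : x \in S -> bas S = (-1) ^+ nbefore x S *: cr x (bas (S :\ x)).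
Proof.
move=> xS; rewrite cr_bas ?setD11 // scalerA (nbeforeD1 x xS) beforexx.
by rewrite -exprMn mulrNN mulr1 expr1n scale1r setD1K.
Qed.

Lemma grass_basis (g : grass) : g = \sum_S g S *: bas S.
Proof.
apply/ffunP => T; rewrite sum_ffunE (bigD1 T) //= !ffunE eqxx big1 ?addr0.
  by rewrite /GRing.scale /= mulr1.
by move=> S h; rewrite !ffunE eq_sym (negbTE h) scaler0.
Qed.

(** The creation operators generate everything from the vacuum. Two operators with the same exchange
    rule against them therefore agree as soon as they agree on the vacuum, and no other monomial has
    to be inspected. *)
Lemma cr_ind (T : endo grass) (c : C) :
  (forall x, T * cr x = c *: (cr x * T)) -> T (bas set0) = 0 -> T = 0.
Proof.
move=> hT h0; have hb k : forall S, (#|S| <= k)%N -> T (bas S) = 0.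
  elim: k => [|k IH] S; first by rewrite leqn0 cards_eq0 => /eqP->.
  have [->//|/set0Pn[x xS]] := eqVneq S set0.
  rewrite (cardsD1 x) xS ltnS => /IH h.
  have hx g : T (cr x g) = c *: cr x (T g) by have /endoP/(_ g) := hT x.
  by rewrite (bas_rec xS) linearZ /= hx h linear0 !scaler0.
apply/endoP => g; rewrite [g]grass_basis linear_sum big1 // => S _.
by rewrite linearZ /= (hb _ _ (leqnn _)) scaler0.
Qed.

End Fermions.
Arguments cr : simpl never.
Arguments an : simpl never.

(** Here A', B', Z' are the superbrackets of A, B, Z with D, and P, Q are those of A' with B and of
    A with B'. By the Jacobi identity the defect [A, B] - Z supercommutes with D, which is the form
    required by [cr_ind] when D is a creation operator. *)
Lemma super_jacobi (C : fieldType) (V : lmodType C) (A B D A' B' Z Z' P Q : endo V) (a b s : C) :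
  b * b = 1 ->
  A * D = a *: (D * A) + A' -> B * D = b *: (D * B) + B' ->
  Z * D = (a * b) *: (D * Z) + Z' ->
  A' * B - (s * b) *: (B * A') = P -> A * B' - (s * a) *: (B' * A) = Q ->
  b *: P + Q = Z' ->
  (A * B - s *: (B * A) - Z) * D = (a * b) *: (D * (A * B - s *: (B * A) - Z)).
Proof.
move=> bb hA hB hZ <- <- hZ'.
rewrite !mulrBl endoZl -!mulrA hA hB hZ -hZ' !mulrDr !endoZr !mulrA hA hB.
move/eqP: bb; rewrite -expr2 sqrf_eq1 => /orP[] /eqP ->; endo_ring.
Qed.

Section GrassmannModel.
Variables (C : fieldType) (m n : nat) (p q : C).
Notation I := 'I_(m + n).
Notation par := (@par m n).
Notation grass := {ffun {set (I * I)%type} -> C^o}.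
Notation cr := (@cr C (I * I)%type).
Notation an := (@an C (I * I)%type).

(** Bracketing a lowering element E_ac with an even E_ij moves (a, i) to (a, j) with a minus sign
    when i, j are even, and (j, c) to (i, c) when they are odd; [num0] (up to that sign) and [num1]
    realize these moves. *)
Definition num0 (i j : I) : endo grass := \sum_(a | par a) cr (a, j) * an (a, i).
Definition num1 (i j : I) : endo grass := \sum_(k | ~~ par k) cr (i, k) * an (j, k).

Lemma quad_cr x y z : cr x * an y * cr z = cr z * (cr x * an y) + (y == z)%:R *: cr x.
Proof.
by rewrite -mulrA an_cr mulrBr endoZr mulr1 !mulrA [cr x * cr z]cr_cr mulNr
  opprK addrC.
Qed.

Lemma num0_cr i j b c : num0 i j * cr (b, c) =
  cr (b, c) * num0 i j + (par b && (c == i))%:R *: cr (b, j).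
Proof.
rewrite /num0 mulr_suml mulr_sumr.
under eq_bigr do rewrite quad_cr.
rewrite big_split /=; congr (_ + _).
case: (boolP (par b)) => hb /=.
  rewrite (bigD1 b) //= xpair_eqE eqxx /= (eq_sym i) big1 ?addr0 //.
  by move=> a /andP[_ /negbTE h]; rewrite xpair_eqE h scale0r.
rewrite scale0r big1 // => a ha; rewrite xpair_eqE.
by case: eqP => [h|_]; [rewrite h (negbTE hb) in ha|rewrite scale0r].
Qed.

Lemma num1_cr i j b c : num1 i j * cr (b, c) =
  cr (b, c) * num1 i j + (~~ par c && (j == b))%:R *: cr (i, c).
Proof.
rewrite /num1 mulr_suml mulr_sumr.
under eq_bigr do rewrite quad_cr.
rewrite big_split /=; congr (_ + _).
case: (boolP (par c)) => hc /=.
  rewrite scale0r big1 // => a ha; rewrite xpair_eqE andbC.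
  by case: eqP => [h|_]; [rewrite h hc in ha|rewrite scale0r].
rewrite (bigD1 c) //= xpair_eqE eqxx andbT big1 ?addr0 //.
by move=> a /andP[_ /negbTE h]; rewrite xpair_eqE h andbF scale0r.
Qed.

(** The form is forced: the anticommutator with [cr (b, c)] has to produce the quadratic parts of
    E_bj and E_ic, and the vacuum has to be killed. *)
Definition cub (i j : I) : endo grass := \sum_(c | par c) num1 c j * an (c, i).

Lemma cub_cr i j b c : cub i j * cr (b, c) =
  - (cr (b, c) * cub i j) + (par b && (c == i))%:R *: num1 b j
  - (~~ par c && (j == b))%:R *: num0 i c.
Proof.
rewrite /cub mulr_suml mulr_sumr -sumrN.
have H a : num1 a j * an (a, i) * cr (b, c) = - (cr (b, c) * (num1 a j * an (a, i)))
    + (((a, i) == (b, c))%:R *: num1 a j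
    - (~~ par c && (j == b))%:R *: (cr (a, c) * an (a, i))).
  rewrite -mulrA an_cr mulrBr endoZr mulr1 !mulrA num1_cr mulrDl endoZl.
  by rewrite opprD addrCA !addrA.
under eq_bigr do rewrite H.
rewrite !big_split /= -addrA; congr (_ + (_ + _)); last first.
  by rewrite sumrN -scaler_sumr.
case: (boolP (par b)) => hb /=.
  rewrite (bigD1 b) //= xpair_eqE eqxx /= (eq_sym i) big1 ?addr0 //.
  by move=> a /andP[_ /negbTE h]; rewrite xpair_eqE h scale0r.
rewrite scale0r big1 // => a ha; rewrite xpair_eqE.
by case: eqP => [h|_]; [rewrite h (negbTE hb) in ha|rewrite scale0r].
Qed.

(** In the last case the scalar p of E_ii and the scalar -q of E_jj meet in the anticommutator with
    [cr (j, i)], whence the coefficient p - q. *)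
Definition mE (i j : I) : endo grass :=
  match par i, par j with
  | true, false => cr (i, j)
  | false, false => (p * (i == j)%:R) *: (1 : endo grass) - num0 i j
  | true, true => (- q * (i == j)%:R) *: (1 : endo grass) + num1 i j
  | false, true => (p - q) *: an (j, i) + cub i j
  end.

Lemma par_neqF i j : par i != par j -> (i == j) = false.
Proof. by apply: contraNF => /eqP->. Qed.

(** For a lowering pair (b, c) this is the relation of gl(m|n) between E_ij and E_bc. The Grassmann
    algebra has a generator for every pair of indices; those outside the lowering block merely
    supercommute with everything. *)
Lemma mE_cr i j b c : mE i j * cr (b, c) =
  (-1) ^+ (par i (+) par j) *: (cr (b, c) * mE i j) + (par b && ~~ par c)%:R *:
    ((j == b)%:R *: mE i c - ((-1) ^+ (par i (+) par j) * (c == i)%:R) *: mE b j).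
Proof.
rewrite /mE; case hi: (par i); case hj: (par j) => /=; rewrite ?expr0 ?expr1 ?scale1r.
- rewrite mulrDl mulrDr endoZl endoZr mulr1 mul1r num1_cr addrA; congr (_ + _).
  case hb: (par b); case hc: (par c) => /=; rewrite ?scale0r ?scale1r //.
    by rewrite (@par_neqF c i) ?hi ?hc // mulr0 scale0r subr0.
  by rewrite (@par_neqF j b) ?hj ?hb // scale0r.
- rewrite cr_cr scaleN1r -[LHS]addr0; congr (_ + _).
  case hb: (par b); case hc: (par c) => /=; rewrite ?scale0r ?scale1r //.
  by rewrite (@par_neqF j b) ?hj ?hb // (@par_neqF c i) ?hi ?hc // mulr0 !scale0r subr0.
- rewrite mulrDl mulrDr endoZl an_cr cub_cr endoZr xpair_eqE (eq_sym i c).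
  rewrite -mulnb natrM (eq_sym b j).
  have -> : (c == i) = ~~ par c && (c == i) by case: eqP => [->|]; rewrite ?hi ?andbF.
  have -> : (j == b) = par b && (j == b) by case: eqP => [<-|]; rewrite ?hj ?andbF.
  case hb: (par b); case hc: (par c) => /=; rewrite ?scale0r ?scale1r ?addr0;
    rewrite /= ?mulr0n ?mulr1n;
    move: (cub i j) (num1 b j) (num0 i c) (cr (b, c)) (an (j, i)) => ? ? ? ? ?; endo_ring.
- rewrite mulrBl mulrBr endoZl endoZr mulr1 mul1r num0_cr.
  have -> : (c == i) = ~~ par c && (c == i) by case: eqP => [->|]; rewrite ?hi ?andbF.
  have -> : (j == b) = ~~ par b && (j == b) by case: eqP => [<-|]; rewrite ?hj ?andbF.
  case hb: (par b); case hc: (par c); rewrite /= ?mulr0n ?mulr1n;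
    move: (num0 i j) (num0 i c) (num0 b j) (cr _) (cr (b, j)) => ? ? ? ? ?; endo_ring.
Qed.

Definition gl_br (i j k l : I) (s : C) : endo grass :=
  (j == k)%:R *: mE i l - (s * (l == i)%:R) *: mE k j.

Definition gl_sg (i j k l : I) : C :=
  (-1) ^+ ((par i (+) par j) && (par k (+) par l)).

Lemma num0_vac i j : num0 i j (bas C set0) = 0.
Proof. by rewrite endo_sumE big1 // => a _; rewrite endoME an_vac linear0. Qed.
Lemma num1_vac i j : num1 i j (bas C set0) = 0.
Proof. by rewrite endo_sumE big1 // => a _; rewrite endoME an_vac linear0. Qed.
Lemma cub_vac i j : cub i j (bas C set0) = 0.
Proof. by rewrite endo_sumE big1 // => a _; rewrite endoME an_vac linear0. Qed.

Lemma mE_vac i j : ~~ (par i && ~~ par j) ->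
  mE i j (bas C set0) = ((i == j)%:R * lam_pq p q i) *: bas C set0.
Proof.
rewrite /mE /lam_pq; case hi: (par i); case hj: (par j) => // _; rewrite !(endoDE, endoZE, endoNE, endo1E).
- by rewrite num1_vac addr0 mulrC.
- by rewrite an_vac cub_vac scaler0 addr0 par_neqF ?hi ?hj // mul0r scale0r.
- by rewrite num0_vac subr0 mulrC.
Qed.

End GrassmannModel.

Lemma endo_brl (C : fieldType) (V : lmodType C) (A U W : endo V) (ch d1 d2 b t : C) :
  ch *: (d1 *: U - (b * d2) *: W) * A - t *: (A * (ch *: (d1 *: U - (b * d2) *: W))) =
  (ch * d1) *: (U * A - t *: (A * U)) - b *: ((ch * d2) *: (W * A - t *: (A * W))).
Proof. endo_ring. Qed.

Lemma endo_brr (C : fieldType) (V : lmodType C) (A U W : endo V) (ch d1 d2 b t : C) :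
  A * (ch *: (d1 *: U - (b * d2) *: W)) - t *: (ch *: (d1 *: U - (b * d2) *: W) * A) =
  (ch * d1) *: (A * U - t *: (U * A)) - b *: ((ch * d2) *: (A * W - t *: (W * A))).
Proof. endo_ring. Qed.

(* The Jacobi identity of gl(m|n) on matrix units, with the Kronecker symbols
   as free parameters. *)
Lemma gl_jacobi (C : fieldType) (V : lmodType C) (u1 u2 u3 u4 u5 u6 : V)
    (ch a b s jb ck li ci jk lb : C) : b * b = 1 ->
  b *: (ch *: (jb *: (ck *: u2 - (s * b * li) *: u3) -
               (a * ci) *: (jk *: u4 - (s * b * lb) *: u5))) +
  ch *: (lb *: (jk *: u1 - (s * a * ci) *: u5) -
         (b * ck) *: (jb *: u2 - (s * a * li) *: u6)) =
  ch *: (jk *: (lb *: u1 - (a * b * ci) *: u4) -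
         (s * li) *: (jb *: u3 - (a * b * ck) *: u6)).
Proof.
by move/eqP; rewrite -expr2 sqrf_eq1 => /orP[] /eqP ->; lmod_ring.
Qed.

Section GrassmannModel.
Variables (C : fieldType) (m n : nat) (p q : C).
Notation I := 'I_(m + n).
Notation par := (@par m n).
Notation gl_br := (@gl_br C m n p q).
Notation gl_sg := (@gl_sg C m n).
Notation mE := (mE p q).
Notation grass := {ffun {set (I * I)%type} -> C^o}.
Notation cr := (@cr C (I * I)%type).
Notation an := (@an C (I * I)%type).

(** If one of the two elements is lowering, this is [mE_cr]. Otherwise both act on the vacuum by
    scalars, so the relation holds there, and by the Jacobi identity the difference of the two sides
    supercommutes with all creation operators; [cr_ind] concludes. *)
Lemma mE_rel i j k l :
  mE i j * mE k l - gl_sg i j k l *: (mE k l * mE i j) = gl_br i j k l (gl_sg i j k l).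
Proof.
have sgC i' j' k' l' : gl_sg i' j' k' l' = gl_sg k' l' i' j' by rewrite /gl_sg andbC.
have sg2 i' j' k' l' : gl_sg i' j' k' l' * gl_sg i' j' k' l' = 1.
  by rewrite /gl_sg -expr2 sqrr_sign.
have base i' j' k' l' : par k' && ~~ par l' ->
    mE i' j' * mE k' l' - gl_sg i' j' k' l' *: (mE k' l' * mE i' j') =
    gl_br i' j' k' l' (gl_sg i' j' k' l').
  move=> h; have /andP[hk hl] := h.
  rewrite {2 3}/mE hk (negbTE hl) mE_cr h scale1r /gl_br /gl_sg hk (negbTE hl) /= andbT.
  by rewrite addrAC subrr add0r.
have sym i' j' k' l' :
    mE k' l' * mE i' j' - gl_sg k' l' i' j' *: (mE i' j' * mE k' l') =
    gl_br k' l' i' j' (gl_sg k' l' i' j') ->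
    mE i' j' * mE k' l' - gl_sg i' j' k' l' *: (mE k' l' * mE i' j') =
    gl_br i' j' k' l' (gl_sg i' j' k' l').
  rewrite (sgC k') => h; have := sg2 i' j' k' l'.
  move: h; rewrite /gl_br; move: (gl_sg _ _ _ _) => s h ss.
  have -> : mE i' j' * mE k' l' = s *: (mE k' l' * mE i' j' -
     ((l' == i')%:R *: mE k' j' - (s * (j' == k')%:R) *: mE i' l')).
    by rewrite -h opprB addrC subrK scalerA ss scale1r.
  rewrite scalerBr addrAC subrr add0r scalerBr !scalerA mulrA ss mul1r opprB.
  done.
(* [d] is 0 on lowering, 1 on even and 2 on raising elements. Bracketing with a lowering element
   decreases it, so the brackets inside the Jacobi identity are covered by induction on the sum. *)
pose d (i j : I) := (~~ par i + par j)%N.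
move: {2}(_ + _)%N (leqnn (d i j + d k l)) => N.
elim: N i j k l => [|N IH] i j k l.
  rewrite leqn0 addn_eq0 => /andP[_]; rewrite /d; case hk: (par k); case hl: (par l) => // _.
  by apply: base; rewrite hk hl.
case: (boolP (par k && ~~ par l)) => [h _|hkl]; first exact: base.
case: (boolP (par i && ~~ par j)) => [h _|hij]; first by apply/sym/base.
move=> hN; apply/eqP; rewrite -subr_eq0; apply/eqP.
apply: (@cr_ind _ _ _ ((-1) ^+ (par i (+) par j) * (-1) ^+ (par k (+) par l))); last first.
  rewrite !(endoDE, endoNE, endoZE, endoME) (mE_vac p q hkl) (mE_vac p q hij) !endo_apZ (mE_vac p q hkl) (mE_vac p q hij).
  have -> : (j == k)%:R *: mE i l (bas C set0) =
      ((j == k)%:R * ((i == l)%:R * lam_pq p q i)) *: bas C set0.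
    case: eqP => [e|_]; last by rewrite mul0r !scale0r.
    rewrite mE_vac ?scalerA //; move: hij hkl; rewrite e.
    by case: (par i); case: (par k); case: (par l).
  have -> : (gl_sg i j k l * (l == i)%:R) *: mE k j (bas C set0) =
      (gl_sg i j k l * (l == i)%:R * ((k == j)%:R * lam_pq p q k)) *: bas C set0.
    case: eqP => [e|_]; last by rewrite mulr0 mul0r !scale0r.
    rewrite mE_vac ?scalerA //; move: hij hkl; rewrite e.
    by case: (par i); case: (par k); case: (par j).
  rewrite !scalerA -!scalerBl (eq_sym i l) (eq_sym k j); apply/eqP.
  rewrite scaler_eq0; apply/orP; left; apply/eqP.
  rewrite /gl_sg; case: (eqVneq i j) => [<-|ij]; last first.
    case: (eqVneq j k) => [e|_]; last by rewrite !mul0r !mulr0 !mul0r !subr0.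
    case: (eqVneq l i) => [e'|_]; last by rewrite !(mul0r, mulr0) !subr0.
    rewrite -e e' in hkl *; rewrite /lam_pq; move: hij hkl.
    by case: (par i); case: (par j) => //= _ _; rewrite ?expr0; ring.
  rewrite addbb /= expr0.
  case: (eqVneq i k) => [<-|_]; last by rewrite !(mul0r, mulr0); ring.
  by case: (eqVneq l i) => [_|_]; ring.
case=> b c.
set a : C := (-1) ^+ (par i (+) par j); set b' : C := (-1) ^+ (par k (+) par l).
pose ch : C := (par b && ~~ par c)%:R.
pose s := gl_sg i j k l.
have bb : b' * b' = 1 by rewrite -expr2 sqrr_sign.
rewrite -/s.
apply: (@super_jacobi _ _ _ _ _
  (ch *: ((j == b)%:R *: mE i c - (a * (c == i)%:R) *: mE b j))
  (ch *: ((l == b)%:R *: mE k c - (b' * (c == k)%:R) *: mE b l)) _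
  (ch *: ((j == k)%:R *: ((l == b)%:R *: mE i c - ((a * b') * (c == i)%:R) *: mE b l)
    - (s * (l == i)%:R) *: ((j == b)%:R *: mE k c - ((a * b') * (c == k)%:R) *: mE b j)))
  (ch *: ((j == b)%:R *: gl_br i c k l (s * b') - (a * (c == i)%:R) *: gl_br b j k l (s * b')))
  (ch *: ((l == b)%:R *: gl_br i j k c (s * a) - (b' * (c == k)%:R) *: gl_br i j b l (s * a)))
  ) => //.
- exact: mE_cr.
- exact: mE_cr.
- have H x y (c' : bool) : (c' -> (-1) ^+ (par x (+) par y) = a * b') ->
      c'%:R *: (mE x y * cr (b, c)) = c'%:R *: ((a * b') *: (cr (b, c) * mE x y) +
        ch *: ((y == b)%:R *: mE x c - (a * b' * (c == x)%:R) *: mE b y)).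
    by case: c' => h; [rewrite mE_cr h|rewrite !scale0r].
  rewrite /gl_br mulrBl !endoZl -[in LHS](scalerA s) !H; last 2 first.
  + by rewrite /a /b' => /eqP ->; case: (par i); case: (par k); case: (par j); rewrite /= ?expr0 ?expr1; ring.
  + by rewrite /a /b' => /eqP ->; case: (par i); case: (par k); case: (par l); rewrite /= ?expr0 ?expr1; ring.
  move: (mE i l) (mE k j) (mE i c) (mE b l) (mE k c) (mE b j) (cr (b, c)) => ? ? ? ? ? ? ?.
  by clearbody a b' s ch; endo_ring.
- have H x y (c' : bool) : (c' -> gl_sg x y k l = s * b' /\ (d x y < d i j)%N) ->
      c'%:R *: (mE x y * mE k l - (s * b') *: (mE k l * mE x y)) =
      c'%:R *: gl_br x y k l (s * b').
    case: c' => [[//|h1 h2]|_]; last by rewrite !scale0r.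
    by rewrite -h1 IH // -ltnS (leq_trans _ hN) // ltn_add2r.
  rewrite endo_brl.
  rewrite /ch -!natrM !mulnb !H.
  + by rewrite -!mulnb !natrM; move: (gl_br _ _ _ _ _) (gl_br _ _ _ _ _) => ? ?; endo_ring.
  + rewrite /s /b' /d /gl_sg => /andP[/andP[hb hc] /eqP <-]; rewrite hb (negbTE hc).
    case: (par j); case: (par k); case: (par l) => //=;
      rewrite ?expr0 ?expr1; split=> //; ring.
  + rewrite /s /b' /d /gl_sg => /andP[/andP[hb hc] /eqP ->]; rewrite hb (negbTE hc).
    case: (par i); case: (par k); case: (par l) => //=;
      rewrite ?expr0 ?expr1; split=> //; ring.
- have H x y (c' : bool) : (c' -> gl_sg i j x y = s * a /\ (d x y < d k l)%N) ->
      c'%:R *: (mE i j * mE x y - (s * a) *: (mE x y * mE i j)) =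
      c'%:R *: gl_br i j x y (s * a).
    case: c' => [[//|h1 h2]|_]; last by rewrite !scale0r.
    by rewrite -h1 IH // -ltnS (leq_trans _ hN) // ltn_add2l.
  rewrite endo_brr.
  rewrite /ch -!natrM !mulnb !H.
  + by rewrite -!mulnb !natrM; move: (gl_br _ _ _ _ _) (gl_br _ _ _ _ _) => ? ?; endo_ring.
  + rewrite /s /a /d /gl_sg => /andP[/andP[hb hc] /eqP <-]; rewrite hb (negbTE hc).
    case: (par i); case: (par j); case: (par l) => //=;
      rewrite ?expr0 ?expr1; split=> //; ring.
  + rewrite /s /a /d /gl_sg => /andP[/andP[hb hc] /eqP ->]; rewrite hb (negbTE hc).
    case: (par i); case: (par k); case: (par j) => //=;
      rewrite ?expr0 ?expr1; split=> //; ring.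
- exact: gl_jacobi.
Qed.

End GrassmannModel.

(** * Evaluation of the enveloping algebra in an endomorphism ring *)

Section Evaluation.
Local Open Scope fset_scope.
Local Open Scope ring_scope.
Variables (C : fieldType) (m n : nat).
Notation I := 'I_(m + n).
Variables (V : lmodType C) (t : I -> I -> endo V).
Notation tens := (tens_gl C m n).

Definition ev_word (w : {fmonom (I * I)%type}) : endo V :=
  \prod_(x <- (w : seq (I * I)%type)) t x.1 x.2.

Definition ev (x : tens) : endo V :=
  \sum_(w <- msupp x) mcoeff w x *: ev_word w.

Lemma ev_wider (d : {fset {fmonom (I * I)%type}}) (x : tens) :
  msupp x `<=` d -> ev x = \sum_(w <- d) mcoeff w x *: ev_word w.
Proof.
move=> le; rewrite [LHS](big_fset_incl _ le) => //= w wd /mcoeff_outdom ->.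
by rewrite scale0r.
Qed.

Lemma ev_is_zmod : zmod_morphism ev.
Proof.
move=> x y; pose d := msupp x `|` msupp y.
rewrite (@ev_wider d x) ?fsubsetUl // (@ev_wider d y) ?fsubsetUr //.
rewrite (@ev_wider d (x - y)) ?msuppB_le // -sumrB; apply: eq_bigr => w _.
by rewrite mcoeffB scalerBl.
Qed.

Lemma evB x y : ev (x - y) = ev x - ev y. Proof. exact: ev_is_zmod. Qed.
Lemma ev0 : ev 0 = 0. Proof. by have := evB 0 0; rewrite !subrr. Qed.
Lemma evD x y : ev (x + y) = ev x + ev y.
Proof. by rewrite -[y in LHS]opprK evB -[in - y]sub0r evB ev0 sub0r opprK. Qed.

Lemma evU c w : ev << c *g w >> = c *: ev_word w.
Proof. by rewrite (ev_wider msuppU_le) big_seq_fset1 mcoeffUU. Qed.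

Lemma evZ c (x : tens) : ev (c *: x) = c *: ev x.
Proof.
rewrite (ev_wider (msuppZ_le c x)) scaler_sumr; apply: eq_bigr => w _.
by rewrite mcoeffZ scalerA.
Qed.

Lemma ev1 : ev 1 = 1.
Proof. by rewrite evU scale1r /ev_word fm1 big_nil. Qed.

Lemma evM (x y : tens) : ev (x * y) = ev x * ev y.
Proof.
rewrite malgME (big_morph ev evD ev0) {2}/ev mulr_suml; apply: eq_bigr => w _.
rewrite (big_morph ev evD ev0) {2}/ev mulr_sumr; apply: eq_bigr => w' _.
by rewrite evU endoZl endoZr scalerA /ev_word fmM big_cat.
Qed.

Lemma ev_tE i j : ev (tE C i j) = t i j.
Proof. by rewrite evU scale1r /ev_word fmU big_seq1. Qed.

Hypothesis t_rel : forall i j k l,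
  t i j * t k l - gl_sg C i j k l *: (t k l * t i j) =
  (j == k)%:R *: t i l - (gl_sg C i j k l * (l == i)%:R) *: t k j.

Lemma ev_bracket (x y z w : tens) (s c d : C) :
  ev (x * y - s *: (y * x) - (c *: z - d *: w)) =
  ev x * ev y - s *: (ev y * ev x) - (c *: ev z - d *: ev w).
Proof.
have h : ev (c *: z - d *: w) = c *: ev z - d *: ev w by rewrite evB; congr (_ - _); exact: evZ.
have h' : ev (x * y - s *: (y * x)) = ev x * ev y - s *: (ev y * ev x).
  by rewrite evB; congr (_ - _); rewrite ?evZ evM.
by rewrite -h -h' -evB.
Qed.

Lemma ev_gl_rel i j k l : ev (gl_rel (@tE C m n) i j k l) = 0.
Proof.
rewrite /gl_rel ev_bracket !ev_tE.
by rewrite t_rel subrr.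
Qed.

Lemma ev_ideal (x : tens) : lspan (@gl_ideal C m n) x -> ev x = 0.
Proof.
elim=> [{}x [a [_ [b [[i [j [k [l ->]]]] ->]]]]||x' y _ hx _ hy|c x' _ hx].
- rewrite evM evM.
  by rewrite ev_gl_rel mulr0 mul0r.
- exact: ev0.
- by rewrite evD hx hy addr0.
- by rewrite evZ hx scaler0.
Qed.

Definition evU_gl (u : Ugl C m n) : endo V := ev (qrepr u).

Lemma evU_gl_pi (x : tens) : evU_gl (qpi (@gl_ideal C m n) x) = ev x.
Proof.
by apply/eqP; rewrite -subr_eq0 -evB; apply/eqP/ev_ideal/qrepr_qpi.
Qed.

Lemma evU_glD u v : evU_gl (u + v) = evU_gl u + evU_gl v.
Proof. by rewrite -[u]qreprK -[v]qreprK -qpiD !evU_gl_pi evD. Qed.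
Lemma evU_glZ c u : evU_gl (c *: u) = c *: evU_gl u.
Proof. by rewrite -[u]qreprK -qpiZ !evU_gl_pi evZ. Qed.
Lemma evU_glM u v : evU_gl (u * v) = evU_gl u * evU_gl v.
Proof.
rewrite -[u]qreprK -[v]qreprK.
have -> : (qpi (@gl_ideal C m n) (qrepr u) : Ugl C m n) * qpi (@gl_ideal C m n) (qrepr v)
  = qpi (@gl_ideal C m n) (qrepr u * qrepr v) by exact: qmulE.
by rewrite !evU_gl_pi evM.
Qed.
Lemma evU_gl1 : evU_gl 1 = 1.
Proof. by rewrite evU_gl_pi ev1. Qed.
Lemma evU_glE i j : evU_gl (E_gl C i j) = t i j.
Proof. by rewrite evU_gl_pi ev_tE. Qed.

End Evaluation.

(** * Induction and commutation relations in the enveloping algebra *)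

Section UglTheory.
Variables (C : fieldType) (m n : nat).
Notation I := 'I_(m + n).
Notation Ugl := (Ugl C m n).
Notation E_gl := (@E_gl C m n).

Definition upi (x : tens_gl C m n) : Ugl := qpi (@gl_ideal C m n) x.

Lemma upiD x y : upi (x + y) = upi x + upi y.
Proof. exact: qpiD. Qed.
Lemma upiZ c x : upi (c *: x) = c *: upi x.
Proof. exact: qpiZ. Qed.
Lemma upiM x y : upi (x * y) = upi x * upi y.
Proof. exact/esym/qmulE. Qed.
Lemma upiB x y : upi (x - y) = upi x - upi y.
Proof. by rewrite upiD -scaleN1r upiZ scaleN1r. Qed.
Lemma upi0 : upi 0 = 0.
Proof. by rewrite -[0 in LHS](scale0r 0) upiZ scale0r. Qed.
Lemma upi_tE i j : upi (tE C i j) = E_gl i j.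
Proof. by []. Qed.

Lemma Ugl_ind (P : Ugl -> Prop) : P 0 -> (forall u v, P u -> P v -> P (u + v)) ->
  (forall c u, P u -> P (c *: u)) -> P 1 ->
  (forall i j u, P u -> P (E_gl i j * u)) -> forall u, P u.
Proof.
move=> P0 PD PZ P1 PE u; rewrite -[u]qreprK; move: (qrepr u) => x.
rewrite -[qpi _ _]/(upi x).
rewrite (_ : x = \sum_(w <- msupp x) mcoeff w x *: << w >>); last first.
  rewrite [LHS]monalgE; apply: eq_bigr => w _; apply/malgP => k.
  by rewrite mcoeffZ !mcoeffU mulr_natr.
elim/big_rec: _ => [|w y _ hy]; first by rewrite upi0.
rewrite upiD upiZ; apply: PD => //; apply: PZ.
case: w => s; elim: s => [|[i j] s IH].
  suff -> : << FMonom [::] >> = 1 :> tens_gl C m n by [].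
  by congr (<< _ >>); rewrite -fmoneE.
have -> : << FMonom ((i, j) :: s) >> = tE C i j * << FMonom s >> :> tens_gl C m n.
  rewrite /tE malgM_def fgmulUU mulr1; congr (<< _ >>).
  by apply/eqP; rewrite fmP fmM fmU.
by rewrite upiM upi_tE; apply: PE.
Qed.

Lemma upi_bracket (x y z w : tens_gl C m n) (s c d : C) :
  upi (x * y - s *: (y * x) - (c *: z - d *: w)) =
  upi x * upi y - s *: (upi y * upi x) - (c *: upi z - d *: upi w).
Proof.
have h : upi (c *: z - d *: w) = c *: upi z - d *: upi w.
  rewrite upiB; apply: (congr2 (fun a b : Ugl => a - b)).
    exact: upiZ.
  exact: upiZ.
have h' : upi (x * y - s *: (y * x)) = upi x * upi y - s *: (upi y * upi x).
  rewrite upiB; apply: (congr2 (fun a b : Ugl => a - b)); first exact: upiM.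
  rewrite upiZ; apply: (congr1 (fun a : Ugl => s *: a)); exact: upiM.
rewrite -h -h'; exact: upiB.
Qed.

Lemma E_gl_rel i j k l : E_gl i j * E_gl k l = gl_sg C i j k l *: (E_gl k l * E_gl i j)
  + ((j == k)%:R *: E_gl i l - (gl_sg C i j k l * (l == i)%:R) *: E_gl k j).
Proof.
apply/eqP; rewrite addrC -subr_eq -subr_eq0 -!upi_tE -upi_bracket -upi0; apply/eqP.
apply/qpi_eqP; rewrite subr0; apply: lspan_gen; exists 1, (gl_rel (@tE C m n) i j k l), 1.
by split; [exists i, j, k, l|rewrite mul1r mulr1].
Qed.

End UglTheory.

(** * The Kac module *)

Section KacModule.
Variables (C : numFieldType) (m n : nat) (p q : C).
Notation I := 'I_(m + n).
Notation par := (@par m n).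
Notation K := (kac m n p q).
Notation Ugl := (Ugl C m n).
Notation E_gl := (@E_gl C m n).
Notation L0 := (@L0_char C m n p q).
Notation v := (v_pq m n p q).

Definition kpi (u : Ugl) : K := qpi (ind_rel L0) u.

Lemma kpiD u w : kpi (u + w) = kpi u + kpi w. Proof. exact: qpiD. Qed.
Lemma kpiZ c u : kpi (c *: u) = c *: kpi u. Proof. exact: qpiZ. Qed.
Lemma kpi_lin c a b : kpi (c *: a + b) = c *: kpi a + kpi b.
Proof. by rewrite kpiD kpiZ. Qed.
Lemma kpi_surj (y : K) : exists u, y = kpi u.
Proof. by exists (qrepr y); rewrite /kpi qreprK. Qed.
Lemma kact_pi u w : kact u (kpi w) = kpi (u * w). Proof. exact: ind_actE. Qed.
Lemma kpi1 : kpi 1 = v. Proof. by []. Qed.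
Lemma kpi_rel u a c : L0 a c -> kpi (u * a) = c *: kpi u.
Proof.
by move=> h; rewrite -kpiZ; apply/qpi_eqP/lspan_gen; exists u, a, c.
Qed.

Lemma kact_lin u c (y z : K) : kact u (c *: y + z) = c *: kact u y + kact u z.
Proof.
have [y' ->] := kpi_surj y; have [z' ->] := kpi_surj z.
apply: (etrans (congr1 (kact u) (esym (kpi_lin c y' z')))).
rewrite kact_pi mulrDr kpiD -scalerAr kpiZ.
by apply: (congr2 (fun s t : K => c *: s + t)); apply/esym/kact_pi.
Qed.

Definition kE i j : endo K := Endo (kact_lin (E_gl i j)).

Lemma kE_pi i j w : kE i j (kpi w) = kpi (E_gl i j * w).
Proof. exact: kact_pi. Qed.

Lemma kpiN a : kpi (- a) = - kpi a.
Proof. by rewrite -scaleN1r kpiZ scaleN1r. Qed.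
Lemma kpiB a b : kpi (a - b) = kpi a - kpi b.
Proof. by rewrite kpiD kpiN. Qed.

Lemma kpi_relation (A B D F w : Ugl) (a b c : C) : A = a *: B + (b *: D - c *: F) ->
  kpi (A * w) = a *: kpi (B * w) + (b *: kpi (D * w) - c *: kpi (F * w)).
Proof.
move=> ->; rewrite mulrDl mulrBl kpiD kpiB.
have Z (e : C) (U : Ugl) : kpi (e *: U * w) = e *: kpi (U * w).
  by rewrite -scalerAl kpiZ.
by apply: congr2; [exact: Z|apply: (congr2 (fun s t : K => s - t)); exact: Z].
Qed.

Lemma kE_relP i j k l y : kE i j (kE k l y) = gl_sg C i j k l *: kE k l (kE i j y)
  + ((j == k)%:R *: kE i l y - (gl_sg C i j k l * (l == i)%:R) *: kE k j y).
Proof.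
have [w ->] := kpi_surj y.
rewrite (kE_pi k l w) (kE_pi i j w) (kE_pi i l w) (kE_pi k j w).
rewrite (kE_pi i j (E_gl k l * w)) (kE_pi k l (E_gl i j * w)) !mulrA.
exact: (kpi_relation w (E_gl_rel C i j k l)).
Qed.

Lemma kE_v i j : ~~ (par i && ~~ par j) ->
  kE i j v = ((i == j)%:R * lam_pq p q i) *: v.
Proof.
move=> h; rewrite -kpi1 kE_pi mulr1 -[E_gl i j]mul1r (@kpi_rel _ _ ((i == j)%:R * lam_pq p q i)) //.
by exists i, j.
Qed.

Lemma kac_ind (P : K -> Prop) : P 0 -> (forall y z, P y -> P z -> P (y + z)) ->
  (forall c y, P y -> P (c *: y)) -> P v ->
  (forall i j y, P y -> P (kE i j y)) -> forall y, P y.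
Proof.
move=> P0 PD PZ Pv PE y; have [u ->] := kpi_surj y.
elim/Ugl_ind: u => [|u w hu hw|c u hu||i j u hu].
- by rewrite -[0](scale0r 0) kpiZ scale0r.
- by rewrite kpiD; apply: PD.
- by rewrite kpiZ; apply: PZ.
- by rewrite kpi1.
- by rewrite -kE_pi; apply: PE.
Qed.

Definition kphi (y : K) : {ffun {set (I * I)%type} -> C^o} :=
  evU_gl (mE p q) (qrepr y) (bas C set0).

(** The vacuum satisfies the relations imposed on the highest weight vector, so the value does not
    depend on the representative chosen by [qrepr]; this is the universal property of the induced
    module. *)
Lemma kphi_pi u : kphi (kpi u) = evU_gl (mE p q) u (bas C set0).
Proof.
have E := @evU_glE C m n _ (mE p q) (@mE_rel C m n p q).
have D := @evU_glD C m n _ (mE p q) (@mE_rel C m n p q).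
have Z := @evU_glZ C m n _ (mE p q) (@mE_rel C m n p q).
have M := @evU_glM C m n _ (mE p q) (@mE_rel C m n p q).
suff H x : lspan (ind_rel L0) x -> evU_gl (mE p q) x (bas C set0) = 0.
  have := H _ (qrepr_qpi (ind_rel L0) u); rewrite -scaleN1r D Z endoDE endoZE.
  by rewrite scaleN1r => /eqP; rewrite subr_eq0 => /eqP.
elim=> [_ [w [_ [c [[i [j [h -> ->]]] ->]]]]||y z _ hy _ hz|c y _ hy].
- rewrite -scaleNr D Z M E endoDE endoME endoZE mE_vac //.
  by rewrite endo_apZ scaleNr subrr.
- by rewrite -[0](scale0r 0) Z scale0r.
- by rewrite D endoDE hy hz addr0.
- by rewrite Z endoZE hy scaler0.
Qed.

Fact kphi_linear : linear kphi.
Proof.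
move=> c y z; have [[y' ->] [z' ->]] := (kpi_surj y, kpi_surj z).
rewrite -kpiZ -kpiD !kphi_pi (evU_glD (@mE_rel C m n p q)).
by rewrite (evU_glZ (@mE_rel C m n p q)).
Qed.
HB.instance Definition _ := GRing.isLinear.Build C K _ *:%R kphi kphi_linear.

Lemma kphi_v : kphi v = bas C set0.
Proof. by rewrite -kpi1 kphi_pi (evU_gl1 (@mE_rel C m n p q)). Qed.

Lemma kphi_E i j y : kphi (kE i j y) = mE p q i j (kphi y).
Proof.
have [w ->] := kpi_surj y; rewrite kE_pi !kphi_pi.
by rewrite (evU_glM (@mE_rel C m n p q)) (evU_glE (@mE_rel C m n p q)).
Qed.

End KacModule.

(** * Words in the lowering elements and injectivity of the Grassmann realization *)

Section SpanningWords.
Variables (C : numFieldType) (m n : nat) (p q : C).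
Notation I := 'I_(m + n).
Notation par := (@par m n).
Notation cr := (@cr C (I * I)%type).
Notation an := (@an C (I * I)%type).
Variables (K : lmodType C) (kE : I -> I -> endo K) (v : K).
Variable phi : {linear K -> {ffun {set (I * I)%type} -> C^o}}.
Hypothesis kE_rel : forall i j k l y,
  kE i j (kE k l y) = gl_sg C i j k l *: kE k l (kE i j y)
  + ((j == k)%:R *: kE i l y - (gl_sg C i j k l * (l == i)%:R) *: kE k j y).
Hypothesis kE_v : forall i j, ~~ (par i && ~~ par j) ->
  kE i j v = ((i == j)%:R * lam_pq p q i) *: v.
Hypothesis kac_ind : forall P : K -> Prop,
  P 0 -> (forall y z, P y -> P z -> P (y + z)) -> (forall c y, P y -> P (c *: y)) ->
  P v -> (forall i j y, P y -> P (kE i j y)) -> forall y, P y.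
Hypothesis phi_v : phi v = bas C set0.
Hypothesis phi_E : forall i j y, phi (kE i j y) = mE p q i j (phi y).

Definition lower : {set (I * I)%type} := [set x | par x.1 && ~~ par x.2].

Definition fword (l : seq (I * I)%type) : K := foldr (fun x => kE x.1 x.2) v l.

Lemma kE_anti x y z : x \in lower -> y \in lower ->
  kE x.1 x.2 (kE y.1 y.2 z) = - kE y.1 y.2 (kE x.1 x.2 z).
Proof.
rewrite !inE => /andP[x1 x2] /andP[y1 y2].
rewrite kE_rel /gl_sg x1 y1 (negbTE x2) (negbTE y2) /= expr1 scaleN1r.
by rewrite !par_neqF ?x1 ?y1 ?(negbTE x2) ?(negbTE y2) // mulr0 !scale0r subrr addr0.
Qed.

Lemma kE_sq x z : x \in lower -> kE x.1 x.2 (kE x.1 x.2 z) = 0.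
Proof.
move=> hx; have := kE_anti z hx hx; move: (kE _ _ _) => y /eqP.
rewrite -subr_eq0 opprK -mulr2n -scaler_nat scaler_eq0 pnatr_eq0 /=.
by move/eqP.
Qed.

Lemma fword_move l1 x l2 : all (mem lower) (l1 ++ x :: l2) ->
  fword (l1 ++ x :: l2) = (-1) ^+ size l1 *: fword (x :: l1 ++ l2).
Proof.
elim: l1 => [|y l1 IH] /=; first by rewrite scale1r.
move=> /andP[hy hl]; rewrite IH //= endo_apZ kE_anti //.
  by rewrite exprS mulN1r scalerN scaleNr.
by move: hl; rewrite all_cat => /and3P[].
Qed.

Lemma fword_dup l : all (mem lower) l -> ~~ uniq l -> fword l = 0.
Proof.
elim: l => //= x l IH /andP[hx hl]; rewrite negb_and negbK.
case/orP=> [|/(IH hl) ->]; last by rewrite endo_ap0.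
move=> xl; move: hl; case/splitPr: xl => l1 l2 hl; rewrite fword_move //= endo_apZ kE_sq //.
by rewrite scaler0.
Qed.

Lemma fword_perm l l' : all (mem lower) l -> perm_eq l l' ->
  exists k : nat, fword l = (-1) ^+ k *: fword l'.
Proof.
elim: l' l => [|x l' IH] l hl hp.
  by move/perm_nilP: hp => ->; exists 0%N; rewrite scale1r.
have xl : x \in l by rewrite (perm_mem hp) mem_head.
case/splitPr: xl hl hp => l1 l2 hl hp.
have hp' : perm_eq (l1 ++ l2) l'.
  rewrite -(perm_cons x); apply: perm_trans hp.
  by rewrite -[x :: l1 ++ l2]/([:: x] ++ l1 ++ l2) -[x :: l2]cat1s perm_catCA.
have hl' : all (mem lower) (l1 ++ l2).
  by move: hl; rewrite !all_cat /= => /and3P[-> _ ->].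
have [k hk] := IH _ hl' hp'.
by exists (size l1 + k)%N; rewrite fword_move //= hk endo_apZ scalerA exprD.
Qed.

Let W := lspan (fun y => exists l, all (mem lower) l /\ y = fword l).

(** Commuting E_ij past the first lowering element leaves brackets acting on a shorter word; on the
    empty word E_ij is either lowering or a scalar. *)
Lemma kE_fword l i j : all (mem lower) l -> W (kE i j (fword l)).
Proof.
elim: l i j => [|x l IH] i j /=.
  case: (boolP (par i && ~~ par j)) => [h _|h _].
    by apply: lspan_gen; exists [:: (i, j)]; rewrite /= andbT inE.
  rewrite kE_v //; apply/lspanZ/lspan_gen; exists [::]; split=> //.
case/andP=> hx hl; rewrite kE_rel.
apply: lspanD.
  apply: lspanZ; elim: (IH i j hl) => [y [l' [hl' ->]]||y z _ hy _ hz|c y _ hy].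
  - by apply: lspan_gen; exists (x :: l'); rewrite /= hx.
  - by rewrite endo_ap0; apply: lspan0.
  - by rewrite endo_apD; apply: lspanD.
  - by rewrite endo_apZ; apply: lspanZ.
apply: lspanD; first by apply/lspanZ/IH.
by rewrite -scaleNr; apply/lspanZ/IH.
Qed.

Lemma fword_span y : W y.
Proof.
elim/kac_ind: y => [|y z hy hz|c y hy||i j y hy].
- exact: lspan0.
- exact: lspanD.
- exact: lspanZ.
- by apply: lspan_gen; exists [::].
elim: hy => [_ [l [hl ->]]||{}y z _ hy _ hz|c {}y _ hy].
- exact: kE_fword.
- by rewrite endo_ap0; apply: lspan0.
- by rewrite endo_apD; apply: lspanD.
- by rewrite endo_apZ; apply: lspanZ.
Qed.

Lemma fword_sets y : exists c : {set (I * I)%type} -> C,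
  y = \sum_(S : {set (I * I)%type} | S \subset lower) c S *: fword (enum S).
Proof.
elim: (fword_span y) => [_ [l [hl ->]]||{}y z _ [c ->] _ [d ->]|a {}y _ [c ->]].
- case: (boolP (uniq l)) => hu; last first.
    exists (fun=> 0); rewrite fword_dup //.
    by rewrite big1 // => S _; rewrite scale0r.
  have hp : perm_eq l (enum [set x in l]).
    by apply: uniq_perm; rewrite ?enum_uniq // => x; rewrite mem_enum inE.
  have [k ->] := fword_perm hl hp.
  exists (fun S : {set (I * I)%type} => if S == [set x in l] then (-1) ^+ k else 0).
  rewrite (bigD1 [set x in l]) /=; last first.
    by apply/subsetP => x; rewrite inE => /(allP hl).
  rewrite eqxx big1 ?addr0 // => S /andP[_ /negbTE ->]; exact: scale0r.
- by exists (fun=> 0); rewrite big1 // => S _; rewrite scale0r.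
- exists (fun S => c S + d S); rewrite -big_split; apply: eq_bigr => S _.
  by rewrite scalerDl.
- exists (fun S => a * c S); rewrite scaler_sumr; apply: eq_bigr => S _.
  by rewrite scalerA.
Qed.

Lemma phi_lower x y : x \in lower -> phi (kE x.1 x.2 y) = cr x (phi y).
Proof.
rewrite inE => /andP[h1 h2]; rewrite phi_E /mE h1 (negbTE h2).
by case: x {h1 h2}.
Qed.

Lemma phi_fword l : all (mem lower) l -> uniq l ->
  exists k : nat, phi (fword l) = (-1) ^+ k *: bas C [set x in l].
Proof.
elim: l => [|x l IH] /=; first by exists 0%N; rewrite phi_v scale1r set_nil.
case/andP=> hx hl /andP[xl ul]; have [k hk] := IH hl ul.
exists (k + nbefore x [set y in l])%N.
by rewrite phi_lower // hk endo_apZ cr_bas ?inE // scalerA exprD set_cons.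
Qed.

Lemma phi_supp y (S : {set (I * I)%type}) : phi y S != 0 -> S \subset lower.
Proof.
have [c ->] := fword_sets y; rewrite linear_sum sum_ffunE => h.
apply: contraNT h => hS; rewrite big1 // => T hT; rewrite linearZ /=.
have hT' : all (mem lower) (enum T).
  by apply/allP => x; rewrite mem_enum => /(subsetP hT).
have [k ->] := phi_fword hT' (enum_uniq _); rewrite !ffunE set_enum.
by case: eqP => [e|_]; [rewrite e hT in hS|rewrite /GRing.scale /= !mulr0].
Qed.

(** The words indexed by the subsets of the lowering block span K and go, up to sign, to distinct
    basis monomials, so the coefficients of y can be read off. This is the Poincare-Birkhoff-Witt
    theorem for K. *)
Lemma phi_inj y : phi y = 0 -> y = 0.
Proof.
have [c ->] := fword_sets y => h; rewrite big1 // => T hT.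
have hT' (S : {set (I * I)%type}) : S \subset lower -> all (mem lower) (enum S).
  by move=> hS; apply/allP => x; rewrite mem_enum => /(subsetP hS).
suff -> : c T = 0 by rewrite scale0r.
move/ffunP: h => /(_ T); rewrite linear_sum sum_ffunE (bigD1 T) //= linearZ /=.
have [k ->] := phi_fword (hT' _ hT) (enum_uniq _); rewrite big1 => [|S /andP[hS ne]].
  rewrite addr0 !ffunE set_enum eqxx /GRing.scale /= mulr1 => /eqP.
  by rewrite mulf_eq0 signr_eq0 orbF => /eqP.
rewrite linearZ /=; have [k' ->] := phi_fword (hT' _ hS) (enum_uniq _).
by rewrite !ffunE set_enum eq_sym (negbTE ne) /GRing.scale /= !mulr0.
Qed.

End SpanningWords.

Lemma card_ord_lt (N k : nat) : (k <= N)%N -> #|[set c : 'I_N | (c < k)%N]| = k.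
Proof.
move=> kN; rewrite -sum1dep_card -(big_ord_widen N (fun=> 1%N) kN).
by rewrite sum1_card card_ord.
Qed.

(** * Typicality: singular vectors of the Grassmann model *)

Section Typicality.
Variables (C : fieldType) (m n : nat) (p q : C).
Notation I := 'I_(m + n).
Notation par := (@par m n).
Notation X := (I * I)%type.
Notation cr := (@cr C X).
Notation an := (@an C X).
Notation bas := (@bas C X).
Notation grass := {ffun {set X} -> C^o}.
Notation mE := (mE p q).
Notation lower := (lower m n).
Implicit Types (S T : {set X}).

Lemma an_bas x S : x \in S -> an x (bas S) = (-1) ^+ nbefore x S *: bas (S :\ x).
Proof.
move=> xS; rewrite (bas_rec C xS) endo_apZ; congr (_ *: _).
rewrite -endoME an_cr eqxx scale1r endoDE endo1E endoNE endoME.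
suff -> : an x (bas (S :\ x)) = 0 by rewrite endo_ap0 subr0.
apply/ffunP => T; rewrite !ffunE; case: ifP => // xT.
by case: eqP => [e|_]; rewrite ?mulr0 //; have := setU11 x T; rewrite e !inE eqxx.
Qed.

Lemma an_bas0 x S : x \notin S -> an x (bas S) = 0.
Proof.
move=> xS; apply/ffunP => T; rewrite !ffunE; case: ifP => // xT.
by case: eqP => [e|_]; rewrite ?mulr0 //; have := setU11 x T; rewrite e (negbTE xS).
Qed.

Lemma cr_an_bas x S : x \in S -> cr x (an x (bas S)) = bas S.
Proof. by move=> xS; rewrite an_bas // endo_apZ -bas_rec. Qed.

(** Lexicographic order with the even index x.2 first, encoded in one number since x.1 < m + n. *)
Definition key (x : X) : nat := (x.2 * (m + n) + x.1)%N.

Lemma key_lt (x y : X) : (key x < key y)%N = (x.2 < y.2)%N || ((x.2 == y.2) && (x.1 < y.1)%N).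
Proof.
case: x y => [a i] [b j]; rewrite /key /=; have ha := ltn_ord a; have hb := ltn_ord b.
have -> : (i == j) = (i == j :> nat) by [].
apply/idP/idP; nia.
Qed.

Definition initial S := S \subset lower /\
  forall x y, x \in S -> y \in lower -> (key y < key x)%N -> y \in S.

(* Removing the last box (a, i) of an initial segment: among the terms of the
   cubic part of e_ia only those moving along row i or column a survive, so
   the scalar is the content p - q - (a - m) + i (rows and columns from 0). *)
Lemma mE_remove S a i : initial S -> (a, i) \in S ->
    (forall x, x \in S -> (key x <= key (a, i))%N) ->
  mE i a (bas S) = (p - q - (a - m)%:R + i%:R) *: an (a, i) (bas S).
Proof.
case=> /fintype.subsetP sub ini aiS maxS; have /andP[ha hi] : par a && ~~ par i.
  by have := sub _ aiS; rewrite inE.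
have max2 x : x \in S -> (x.2 < i)%N || ((x.2 == i) && (x.1 <= a)%N).
  move=> /maxS; rewrite leqNgt key_lt /= negb_or -leqNgt => /andP[].
  by rewrite leq_eqVlt => /orP[/eqP/val_inj -> |-> //]; rewrite eqxx ltnn /= -leqNgt.
have term c k : par c -> ~~ par k ->
    cr (c, k) (an (a, k) (an (c, i) (bas S))) =
    ((c == a) && (k < i)%N)%:R *: an (a, i) (bas S) -
    ((c < a)%N && (k == i))%:R *: an (a, i) (bas S).
  move=> hc hk; case: (eqVneq k i) => [->|ki]; last first.
    rewrite andbF scale0r subr0; case: (eqVneq c a) => [->|ca]; rewrite ?andTb ?andFb.
      rewrite an_bas // !endo_apZ scalerA mulrC -scalerA; congr (_ *: _).
      case: (ltnP k i) => hki; rewrite ?scale1r ?scale0r.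
        rewrite cr_an_bas // !inE xpair_eqE negb_and ki orbT andTb.
        by apply: (ini (a, i)) => //; rewrite ?inE /= ?ha ?hk // key_lt /= hki.
      rewrite an_bas0 ?endo_ap0 // !inE; apply/negP => /andP[_ /max2 /=].
      by rewrite ltnNge hki (negbTE ki).
    rewrite scale0r; case: (boolP ((c, i) \in S)) => ciS; last by rewrite an_bas0 ?endo_ap0.
    rewrite an_bas // !endo_apZ.
    case: (boolP ((a, k) \in S :\ (c, i))) => akS; last by rewrite an_bas0 // endo_ap0 scaler0.
    rewrite an_bas // !endo_apZ cr_bas0 ?scaler0 // !inE !xpair_eqE (negbTE ca) (negbTE ki) andbF /=.
    move: akS; rewrite !inE => /andP[_ /max2 /=]; rewrite (negbTE ki) orbF => hki.
    by apply: (ini (a, i)) => //; rewrite ?inE /= ?hc ?hk // key_lt /= hki.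
  rewrite ltnn andbF scale0r sub0r andbT.
  case: (eqVneq c a) => [->|ca].
    rewrite ltnn scale0r oppr0 [an _ (bas S)]an_bas // !endo_apZ an_bas0 ?endo_ap0 ?scaler0 //.
    by rewrite !inE eqxx.
  have ciS : ((c, i) \in S) = (c < a)%N.
    apply/idP/idP => [/max2 /=|h].
      rewrite ltnn eqxx /= leq_eqVlt => /orP[/eqP/val_inj e|//].
      by rewrite e eqxx in ca.
    by apply: (ini (a, i)) => //; rewrite ?inE /= ?hc ?hi // key_lt /= eqxx h orbT.
  rewrite -ciS; case: (boolP ((c, i) \in S)) => h; last first.
    by rewrite an_bas0 // !endo_ap0 scale0r oppr0.
  rewrite scale1r -[in RHS](cr_an_bas h) -!endoME.
  have -> : an (a, i) * cr (c, i) = - (cr (c, i) * an (a, i)).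
    by rewrite an_cr xpair_eqE eq_sym (negbTE ca) scale0r sub0r.
  by rewrite !endoE opprK.
have {1}-> : mE i a = (p - q) *: an (a, i) + cub C i a by rewrite /mE ha (negbTE hi).
have -> : p - q - (a - m)%:R + i%:R = (p - q) + (i%:R - (a - m)%:R) by ring.
rewrite endoDE endoZE [in RHS]scalerDl; congr (_ + _).
rewrite endo_sumE.
have -> : \sum_(c | par c) (num1 C c a * an (c, i)) (bas S) =
  (\sum_(c | par c) \sum_(k | ~~ par k) (((c == a) && (k < i)%N)%:R -
    ((c < a)%N && (k == i))%:R : C)) *: an (a, i) (bas S).
  rewrite scaler_suml; apply: eq_bigr => c hc.
  rewrite endoME endo_sumE scaler_suml; apply: eq_bigr => k hk.
  by rewrite endoME term // scalerBl.
have e1 : \sum_(c | par c) \sum_(k | ~~ par k) ((c == a) && (k < i)%N)%:R = i%:R :> C.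
  rewrite (bigD1 a) //= [X in _ + X]big1 ?addr0 => [|c /andP[_ /negbTE h]]; last first.
    by rewrite big1 // => k _; rewrite h.
  rewrite eqxx /= -natr_sum; congr _%:R; rewrite -[RHS](@card_ord_lt (m + n)) 1?ltnW //.
  rewrite -sum1dep_card big_mkcond [RHS]big_mkcond; apply: eq_bigr => k _.
  case: (ltnP k i) => h; last by rewrite if_same.
  by rewrite -ltnNge (leq_trans h) // ltnW // ltnNge.
have e2 : \sum_(c | par c) \sum_(k | ~~ par k) ((c < a)%N && (k == i))%:R = (a - m)%:R :> C.
  rewrite exchange_big (bigD1 i) //= [X in _ + X]big1 ?addr0 => [|c /andP[_ /negbTE h]]; last first.
    by rewrite big1 // => k _; rewrite h andbF.
  under eq_bigr do rewrite eqxx andbT.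
  rewrite -natr_sum; congr _%:R; apply: (@addIn m); rewrite subnK //.
  rewrite -[RHS](@card_ord_lt (m + n)) 1?ltnW // -[X in (_ + X)%N](@card_ord_lt (m + n) m) ?leq_addr //.
  rewrite -!sum1dep_card [RHS](bigID par) /=; congr (_ + _)%N.
    by rewrite [RHS]big_mkcondl; apply: eq_bigr => c _; case: (c < a)%N.
  apply: eq_bigl => c; rewrite /par -ltnNge andbC.
  by case: (ltnP c m) => // h; rewrite (leq_trans h).
under eq_bigr do rewrite sumrB.
by rewrite sumrB e1 e2.
Qed.

Lemma initial_remove S x : initial S -> x \in S ->
  (forall y, y \in S -> (key y <= key x)%N) -> initial (S :\ x).
Proof.
case=> /fintype.subsetP sub ini xS maxS; split.
  by apply/fintype.subsetP => y; rewrite !inE => /andP[_ /sub]; rewrite inE.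
move=> y z; rewrite !inE => /andP[yx yS] zl zy; rewrite (ini y) ?inE // andbT.
by apply: contraTneq zy => ->; rewrite -leqNgt maxS.
Qed.

(** Level k consists of the vectors killed by all products of k raising elements; level 1 is the
    space of vectors killed by g_1. *)
Fixpoint inv_filtration (k : nat) (g : grass) : Prop :=
  if k is k'.+1 then
    forall i a, ~~ par i -> par a -> inv_filtration k' (mE i a g)
  else g = 0.

Lemma invfZ k c g : inv_filtration k g -> inv_filtration k (c *: g).
Proof.
elim: k g => [|k IH] g /= h; first by rewrite h scaler0.
by move=> i a hi ha; rewrite endo_apZ; apply/IH/h.
Qed.

Lemma invfD k g g' :
  inv_filtration k g -> inv_filtration k g' -> inv_filtration k (g + g').
Proof.
elim: k g g' => [|k IH] g g' /= h h'; first by rewrite h h' addr0.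
by move=> i a hi ha; rewrite endo_apD; apply: IH; [apply: h|apply: h'].
Qed.

Lemma invf0 k : inv_filtration k 0.
Proof. by elim: k => //= k IH i a _ _; rewrite endo_ap0. Qed.

Lemma mE_relP (i j k l : I) g : mE i j (mE k l g) = gl_sg C i j k l *: mE k l (mE i j g)
  + ((j == k)%:R *: mE i l g - (gl_sg C i j k l * (l == i)%:R) *: mE k j g).
Proof.
have /endoP/(_ g) := mE_rel p q i j k l; rewrite !(endoDE, endoZE, endoNE, endoME).
by move/eqP; rewrite subr_eq addrC => /eqP.
Qed.

Lemma invf_even k (i j : I) g : par i = par j ->
  inv_filtration k g -> inv_filtration k (mE i j g).
Proof.
elim: k g => [|k IH] g hij /= h; first by rewrite h endo_ap0.
move=> l a hl ha; rewrite mE_relP; apply: invfD; first by apply/invfZ/IH/h.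
apply: invfD.
  case: eqP => [e|_]; last by rewrite scale0r; apply: invf0.
  by apply/invfZ/h => //; rewrite -hij -e.
rewrite -scaleNr; case: eqP => [e|_]; last by rewrite mulr0 oppr0 scale0r; apply: invf0.
by apply/invfZ/h => //; rewrite hij e.
Qed.

(** The bracket of a raising and a lowering element is even, and even elements preserve each level;
    so a lowering element costs exactly one level. *)
Lemma invf_cr k x g : x \in lower ->
  inv_filtration k g -> inv_filtration k.+1 (cr x g).
Proof.
rewrite inE => /andP[hx1 hx2].
have -> : cr x = mE x.1 x.2 by rewrite /mE hx1 (negbTE hx2); case: x {hx1 hx2}.
elim: k g => [|k IH] g h; first by move=> i a _ _ /=; rewrite h !endo_ap0.
move=> i a hi ha; rewrite mE_relP; apply: invfD; first by apply/invfZ/IH/h.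
apply: invfD.
  case: eqP => [e|_]; last by rewrite scale0r; apply: invf0.
  by apply/invfZ/invf_even => //; rewrite (negbTE hi) (negbTE hx2).
rewrite -scaleNr; case: eqP => [e|_]; last by rewrite mulr0 oppr0 scale0r; apply: invf0.
by apply/invfZ/invf_even => //; rewrite ha hx1.
Qed.

Hypothesis typical : forall a b : nat, (a < n)%N -> (b < m)%N ->
  p - q - a%:R + b%:R != 0.

(** Removing the boxes of S in decreasing order of [key] keeps the set initial and multiplies by
    nonzero scalars, so a product of #|S| raising elements sends [bas S] to a nonzero multiple of
    the vacuum. *)
Lemma initial_not_inv S : initial S -> ~ inv_filtration #|S| (bas S).
Proof.
move: {2}#|S| (erefl #|S|) => k; elim: k S => [|k IH] S hk hS; rewrite hk /=.
  move/eqP: hk; rewrite cards_eq0 => /eqP ->.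
  by move=> /ffunP /(_ set0); rewrite !ffunE eqxx => /eqP; rewrite oner_eq0.
have /set0Pn[x0 x0S] : S != set0 by rewrite -cards_eq0 hk.
pose x := [arg max_(x > x0 in S) key x].
have [xS maxx] : x \in S /\ forall y, y \in S -> (key y <= key x)%N.
  by rewrite /x; case: arg_maxnP.
move=> h; have [/fintype.subsetP sub _] := hS; have := sub _ xS; rewrite inE => /andP[hx1 hx2].
have := h x.2 x.1 hx2 hx1; have ex : x = (x.1, x.2) by case: (x).
rewrite (mE_remove hS) -?ex // an_bas // scalerA.
set c := _ * _; have c0 : c != 0.
  rewrite mulf_neq0 ?signr_eq0 // typical //.
    have := ltn_ord x.1; move: hx1; rewrite /par; lia.
  by move: hx2; rewrite /par -ltnNge.
move/(@invfZ _ c^-1); rewrite scalerA mulVf // scale1r.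
have hc : #|S :\ x| = k by move: hk; rewrite (cardsD1 x) xS => -[].
by rewrite -{1}hc; apply: IH; last exact: initial_remove.
Qed.

Definition crs (l : seq X) (g : grass) : grass := foldr (fun x => cr x) g l.

Lemma crs_coef l g S : uniq l -> exists k : nat, crs l g S =
  if all (mem S) l then (-1) ^+ k * g (S :\: [set x in l]) else 0.
Proof.
elim: l S => [|x l IH] S /=; first by exists 0%N; rewrite mul1r set_nil setD0.
case/andP=> xl ul; rewrite ffunE; case: ifP => xS; last by exists 0%N.
have [k ->] := IH (S :\ x) ul; exists (nbefore x S + k)%N.
have -> : all (mem (S :\ x)) l = all (mem S) l.
  apply: eq_in_all => y yl /=; rewrite !inE; case: eqP => // e; by rewrite -e yl in xl.
case: ifP => _; last by rewrite mulr0.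
by rewrite exprD mulrA setDDl set_cons setUC setUC.
Qed.

(* The typical Kac module has no singular vectors besides the highest weight
   line: a lowest-degree component of a singular vector can be raised to the
   top of the Grassmann algebra while staying in the filtration, which is
   incompatible with the nonvanishing of the product of all mE_remove scalars. *)
Lemma typical_singular (g : grass) :
    (forall S, g S != 0 -> S \subset lower) ->
    (forall i a, ~~ par i -> par a -> mE i a g = 0) -> g set0 = 0 -> g = 0.
Proof.
move=> supp sing g0; apply: contrapT => /eqP gn0.
have /existsP[S0 hS0] : [exists S : {set X}, g S != 0].
  apply: contraNT gn0; rewrite negb_exists => /forallP h.
  by apply/eqP/ffunP => S; rewrite ffunE; apply/eqP; rewrite -[_ == _]negbK.
have [S hS minS] : exists2 S, g S != 0 & forall T, g T != 0 -> (#|S| <= #|T|)%N.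
  by case: (@arg_minnP _ S0 (fun S => g S != 0) (fun S : {set X} => #|S|) hS0) => S; exists S.
have Sn0 : S != set0 by apply: contraNneq hS => ->; rewrite g0.
have Sl := supp _ hS.
pose l := enum (lower :\: S).
(* At T the product of creation operators reads g at T minus the created boxes. If that set lies in
   the support of g, it is contained in S, hence equal to S by minimality; so only the top monomial
   survives. *)
have [c [c0 hc]] : exists c : C, c != 0 /\ crs l g = c *: bas lower.
  have [k hk] := crs_coef g lower (enum_uniq (lower :\: S)).
  have hl : all (mem lower) l by apply/allP => x; rewrite mem_enum !inE => /andP[].
  rewrite hl set_enum setDDr setDv set0U (setIidPr Sl) in hk.
  exists (crs l g lower); split; first by rewrite hk mulf_neq0 // signr_eq0.
  apply/ffunP => T; rewrite !ffunE; case: eqP => [->|nT]; first by rewrite regZ mulr1.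
  rewrite regZ mulr0; have [k' ->] := crs_coef g T (enum_uniq (lower :\: S)).
  case: ifP => // /allP hT; apply/eqP; apply: contraT; rewrite mulf_eq0 signr_eq0 orFb set_enum.
  move=> hg; have sT := supp _ hg; have hcard := minS _ hg; case: nT.
  have lT : lower :\: S \subset T by apply/fintype.subsetP => x; rewrite -mem_enum => /hT.
  have TD : T :\: (lower :\: S) \subset S.
    apply/fintype.subsetP => x xT; have := fintype.subsetP sT _ xT.
    by move: xT; rewrite !in_setD; case: (x \in S) => //= + xl; rewrite xl.
  have /eqP eT : T :\: (lower :\: S) == S by rewrite eqEcard TD hcard.
  by rewrite -(setID T (lower :\: S)) eT (setIidPr lT) setUC -{1}(setIidPr Sl) setID.
have hinv k (l' : seq X) g' : {subset l' <= lower} -> inv_filtration k g' ->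
    inv_filtration (size l' + k) (crs l' g').
  move=> + hg'; elim: l' => [|x l' IH] hl'; first exact: hg'.
  apply: (@invf_cr (size l' + k)%N x (crs l' g')); first by apply: hl'; rewrite mem_head.
  by apply: IH => y hy; apply: hl'; rewrite inE hy orbT.
have hmono k g' : inv_filtration k g' -> inv_filtration k.+1 g'.
  elim: k g' => [|k IH] g'; first by move=> -> i a _ _; apply: endo_ap0.
  by move=> h i a hi ha; apply/IH/h.
have hmono' k k' g' : inv_filtration k g' -> inv_filtration (k' + k) g'.
  by move=> h; elim: k' => //= k' IH; apply: hmono.
have inil : initial lower by split.
apply: (initial_not_inv inil).
have -> : bas lower = c^-1 *: crs l g by rewrite hc scalerA mulVf // scale1r.
apply: invfZ.
have h1 : inv_filtration 1 g by [].
have := @hinv 1%N l g; move=> /(_ _ h1) h2.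
(* S is nonempty because g vanishes at the empty set. The level reached is thus at most the number
   of boxes of the full block, which contradicts [initial_not_inv]. *)
have hsize : (size l + 1 <= #|lower|)%N.
  rewrite -cardE cardsD (setIidPr Sl) addn1 ltn_subrL.
  have : (0 < #|S|)%N by rewrite card_gt0.
  by move=> hp; rewrite hp (leq_trans hp) // subset_leq_card.
rewrite -(subnK hsize); apply: hmono'; apply: h2.
by move=> x; rewrite mem_enum inE => /andP[].
Qed.

End Typicality.

(** * Affine Hecke operators *)

Section OperatorAlgebra.
Variables (C : numFieldType) (m n r : nat) (V : lmodType C).
Notation I := 'I_(m + n).
Notation par := (@par m n).
Notation sg := (@gl_sg C m n).
Implicit Type A : nat -> I -> I -> endo V.

(* The operators A a i j stand for E_ij acting on the tensor factor labelled a,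
   the factors 1, ..., r being copies of the natural module. *)
Record op_algebra A : Prop := OpAlgebra {
  op_super : forall a b i j k l, (a <= r)%N -> (b <= r)%N -> a != b ->
    A a i j * A b k l = sg i j k l *: (A b k l * A a i j);
  op_unit : forall a i j k l, (0 < a <= r)%N ->
    A a i j * A a k l = (j == k)%:R *: A a i l;
  op_gl : forall a i j k l, (a <= r)%N ->
    A a i j * A a k l = sg i j k l *: (A a k l * A a i j) +
      ((j == k)%:R *: A a i l - (sg i j k l * (l == i)%:R) *: A a k j);
  op_one : forall a, (0 < a <= r)%N -> \sum_i A a i i = 1 }.

Variable A : nat -> I -> I -> endo V.
Hypothesis H : op_algebra A.
Let A_super := op_super H.
Let A_unit := op_unit H.
Let A_gl := op_gl H.
Let A_one := op_one H.

Definition sp (j : I) : C := (-1) ^+ par j.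

Lemma sg2 i j k l : sg i j k l * sg i j k l = 1.
Proof. by rewrite /gl_sg -expr2 sqrr_sign. Qed.
Lemma sgC i j k l : sg i j k l = sg k l i j.
Proof. by rewrite /gl_sg andbC. Qed.
Lemma sgT i j k l : sg i j k l = sg i j l k.
Proof. by rewrite /gl_sg [par k (+) _]addbC. Qed.
Lemma sg_even i j k l : par i = par j -> sg i j k l = 1.
Proof. by move=> h; rewrite /gl_sg h addbb. Qed.
Lemma sg_pm i j k l : sg i j k l = 1 \/ sg i j k l = -1.
Proof. by rewrite /gl_sg; case: (_ && _); [right|left]. Qed.
Lemma sp_sg i k l : sp k * sg k i k l = sp l * sg k l i l.
Proof.
by rewrite /sp /gl_sg; case: (par i); case: (par k); case: (par l);
  rewrite /= ?expr0 ?expr1; ring.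
Qed.

Lemma sum_delta (W : lmodType C) (F : I -> W) l : \sum_i (i == l)%:R *: F i = F l.
Proof.
rewrite (bigD1 l) //= eqxx scale1r big1 ?addr0 // => i /negbTE ->; exact: scale0r.
Qed.

Definition om (a b : nat) : endo V := \sum_i \sum_j sp j *: (A a i j * A b j i).

Lemma commr_om (T : endo V) a b : (forall i j, T * A a i j = A a i j * T) ->
  (forall i j, T * A b i j = A b i j * T) -> T * om a b = om a b * T.
Proof.
move=> ha hb; rewrite /om mulr_sumr mulr_suml; apply: eq_bigr => i _.
rewrite mulr_sumr mulr_suml; apply: eq_bigr => j _.
by rewrite endoZr endoZl mulrA ha -mulrA hb mulrA.
Qed.

Lemma A_om c a b i j : (c <= r)%N -> (a <= r)%N -> (b <= r)%N -> c != a -> c != b ->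
  A c i j * om a b = om a b * A c i j.
Proof.
move=> hc ha hb ca cb; rewrite /om mulr_sumr mulr_suml; apply: eq_bigr => k _.
rewrite mulr_sumr mulr_suml; apply: eq_bigr => l _.
rewrite endoZr endoZl; congr (_ *: _).
rewrite mulrA (A_super _ _ _ _ _ _ ca) // endoZl -mulrA (A_super _ _ _ _ _ _ cb) //.
by rewrite endoZr scalerA (sgT _ _ k) sg2 scale1r mulrA.
Qed.

(** The brackets with the two factors give four sums. Two of them cancel directly, the other two
    through the sign identity [sp_sg]: Omega is an invariant tensor. *)
Lemma AD_om a b k l : (a <= r)%N -> (b <= r)%N -> a != b ->
  (A a k l + A b k l) * om a b = om a b * (A a k l + A b k l).
Proof.
move=> ha hb ab; have ba : b != a by rewrite eq_sym.
pose F (i j : I) : endo V := sp j *: ((i == l)%:R *: (A a k j * A b j i))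
   - sp j *: ((j == k)%:R *: (sg k l i j *: (A a i l * A b j i)))
   + sp j *: ((j == l)%:R *: (sg k l i j *: (A a i j * A b k i)))
   - sp j *: ((i == k)%:R *: (A a i j * A b j l)).
have HF i j : (A a k l + A b k l) * (sp j *: (A a i j * A b j i)) =
     sp j *: (A a i j * A b j i) * (A a k l + A b k l) + F i j.
  rewrite endoZr mulrDl !mulrA.
  have -> : A a k l * A a i j * A b j i = A a i j * A b j i * A a k l +
      ((i == l)%:R *: (A a k j * A b j i) - (sg k l i j * (j == k)%:R) *: (A a i l * A b j i)).
    rewrite A_gl // mulrDl mulrBl !endoZl -mulrA (A_super _ _ _ _ ha hb ab).
    by rewrite endoZr scalerA (sgT k l i j) sgC sg2 scale1r mulrA (eq_sym l).
  have -> : A b k l * A a i j * A b j i = A a i j * A b j i * A b k l +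
      ((sg k l i j * (j == l)%:R) *: (A a i j * A b k i) - (i == k)%:R *: (A a i j * A b j l)).
    rewrite (A_super _ _ _ _ hb ha ba) endoZl -mulrA A_gl // mulrDr mulrBr !endoZr.
    rewrite (sgT k l j i) (eq_sym l) !mulrA.
    by case: (sg_pm k l i j) => ->; lmod_ring.
  rewrite endoZl mulrDr !scalerDr !scalerN !scalerA /F.
  by rewrite !scalerA; lmod_ring.
rewrite /om mulr_sumr mulr_suml.
under eq_bigr => i _ do (rewrite mulr_sumr; under eq_bigr => j _ do rewrite HF; rewrite big_split /=).
rewrite big_split /= -[RHS]addr0; congr (_ + _).
  by apply: eq_bigr => i _; rewrite mulr_suml.
rewrite /F.
under eq_bigr => i _ do rewrite !big_split /= !sumrN.
rewrite !big_split /= !sumrN.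
have -> : \sum_i \sum_j sp j *: ((i == l)%:R *: (A a k j * A b j i)) =
    \sum_j sp j *: (A a k j * A b j l).
  rewrite exchange_big; apply: eq_bigr => j _.
  by rewrite -scaler_sumr (sum_delta (fun i => A a k j * A b j i)).
have -> : \sum_i \sum_j sp j *: ((i == k)%:R *: (A a i j * A b j l)) =
    \sum_j sp j *: (A a k j * A b j l).
  rewrite exchange_big; apply: eq_bigr => j _.
  by rewrite -scaler_sumr (sum_delta (fun i => A a i j * A b j l)).
have -> : \sum_i \sum_j sp j *: ((j == k)%:R *: (sg k l i j *: (A a i l * A b j i))) =
    \sum_i (sp k * sg k l i k) *: (A a i l * A b k i).
  apply: eq_bigr => i _; rewrite -(sum_delta (fun j => (sp j * sg k l i j) *: (A a i l * A b j i))).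
  by apply: eq_bigr => j _; lmod_ring.
have -> : \sum_i \sum_j sp j *: ((j == l)%:R *: (sg k l i j *: (A a i j * A b k i))) =
    \sum_i (sp l * sg k l i l) *: (A a i l * A b k i).
  apply: eq_bigr => i _; rewrite -(sum_delta (fun j => (sp j * sg k l i j) *: (A a i j * A b k i))).
  by apply: eq_bigr => j _; lmod_ring.
have -> : \sum_i (sp k * sg k l i k) *: (A a i l * A b k i) =
    \sum_i (sp l * sg k l i l) *: (A a i l * A b k i).
  by apply: eq_bigr => i _; rewrite (sgT k l i k) sgC (sp_sg i k l).
by lmod_ring.
Qed.

(** On two copies of the natural module Omega is the signed flip, so it carries the operators of one
    factor to those of the other. *)
Lemma om_Ar a b k l : (0 < a <= r)%N -> (0 < b <= r)%N -> a != b ->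
  om a b * A b k l = A a k l * om a b.
Proof.
move=> ha hb ab; rewrite /om mulr_suml mulr_sumr.
transitivity (\sum_j sp j *: (A a k j * A b j l)).
  rewrite -(sum_delta (fun i => \sum_j sp j *: (A a i j * A b j l))).
  apply: eq_bigr => i _; rewrite mulr_suml scaler_sumr; apply: eq_bigr => j _.
  by rewrite endoZl -mulrA A_unit // endoZr; lmod_ring.
rewrite -(sum_delta (fun i => \sum_j sp j *: (A a k j * A b j i))).
apply: eq_bigr => i _; rewrite mulr_sumr scaler_sumr; apply: eq_bigr => j _.
by rewrite endoZr mulrA A_unit // endoZl (eq_sym i); lmod_ring.
Qed.

Lemma om_Al a b k l : (0 < a <= r)%N -> (0 < b <= r)%N -> a != b ->
  om a b * A a k l = A b k l * om a b.
Proof.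
move=> ha hb ab; rewrite /om mulr_suml mulr_sumr.
have [/andP[_ ha'] /andP[_ hb']] := (ha, hb); have ba : b != a by rewrite eq_sym.
transitivity (\sum_i (sp k * sg k i k l) *: (A a i l * A b k i)).
  apply: eq_bigr => i _; rewrite mulr_suml -(sum_delta (fun j => (sp j * sg j i k l) *: (A a i l * A b j i))).
  apply: eq_bigr => j _.
  rewrite endoZl -mulrA (A_super _ _ _ _ hb' ha' ba) endoZr mulrA A_unit // endoZl.
  by lmod_ring.
apply: eq_bigr => i _; rewrite mulr_sumr sp_sg.
rewrite -(sum_delta (fun j => (sp j * sg k l i j) *: (A a i j * A b k i))).
apply: eq_bigr => j _.
rewrite endoZr mulrA (A_super _ _ _ _ hb' ha' ba) endoZl -mulrA A_unit // endoZr (eq_sym l).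
by lmod_ring.
Qed.

Lemma om_sq a b : (0 < a <= r)%N -> (0 < b <= r)%N -> a != b -> om a b * om a b = 1.
Proof.
move=> ha hb ab; have [/andP[_ ha'] /andP[_ hb']] := (ha, hb); have ba : b != a by rewrite eq_sym.
rewrite {1}/om mulr_suml -[RHS](A_one ha); apply: eq_bigr => i _.
rewrite mulr_suml -[RHS]mulr1 -(A_one hb) mulr_sumr; apply: eq_bigr => j _.
have -> : A a i i * A b j j = (sp j * (sp i * sg j i j i)) *: (A a i i * A b j j).
  rewrite (_ : sp j * (sp i * sg j i j i) = 1) ?scale1r // /sp /gl_sg.
  by case: (par i); case: (par j); rewrite /= ?expr0 ?expr1; ring.
rewrite -(sum_delta (fun k => (sp j * (sp i * sg j i k i)) *: (A a i i * A b j k))).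
rewrite endoZl /om mulr_sumr scaler_sumr; apply: eq_bigr => k _.
rewrite -(sum_delta (fun l => (k == j)%:R *: ((sp j * (sp l * sg j i k l)) *: (A a i l * A b j k)))).
rewrite mulr_sumr scaler_sumr; apply: eq_bigr => l _.
rewrite endoZr -mulrA (mulrA (A b j i)) (A_super _ _ _ _ hb' ha' ba) endoZl -mulrA.
rewrite A_unit // !endoZr mulrA A_unit // endoZl (eq_sym i l) (eq_sym j k).
by lmod_ring.
Qed.

Lemma om_same a b l (x : V) : (0 < a <= r)%N -> (0 < b <= r)%N -> a != b ->
  A a l l x = x -> A b l l x = x -> om a b x = sp l *: x.
Proof.
move=> ha hb ab xa xb; rewrite /om endo_sumE.
have [/andP[_ ha'] /andP[_ hb']] := (ha, hb).
rewrite -(sum_delta (fun i => sp l *: x) l); apply: eq_bigr => i _.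
rewrite endo_sumE -(sum_delta (fun j => (i == l)%:R *: (sp l *: x)) l).
apply: eq_bigr => j _; rewrite endoZE endoME -{1}xb.
rewrite -(endoME (A b j i)) A_unit // endoZE endo_apZ -xa.
rewrite -(endoME (A b j l)) (A_super _ _ _ _ hb' ha') 1?eq_sym // endoZE endo_apZ endoME.
rewrite -(endoME (A a i j)) A_unit // endoZE; case: (eqVneq i l) => [->|_]; last first.
  by rewrite !scale0r !scaler0.
case: (eqVneq j l) => [->|_]; last by rewrite !scale0r !scaler0.
by rewrite !scale1r xb xa sg_even // scale1r.
Qed.

Lemma neq_succ k : k.+1 != k. Proof. by rewrite gtn_eqF. Qed.
Lemma conj_sum (T : finType) (f g : endo V) (F : T -> endo V) :
  f * (\sum_i F i) * g = \sum_i f * F i * g.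
Proof. by rewrite mulr_sumr mulr_suml. Qed.

Definition Sx (k : nat) : endo V := om k.+1 k.
Fixpoint Xx (k : nat) : endo V :=
  match k with
  | 0 => 0
  | 1 => - om 1 0
  | (_.+1 as j).+1 => Sx j * Xx j * Sx j - Sx j
  end.
(** For k = r + 1 this is the diagonal action of g on the whole tensor product. *)
Definition Dd (k : nat) (i j : I) : endo V := \sum_(a < k) A a i j.

Lemma XS k : Xx k.+2 = Sx k.+1 * Xx k.+1 * Sx k.+1 - Sx k.+1.
Proof. by []. Qed.

Lemma S_sq k : (0 < k < r)%N -> Sx k * Sx k = 1.
Proof.
by case/andP=> h1 h2; apply: om_sq; rewrite ?neq_succ ?h1 ?h2 ?(ltnW h2).
Qed.

Lemma S_A k c i j : (0 < k < r)%N -> (c <= r)%N -> c != k -> c != k.+1 ->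
  Sx k * A c i j = A c i j * Sx k.
Proof. by case/andP=> h1 h2 hc c1 c2; rewrite /Sx A_om // ltnW. Qed.

Lemma S_Al k i j : (0 < k < r)%N -> Sx k * A k i j = A k.+1 i j * Sx k.
Proof. by case/andP=> h1 h2; apply: om_Ar; rewrite ?neq_succ ?h1 ?h2 ?(ltnW h2). Qed.

Lemma D_om a b k i j : (a < k)%N -> (b < k)%N -> (k <= r.+1)%N -> a != b ->
  Dd k i j * om a b = om a b * Dd k i j.
Proof.
move=> ha hb hk ab; rewrite /Dd (bigD1 (Ordinal ha)) //= (bigD1 (Ordinal hb)) /=; last first.
  by rewrite -val_eqE /= eq_sym.
rewrite !addrA mulrDl mulrDr AD_om ?(leq_trans ha) ?(leq_trans hb) //; last 2 first.
- by rewrite -ltnS (leq_trans ha).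
- by rewrite -ltnS (leq_trans hb).
congr (_ + _); rewrite mulr_suml mulr_sumr; apply: eq_bigr => c /andP[ca cb].
by rewrite A_om // -ltnS ?(leq_trans (ltn_ord c)) ?(leq_trans ha) ?(leq_trans hb).
Qed.

(** x_k is a polynomial without constant term in Omega_10 and s_1, ..., s_(k-1), so commutation with
    these generators passes to x_k. *)
Lemma X_ind (Pp : endo V -> Prop) k : (0 < k <= r)%N -> Pp (om 1 0) ->
  (forall j, (0 < j < k)%N -> Pp (Sx j)) -> (forall f g, Pp f -> Pp g -> Pp (f * g)) ->
  (forall f g, Pp f -> Pp g -> Pp (f - g)) -> Pp (Xx k).
Proof.
move=> hk P1 PS PM PB.
have P0 : Pp 0 by rewrite -(subrr (om 1 0)); apply: PB.
elim: k hk PS => // -[|k] IH hk PS; first by rewrite /= -sub0r; apply: PB.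
rewrite XS; have hS : Pp (Sx k.+1) by apply: PS; rewrite /=.
have hX : Pp (Xx k.+1).
  apply: IH => [|j /andP[h1 h2]]; first by case/andP: hk => _ /ltnW ->.
  by apply: PS; rewrite h1 ltnW.
exact: PB _ _ (PM _ _ (PM _ _ hS hX) hS) hS.
Qed.

Lemma X_A k c i j : (0 < k)%N -> (k < c <= r)%N -> Xx k * A c i j = A c i j * Xx k.
Proof.
move=> k0 /andP[kc cr]; apply: (@X_ind (fun f => f * A c i j = A c i j * f)).
- by rewrite k0 (leq_trans (ltnW kc)).
- by rewrite A_om // ?gtn_eqF // ?(leq_trans _ kc) // (leq_trans _ cr) // (leq_trans _ kc).
- move=> l /andP[h1 h2]; rewrite S_A ?h1 //= ?gtn_eqF //.
  + by rewrite (leq_trans (leq_trans h2 (ltnW kc))).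
  + by rewrite (ltn_trans h2).
  + by rewrite (leq_ltn_trans h2).
- by move=> f g hf hg; rewrite -mulrA hg !mulrA hf.
- by move=> f g hf hg; rewrite mulrBl mulrBr hf hg.
Qed.

Lemma X_D k l i j : (0 < k)%N -> (k < l <= r.+1)%N -> Xx k * Dd l i j = Dd l i j * Xx k.
Proof.
move=> k0 /andP[kl lr]; apply: (@X_ind (fun f => f * Dd l i j = Dd l i j * f)).
- by rewrite k0 -ltnS (leq_trans kl).
- by rewrite D_om // ?(leq_trans _ kl) // (leq_ltn_trans _ kl).
- move=> a /andP[h1 h2]; rewrite /Sx D_om ?gtn_eqF //.
    by rewrite (leq_ltn_trans h2).
  by rewrite (ltn_trans h2).
- by move=> f g hf hg; rewrite -mulrA hg !mulrA hf.
- by move=> f g hf hg; rewrite mulrBl mulrBr hf hg.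
Qed.

(** Conjugation by s_k replaces the label k by k + 1 in every Omega_kb, and the subtracted s_k is
    the missing term with b = k. *)
Lemma X_jm k : (0 < k <= r)%N -> Xx k = - \sum_(b < k) om k b.
Proof.
elim: k => // -[|k] IH hk; first by rewrite big_ord1.
have hk' : (0 < k.+1 < r)%N by case/andP: hk.
rewrite XS IH; last by case/andP: hk' => -> /ltnW.
rewrite [in RHS]big_ord_recr /= opprD mulrN mulNr; congr (- _ - _).
rewrite conj_sum; apply: eq_bigr => b _.
have br : (b <= r)%N by rewrite ltnW // (leq_trans (ltn_ord b)) //; case/andP: hk' => _ /ltnW.
rewrite /om conj_sum; apply: eq_bigr => i _; rewrite conj_sum; apply: eq_bigr => j _.
rewrite endoZr endoZl mulrA S_Al // -!mulrA.
have <- : Sx k.+1 * A b j i = A b j i * Sx k.+1.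
  by have := ltn_ord b; move=> hb; apply: S_A => //; lia.
by rewrite (mulrA (Sx _)) S_sq // mul1r.
Qed.

(** In this form, commuting with x_k amounts to commuting with the operators of factor k and with
    the diagonal action on the factors below k; the commutativity of the x_k follows from it. *)
Lemma X_jmD k : (0 < k <= r)%N ->
  Xx k = - \sum_i \sum_j sp j *: (A k i j * Dd k j i).
Proof.
move=> hk; rewrite X_jm // /om exchange_big; congr (- _); apply: eq_bigr => i _.
rewrite exchange_big; apply: eq_bigr => j _.
by rewrite -scaler_sumr /Dd mulr_sumr.
Qed.

Lemma X_comm l k : (0 < l)%N -> (l < k <= r)%N -> Xx l * Xx k = Xx k * Xx l.
Proof.
move=> l0 /andP[lk kr]; rewrite (@X_jmD k) ?kr ?(leq_trans _ lk) // mulrN mulNr.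
congr (- _); rewrite mulr_sumr mulr_suml; apply: eq_bigr => i _.
rewrite mulr_sumr mulr_suml; apply: eq_bigr => j _.
rewrite endoZr endoZl mulrA X_A ?lk // -!mulrA X_D //.
by rewrite lk leqW.
Qed.

Lemma S_X j k : (0 < j < r)%N -> (0 < k <= r)%N -> k != j -> k != j.+1 ->
  Sx j * Xx k = Xx k * Sx j.
Proof.
move=> hj hk kj kj1; have [/andP[j0 jr] /andP[k0 kr]] := (hj, hk).
have [lt|ge] := ltnP k j.
  by rewrite /Sx; apply/esym/commr_om => a b; apply: X_A => //; rewrite ?lt ?(ltnW jr) // ltnW.
have jk : (j.+1 < k)%N by rewrite ltn_neqAle eq_sym kj1 ltn_neqAle eq_sym kj.
rewrite X_jmD // mulrN mulNr; congr (- _).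
rewrite mulr_sumr mulr_suml; apply: eq_bigr => a _.
rewrite mulr_sumr mulr_suml; apply: eq_bigr => b _.
rewrite endoZr endoZl mulrA S_A // -!mulrA /Sx D_om //; last exact: neq_succ.
  by rewrite (ltn_trans _ jk).
by rewrite leqW.
Qed.

Lemma S_Xr k : (0 < k < r)%N -> Sx k * Xx k.+1 = Xx k * Sx k - 1.
Proof.
by case: k => // k hk; rewrite XS mulrBr !mulrA S_sq // mul1r.
Qed.

Lemma S_Xl k : (0 < k < r)%N -> Sx k * Xx k = Xx k.+1 * Sx k + 1.
Proof.
by case: k => // k hk; rewrite XS mulrBl -!mulrA S_sq // mulr1 subrK.
Qed.

Fixpoint Pp (p : C) (a : nat) : endo V :=
  if a is a'.+1 then (Xx a + p *: (1 : endo V)) * Pp p a' else 1.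

Lemma PS p a : Pp p a.+1 = (Xx a.+1 + p *: (1 : endo V)) * Pp p a. Proof. by []. Qed.

Lemma shiftl (f g : endo V) c : (f + c *: (1 : endo V)) * g = f * g + c *: g.
Proof. by rewrite mulrDl endoZl mul1r. Qed.
Lemma shiftr (f g : endo V) c : g * (f + c *: (1 : endo V)) = g * f + c *: g.
Proof. by rewrite mulrDr endoZr mulr1. Qed.
Lemma commr_shift (f g : endo V) c : f * g = g * f -> f * (g + c *: (1 : endo V)) = (g + c *: (1 : endo V)) * f.
Proof. by move=> h; rewrite mulrDl mulrDr h endoZr endoZl mulr1 mul1r. Qed.

Lemma hecke_swap (s u w : endo V) :
  s * u = w * s - 1 -> s * w = u * s + 1 -> w * u = u * w -> s * u * w = u * w * s.
Proof.
by move=> h1 h2 h3; rewrite h1 mulrBl mul1r -(mulrA w s w) h2 mulrDr mulr1 addrK mulrA h3.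
Qed.

(** For j different from a, the factors x_j + p and x_(j+1) + p are both present or both absent, and
    the Hecke relations make s_j commute with their product. *)
Lemma S_P p j a : (0 < j < r)%N -> (a <= r)%N -> j != a -> Sx j * Pp p a = Pp p a * Sx j.
Proof.
case: j => [//|j] hj; elim/ltn_ind: a => -[|a] IH ar ja; first by rewrite mulr1 mul1r.
case: (eqVneq j.+1 a) => [e|ne].
  move: IH ar; rewrite -e => IH ar.
  have IHj : Sx j.+1 * Pp p j = Pp p j * Sx j.+1 by apply: IH; lia.
  rewrite -[Pp p j.+2]/((Xx j.+2 + p *: (1 : endo V)) * ((Xx j.+1 + p *: (1 : endo V)) * Pp p j)).
  rewrite !mulrA -(mulrA _ (Pp p j)) -IHj !mulrA; congr (_ * _).
  apply: hecke_swap.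
  - by rewrite shiftr shiftl S_Xr // addrAC.
  - by rewrite shiftr shiftl S_Xl // addrAC.
  have hc : Xx j.+1 * Xx j.+2 = Xx j.+2 * Xx j.+1 by apply: X_comm; lia.
  by apply: commr_shift; apply/esym/commr_shift/esym.
rewrite PS mulrA commr_shift; last by apply: S_X => //; lia.
by rewrite -!mulrA IH // ltnW.
Qed.

Lemma P_X p a k : (a < k <= r)%N -> Xx k * Pp p a = Pp p a * Xx k.
Proof.
elim: a => [|a IH] /andP[ak kr]; first by rewrite mulr1 mul1r.
rewrite PS mulrA commr_shift; last by apply/esym/X_comm; rewrite ?ak.
by rewrite -!mulrA IH // (ltnW ak).
Qed.

Lemma P_split p a k : (k <= a)%N -> exists Q, Pp p a = Q * Pp p k.
Proof.
elim: a => [|a IH]; first by rewrite leqn0 => /eqP->; exists 1; rewrite mul1r.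
rewrite leq_eqVlt => /orP[/eqP ->|/IH[Q hQ]]; first by exists 1; rewrite mul1r.
by exists ((Xx a.+1 + p *: (1 : endo V)) * Q); rewrite PS hQ mulrA.
Qed.

Lemma P_D p a i j : (a <= r)%N -> Pp p a * Dd r.+1 i j = Dd r.+1 i j * Pp p a.
Proof.
elim: a => [|a IH] ar; first by rewrite mulr1 mul1r.
rewrite PS -mulrA IH ?(ltnW ar) // !mulrA; congr (_ * _).
by apply/esym/commr_shift/esym/X_D; rewrite ?ltnS ?ar /=.
Qed.

End OperatorAlgebra.

(** * Adjacent transpositions generate the stabilizer of an initial segment *)

Section AdjacentGeneration.
Variables (r a : nat) (Q : 'S_r -> Prop).
Hypothesis Q1 : Q 1%g.
Hypothesis QM : forall w w', Q w -> Q w' -> Q (w * w')%g.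
Hypothesis Qs : forall i, (0 < i < r)%N -> i != a -> Q (s_perm r i).

Lemma s_permE (x y : 'I_r) : y = x.+1 :> nat -> s_perm r y = tperm x y.
Proof.
move=> e; rewrite /s_perm; have -> : (nat_of_ord y).-1 = x by rewrite e.
by rewrite !valK.
Qed.

Lemma adjacent_tperm (x y : 'I_r) : ((x < a) = (y < a))%N -> (x < y)%N -> Q (tperm x y).
Proof.
move=> + xy; have [d hd] : exists d, (y = x + d.+1 :> nat)%N.
  by exists (y - x).-1; rewrite prednK ?subn_gt0 // subnKC // ltnW.
elim: d x y hd xy => [|d IH] x y hd xy hxy.
  rewrite -s_permE ?hd ?addn1 //; apply: Qs.
    by have := ltn_ord y; rewrite hd; lia.
  by lia.
have hz : (y.-1 < r)%N by have := ltn_ord y; lia.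
pose z := Ordinal hz.
have zx : x != z by rewrite -val_eqE /=; lia.
have yx : x != y by rewrite -val_eqE /=; lia.
have zy : z != y by rewrite -val_eqE /=; lia.
have Qzy : Q (tperm z y).
  rewrite -s_permE; last by rewrite /=; lia.
  apply: Qs; first by have := ltn_ord y; lia.
  by lia.
have Qxz : Q (tperm x z) by apply: IH => /=; lia.
have -> : tperm x y = (tperm z y * tperm x z * tperm z y)%g.
  have := tpermJ x z (tperm z y); rewrite conjgE tpermV tpermL tpermD 1?eq_sym //.
  by move=> <-; rewrite mulgA.
by apply: (QM _ Qzy); apply: QM.
Qed.

(** Induction on the number of moved points: composing w with the transposition of x and w x fixes x
    in addition and still preserves both blocks. For a = 0 the blocks impose nothing, and the whole
    symmetric group is obtained. *)
Lemma adjacent_generate (w : 'S_r) : (forall k, (w k < a) = (k < a))%N -> Q w.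
Proof.
move: {2}#|_| (leqnn #|[set x | w x != x]|) => N; elim: N w => [|N IH] w.
  rewrite leqn0 cards_eq0 => /eqP h _; suff -> : w = 1%g by [].
  apply/permP => x; rewrite perm1; apply/eqP; apply: contraT => hx.
  by have := in_set0 x; rewrite -h inE hx.
case: (eqVneq [set x | w x != x] set0) => [h _ hw|/set0Pn[x]].
  by apply: IH => //; rewrite h cards0.
rewrite inE => wx hN hw; pose t := tperm x (w x).
have Qt : Q t.
  have hx : ((x < a) = (w x < a))%N by rewrite hw.
  have [lt|gt|e] := ltngtP x (w x).
  - exact: adjacent_tperm.
  - by rewrite /t tpermC; apply: adjacent_tperm.
  - by rewrite -(val_inj e) eqxx in wx.
have -> : w = (w * t * t)%g by rewrite -mulgA tperm2 mulg1.
apply: QM => //; apply: IH; last first.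
  move=> k; rewrite permM /t; case: tpermP => [e|/perm_inj e|_ _]; last exact: hw.
  - by rewrite hw -e hw.
  - by rewrite e.
rewrite -ltnS; apply: leq_trans hN; apply: proper_card; apply/properP; split.
  apply/fintype.subsetP => z; rewrite !inE permM; apply: contraNneq => wz.
  rewrite wz /t tpermD //; first by apply: contraNneq wx => ->; rewrite wz.
  by apply: contraNneq wx => e; rewrite (perm_inj (etrans e (esym wz))) wz.
by exists x; rewrite !inE ?wx // permM /t tpermR eqxx.
Qed.

End AdjacentGeneration.

(** * Place permutations and vectors killed by P *)

Section Implementers.
Variables (C : numFieldType) (m n r : nat) (p q : C) (V : lmodType C).
Notation I := 'I_(m + n).
Notation par := (@par m n).
Notation sg := (@gl_sg C m n).
Variable A : nat -> I -> I -> endo V.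
Hypothesis H : op_algebra r A.
Implicit Types x : V.

(** Coordinate-free conditions: factor 0 carries the highest weight vector of K ([base]), and only
    even ([evn]) or only odd ([odd_at]) letters occur in position k. *)
Definition base x := forall i j, ~~ (par i && ~~ par j) ->
  A 0 i j x = ((i == j)%:R * lam_pq p q i) *: x.
Definition evn k x := forall l o, par o -> A k l o x = 0.
Definition odd_at k x := forall l o, ~~ par o -> A k l o x = 0.

Lemma om_k0 k x : (0 < k <= r)%N -> base x -> evn k x -> om A k 0 x = p *: x.
Proof.
move=> hk bx ex; have [/andP[k0 kr]] := hk.
have T i j : sp C j *: (A k i j * A 0 j i) x = (j == i)%:R *: (p *: A k i i x).
  rewrite endoME; case hj: (par j).
    rewrite -endoME (op_super H) // -?lt0n // endoZE endoME ex // endo_ap0 !scaler0.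
    by case: eqP => [<-|_]; rewrite ?scale0r // ex // !scaler0.
  rewrite bx ?hj //; rewrite endo_apZ /sp hj expr0 scale1r /lam_pq hj -scalerA.
  by case: eqP => [<-//|_]; rewrite !scale0r.
rewrite endo_sumE; under eq_bigr => i _ do rewrite endo_sumE.
under eq_bigr => i _ do under eq_bigr => j _ do rewrite endoZE T.
under eq_bigr => i _ do rewrite (sum_delta (fun j => p *: A k i i x)).
by rewrite -scaler_sumr -endo_sumE (op_one H).
Qed.

Lemma base_A x b i j : (0 < b <= r)%N -> base x -> base (A b i j x).
Proof.
move=> /andP[b0 br] bx k l hkl; rewrite -endoME (op_super H) -?lt0n //; last by rewrite eq_sym -lt0n.
rewrite endoZE endoME bx // endo_apZ; case: (eqVneq k l) => [->|_].
  by rewrite sg_even // scale1r.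
by rewrite !mul0r !scale0r scaler0.
Qed.

Lemma base_om x a b : (0 < a <= r)%N -> (0 < b <= r)%N -> a != b -> base x -> base (om A a b x).
Proof.
move=> /andP[a0 ar] /andP[b0 br] ab bx i j hij.
have na : 0%N != a by rewrite eq_sym -lt0n.
have nb : 0%N != b by rewrite eq_sym -lt0n.
by rewrite -endoME (A_om H _ _ (leq0n r) ar br na nb) endoME bx // endo_apZ.
Qed.

Lemma evn_om x a b : (0 < a <= r)%N -> (0 < b <= r)%N -> a != b ->
  evn a x -> evn b (om A a b x).
Proof.
by move=> ha hb ab ex l o ho; rewrite -endoME -(om_Al H) // endoME ex // endo_ap0.
Qed.

(* An even letter in position k passes to a lower position with each
   Jucys-Murphy term of x_k + p, and x_1 + p kills an even letter in
   position 1. *)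
Lemma P_kill k x : (0 < k <= r)%N -> base x -> evn k x -> Pp A p k x = 0.
Proof.
elim/ltn_ind: k x => -[//|k] IH x hk bx ex.
have hk1 : (k < k.+1 <= r)%N by rewrite leqnn; case/andP: hk.
(* The term with b = 0 equals -p and cancels the shift. In a term with b > 0 the even letter sits in
   position b, and P_b is a right factor of the remaining product, so induction applies. *)
rewrite PS -commr_shift; last by apply/esym; apply: P_X hk1.
rewrite endoME endoDE endoZE endo1E (X_jm H) // endoNE big_ord_recl endoDE.
rewrite (om_k0 hk bx ex) opprD addrAC addNr sub0r.
rewrite endo_sumE -sumrN endo_apsum big1 // => b _; rewrite endo_apN.
have hb : (0 < bump 0 b <= r)%N by case/andP: hk => _ h; have := ltn_ord b; rewrite /bump; lia.
have kb : k.+1 != bump 0 b by have := ltn_ord b; rewrite /bump; lia.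
have [|Q ->] := @P_split C m n V A p k (bump 0 b); first by have := ltn_ord b; rewrite /bump; lia.
rewrite endoME IH ?endo_ap0 ?oppr0 //; first by have := ltn_ord b; rewrite /bump; lia.
- exact: base_om.
- exact: evn_om.
Qed.

Lemma P_kill_le k a x : (0 < k <= a)%N -> (a <= r)%N -> base x -> evn k x -> Pp A p a x = 0.
Proof.
move=> /andP[k0 ka] ar bx ex; have [Q ->] := P_split A p ka.
by rewrite endoME P_kill ?endo_ap0 // k0 (leq_trans ka).
Qed.

(** P commutes with the diagonal action, so E_ij may act on u. It kills factor 0 and every even
    letter; in a position b <= a it turns an odd letter into an even one, and P kills the result. *)
Lemma g1_kill a u i j : (a <= r)%N -> ~~ par i -> par j -> base u ->
  (forall k, (0 < k <= a)%N -> odd_at k u) ->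
  (forall k, (a < k <= r)%N -> evn k u) -> Dd A r.+1 i j (Pp A p a u) = 0.
Proof.
move=> ar hi hj bu ou eu; rewrite -endoME -(P_D H) // endoME /Dd endo_sumE endo_apsum.
rewrite big1 // => b _; have br : (b <= r)%N by rewrite -ltnS.
case: (posnP b) => [->|b0].
  rewrite bu ?(negbTE hi) // par_neqF ?hj ?(negbTE hi) // mul0r scale0r.
  exact: endo_ap0.
have [ba|ab] := leqP b a; last by rewrite eu ?ab // endo_ap0.
apply: (@P_kill_le b); rewrite ?b0 //; first by apply: base_A; rewrite ?b0.
move=> l o ho; rewrite -endoME (op_unit H) ?b0 // endoZE.
by rewrite par_neqF ?scale0r // ho (negbTE hi).
Qed.

Definition implements (w : 'S_r) (T : endo V) :=
  forall (c : 'I_r) i j, T * A c.+1 i j = A (w c).+1 i j * T.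

Variable i0 : I.
Hypothesis i0_even : ~~ par i0.

Definition fixes (T : endo V) :=
  forall x, (forall c : 'I_r, A c.+1 i0 i0 x = x) -> T x = x.

Lemma labP (c : 'I_r) : (0 < c.+1 <= r)%N. Proof. exact: ltn_ord. Qed.

(** Every vector is a sum of images, under operators of one factor, of vectors with the letter i0 in
    that position. After r such steps T is determined by its values on vectors with all letters i0.
    Hence [permop] is independent of the word and multiplicative, with no braid relation to
    verify. *)
Lemma impl_uniq w T T' : implements w T -> implements w T' -> fixes T -> fixes T' -> T = T'.
Proof.
move=> iT iT' fT fT'; apply/endoP.
suff h k x : (forall c : 'I_r, (k <= c)%N -> A c.+1 i0 i0 x = x) -> T x = T' x.
  by move=> x; apply: (h r) => c; rewrite leqNgt ltn_ord.
elim: k x => [|k IH] x hx; first by rewrite fT ?fT' // => c; apply: hx.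
have [rk|kr] := leqP r k; first by apply: IH => c; rewrite leqNgt (leq_trans (ltn_ord c)).
pose c := Ordinal kr; have e : x = \sum_l A c.+1 l i0 (A c.+1 i0 l x).
  rewrite -{1}[x]endo1E -(op_one H (labP c)) endo_sumE; apply: eq_bigr => l _.
  by rewrite -endoME (op_unit H) // eqxx scale1r.
rewrite e !endo_apsum; apply: eq_bigr => l _.
rewrite -!endoME iT iT' !endoME (IH (A c.+1 i0 l x)) // => d.
rewrite leq_eqVlt => /orP[/eqP e'|kd].
  have -> : d = c by apply: val_inj.
  by rewrite -endoME (op_unit H) // eqxx scale1r.
rewrite -endoME (op_super H) //; last by rewrite eqSS gtn_eqF.
by rewrite sg_even // scale1r endoME hx.
Qed.

Lemma impl_mul w w' T T' : implements w T -> implements w' T' -> implements (w * w') (T' * T).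
Proof. by move=> h h' c i j; rewrite -mulrA h mulrA h' permM mulrA. Qed.

Lemma fixes_mul T T' : fixes T -> fixes T' -> fixes (T' * T).
Proof. by move=> h h' x hx; rewrite endoME h // h'. Qed.

Lemma impl1 : implements 1 1. Proof. by move=> c i j; rewrite perm1 mul1r mulr1. Qed.
Lemma fixes1 : fixes 1. Proof. by []. Qed.

Lemma impl_om (a b : 'I_r) : a != b -> implements (tperm a b) (om A a.+1 b.+1).
Proof.
move=> ab c i j; have ab' : a.+1 != b.+1 by rewrite eqSS.
case: tpermP => [->|->|/eqP ca /eqP cb]; first by rewrite (om_Al H) ?labP.
  by rewrite (om_Ar H) ?labP.
by rewrite (A_om H) ?ltn_ord ?eqSS.
Qed.

Lemma fixes_om (a b : 'I_r) : a != b -> fixes (om A a.+1 b.+1).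
Proof.
move=> ab x hx; rewrite (@om_same _ _ _ _ _ _ H _ _ i0) ?labP //.
by rewrite /sp (negbTE i0_even) scale1r.
Qed.

Definition wd (u : seq nat) : endo V := foldl (fun T i => Sx A i * T) 1 u.

Lemma wd_rcons u i : wd (rcons u i) = Sx A i * wd u.
Proof. by rewrite /wd foldl_rcons. Qed.

Lemma s_perm_om i : (0 < i < r)%N ->
  exists a b : 'I_r, [/\ a != b, s_perm r i = tperm a b & Sx A i = om A b.+1 a.+1].
Proof.
case: i => [//|i] hi; have hi' : (i < r)%N by lia.
exists (Ordinal hi'), (Ordinal hi); split; first by rewrite -val_eqE /=; lia.
  exact: (@s_permE _ (Ordinal hi') (Ordinal hi)).
by [].
Qed.

Lemma wd_impl u : all (fun i => 0 < i < r)%N u ->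
  implements (\prod_(i <- u) s_perm r i) (wd u) /\ fixes (wd u).
Proof.
elim/last_ind: u => [_|u i IH]; first by rewrite big_nil; split; [exact: impl1|exact: fixes1].
rewrite all_rcons => /andP[hi /IH[h1 h2]]; rewrite wd_rcons -cats1 big_cat big_seq1.
have [a [b [ab e1 e2]]] := s_perm_om hi; rewrite e1 e2 tpermC; split.
  by apply: impl_mul => //; apply: impl_om; rewrite eq_sym.
by apply: fixes_mul => //; apply: fixes_om; rewrite eq_sym.
Qed.

Lemma s_word_spec (w : 'S_r) : all (fun i => 0 < i < r)%N (s_word w) /\
  (\prod_(i <- s_word w) s_perm r i)%g = w.
Proof.
apply: (xgetPex [::] (P := fun u : seq nat => all (fun i => 0 < i < r)%N u /\
  (\prod_(i <- u) s_perm r i)%g = w)).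
apply: (@adjacent_generate r 0 (fun w => exists u : seq nat,
   all (fun i => 0 < i < r)%N u /\ (\prod_(i <- u) s_perm r i)%g = w)) => //.
- by exists [::]; rewrite big_nil.
- by move=> w1 w2 [u [hu <-]] [v [hv <-]]; exists (u ++ v); rewrite all_cat hu hv big_cat.
- by move=> i hi _; exists [:: i]; rewrite /= hi big_seq1.
Qed.

Definition permop (w : 'S_r) : endo V := wd (s_word w).

Lemma pi_impl w : implements w (permop w).
Proof. by have [h1 h2] := s_word_spec w; have [h _] := wd_impl h1; rewrite h2 in h. Qed.
Lemma pi_fixes w : fixes (permop w).
Proof. by have [h1 h2] := s_word_spec w; have [_ h] := wd_impl h1. Qed.

Lemma pi_uniq w T : implements w T -> fixes T -> permop w = T.
Proof. by move=> h1 h2; apply: impl_uniq h2; [exact: pi_impl| |exact: pi_fixes]. Qed.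

(** The factors are reversed because the right action of the symmetric group is written by operators
    composed on the left. *)
Lemma piM w w' : permop (w * w') = permop w' * permop w.
Proof.
apply: pi_uniq; [apply: impl_mul|apply: fixes_mul]; by [exact: pi_impl|exact: pi_fixes].
Qed.
Lemma pi1 : permop 1 = 1. Proof. exact: pi_uniq impl1 fixes1. Qed.
Lemma pi_tperm (a b : 'I_r) : a != b -> permop (tperm a b) = om A a.+1 b.+1.
Proof. by move=> ab; apply: pi_uniq; [apply: impl_om|apply: fixes_om]. Qed.
Lemma pi_s i : (0 < i < r)%N -> permop (s_perm r i) = Sx A i.
Proof.
by move/s_perm_om => [a [b [ab -> ->]]]; rewrite tpermC pi_tperm // eq_sym.
Qed.

Lemma pi_comm (a : nat) (T : endo V) (w : 'S_r) :
  (forall i, (0 < i < r)%N -> i != a -> Sx A i * T = T * Sx A i) ->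
  (forall k, (w k < a) = (k < a))%N -> permop w * T = T * permop w.
Proof.
move=> hT; apply: (@adjacent_generate r a (fun w => permop w * T = T * permop w)).
- by rewrite pi1 mul1r mulr1.
- by move=> w1 w2 h1 h2; rewrite piM -mulrA h1 mulrA h2 mulrA.
- by move=> i hi ia; rewrite pi_s // hT.
Qed.

Lemma pi_P a (w : 'S_r) : (a <= r)%N -> (forall k, (w k < a) = (k < a))%N ->
  permop w * Pp A p a = Pp A p a * permop w.
Proof. by move=> ar; apply: pi_comm => i hi ia; apply: (S_P H). Qed.

Lemma pi_D (w : 'S_r) i j : permop w * Dd A r.+1 i j = Dd A r.+1 i j * permop w.
Proof.
apply: (@pi_comm 0) => // k /andP[k0 kr] _; apply/esym; apply: (D_om H) => //.
- by rewrite ltnS ltnW.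
- exact: neq_succ.
Qed.

Lemma pi_A0 (w : 'S_r) i j : permop w * A 0 i j = A 0 i j * permop w.
Proof.
apply: (@pi_comm 0) => // k /andP[k0 kr] _; apply/esym; apply: (A_om H) => //; first exact: ltnW.
by rewrite eq_sym -lt0n.
Qed.

End Implementers.

(** * The operators of the tensor factors in coordinates *)

Section TensorOperators.
Variables (C : numFieldType) (m n r : nat) (K : lmodType C).
Notation I := 'I_(m + n).
Notation par := (@par m n).
Notation sg := (@gl_sg C m n).
Notation W := {ffun 'I_r -> I}.
Notation M := {ffun W -> K}.
Variable kE : I -> I -> endo K.
Hypothesis kE_rel : forall i j k l y,
  kE i j (kE k l y) = gl_sg C i j k l *: kE k l (kE i j y)
  + ((j == k)%:R *: kE i l y - (gl_sg C i j k l * (l == i)%:R) *: kE k j y).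

(** Labels start at 1 and positions at 0, so the factors to the left of label a are the positions c
    with a <= c. *)
Definition nodd (a : nat) (f : W) : nat := (\sum_(c < r | (a <= c)%N) par (f c))%N.
Definition tsg (a : nat) (i j : I) (f : W) : C := (-1) ^+ ((par i + par j) * nodd a f)%N.

Definition tE_fun (a : nat) (i j : I) (x : M) : M :=
  [ffun f : W => tsg a i j f *:
    if a is b.+1 then
      if insub b is Some k then if f k == i then x (upd f k j) else 0 else 0
    else kE i j (x f)].

Fact tE_linear a i j : linear (tE_fun a i j).
Proof.
move=> c x y; apply/ffunP => f; rewrite !ffunE; case: a => [|a].
  by rewrite endo_apD endo_apZ scalerDr !scalerA mulrC.
case: insub => [k|]; last by rewrite !scaler0 addr0.
case: eqP => _; last by rewrite !scaler0 addr0.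
by rewrite !ffunE scalerDr !scalerA mulrC.
Qed.
Definition tE a i j : endo M := Endo (tE_linear a i j).

Lemma tE0 i j (x : M) f : tE 0 i j x f = tsg 0 i j f *: kE i j (x f).
Proof. by rewrite ffunE. Qed.

Lemma tES (k : 'I_r) i j (x : M) f : tE k.+1 i j x f =
  tsg k.+1 i j f *: (if f k == i then x (upd f k j) else 0).
Proof. by rewrite ffunE valK. Qed.

Lemma MZ c (x : M) f : (c *: x) f = c *: x f. Proof. by rewrite ffunE. Qed.
Lemma MD (x y : M) f : (x + y) f = x f + y f. Proof. by rewrite ffunE. Qed.
Lemma MN (x : M) f : (- x) f = - x f. Proof. by rewrite ffunE. Qed.
Definition ME := (MZ, MD, MN).

Lemma upd_same (f : W) k j : upd f k j k = j. Proof. by rewrite ffunE eqxx. Qed.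
Lemma upd_other (f : W) k j l : l != k -> upd f k j l = f l.
Proof. by move=> /negbTE h; rewrite ffunE h. Qed.
Lemma upd_upd (f : W) k i j : upd (upd f k i) k j = upd f k j.
Proof. by apply/ffunP => l; rewrite !ffunE; case: eqP. Qed.
Lemma upd_comm (f : W) k l i j : k != l -> upd (upd f k i) l j = upd (upd f l j) k i.
Proof.
move=> kl; apply/ffunP => o; rewrite !ffunE.
by case: (eqVneq o l) => [->|//]; rewrite eq_sym (negbTE kl).
Qed.
Lemma upd_id (f : W) k : upd f k (f k) = f.
Proof. by apply/ffunP => l; rewrite !ffunE; case: eqP => [->|]. Qed.

Lemma nodd_upd_lt a (f : W) (k : 'I_r) j : (k < a)%N -> nodd a (upd f k j) = nodd a f.
Proof.
move=> ka; apply: eq_bigr => c ac; rewrite upd_other //.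
by apply: contraTneq ac => ->; rewrite -ltnNge.
Qed.
Lemma nodd_upd_ge a (f : W) (k : 'I_r) j : (a <= k)%N ->
  (nodd a (upd f k j) + par (f k) = nodd a f + par j)%N.
Proof.
move=> ak; rewrite /nodd (bigD1 k) //= [in RHS](bigD1 k) //= upd_same.
rewrite (eq_bigr (fun c => nat_of_bool (par (f c)))) => [|c /andP[_ ck]].
  by rewrite addnAC [RHS]addnAC [X in (X + _)%N = _]addnC.
by rewrite upd_other.
Qed.

Lemma tsg_upd_lt a i j f (k : 'I_r) l : (k < a)%N -> tsg a i j (upd f k l) = tsg a i j f.
Proof. by move=> h; rewrite /tsg nodd_upd_lt. Qed.

Lemma tsg_upd_ge a i j f (k : 'I_r) l : (a <= k)%N ->
  tsg a i j (upd f k l) = sg i j (f k) l * tsg a i j f.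
Proof.
move=> h; have := congr1 odd (nodd_upd_ge f l h); rewrite !oddD !oddb => ho.
rewrite /tsg /gl_sg -exprD -[LHS]signr_odd -[RHS]signr_odd !(oddD, oddM, oddb).
congr (_ ^+ (nat_of_bool _)); move: ho.
case: (par i); case: (par j); case: (par l); case: (par (f k));
  by case: (odd _); case: (odd _).
Qed.

Lemma tsg_mul a i j l f : tsg a i j f * tsg a j l f = tsg a i l f.
Proof.
rewrite /tsg -exprD -[LHS]signr_odd -[RHS]signr_odd !(oddD, oddM, oddb).
by apply: (congr1 (fun b : bool => (-1) ^+ b)); case: (par i); case: (par j); case: (par l); case: (odd _).
Qed.
Lemma tsg_neq0 a i j f : tsg a i j f != 0. Proof. by rewrite /tsg signr_eq0. Qed.
Lemma tsg_even a i j f : par i = par j -> tsg a i j f = 1.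
Proof.
by move=> h; rewrite /tsg h -signr_odd oddM oddD addbb.
Qed.

Lemma lab_ord a : (0 < a <= r)%N -> exists k : 'I_r, a = k.+1.
Proof. by case: a => [//|a] /= h; exists (Ordinal h). Qed.

Lemma tE_super_lt (b : nat) (k : 'I_r) i j i' j' : (b <= k)%N ->
  tE k.+1 i j * tE b i' j' = sg i j i' j' *: (tE b i' j' * tE k.+1 i j).
Proof.
move=> bk; apply/endoP => x; apply/ffunP => f; rewrite endoME endoZE endoME tES MZ.
case: (posnP b) => [b0|bp].
  rewrite b0 !tE0 tES; case: eqP => e; last by rewrite scaler0 endo_ap0 !scaler0.
  rewrite tsg_upd_ge // e endo_apZ !scalerA; congr (_ *: _).
  by rewrite (sgC C i'); ring.
have [l hl] : exists l : 'I_r, b = l.+1 by apply: lab_ord; rewrite bp (leq_trans bk) // ltnW.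
have lk : l != k by rewrite -val_eqE /= ltn_eqF // -hl.
have kl : k != l by rewrite eq_sym.
rewrite hl !tES (upd_other _ _ lk); case: (eqVneq (f k) i) => e; last first.
  rewrite scaler0; case: (f l == i'); last by rewrite !scaler0.
  by rewrite (upd_other _ _ kl) (negbTE e) !scaler0.
case: (f l == i'); last by rewrite !scaler0.
rewrite (upd_other _ _ kl) e eqxx tsg_upd_ge -?hl // e !scalerA upd_comm //.
rewrite tsg_upd_lt; last by rewrite ltnS -ltnS -hl leqW.
by congr (_ *: _); rewrite (sgC C i'); ring.
Qed.

Lemma tE_unit (a : nat) i j k l : (0 < a <= r)%N ->
  tE a i j * tE a k l = (j == k)%:R *: tE a i l.
Proof.
move=> /lab_ord [c ->]; apply/endoP => x; apply/ffunP => f.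
rewrite endoME endoZE MZ !tES; case: (f c == i); last by rewrite !scaler0.
rewrite upd_same upd_upd tsg_upd_lt //; case: (eqVneq j k) => [<-|_]; last by rewrite !scaler0 scale0r.
by rewrite scalerA tsg_mul scale1r.
Qed.

Lemma tE_op : op_algebra r tE.
Proof.
split.
- move=> a b i j k l ar br; rewrite neq_ltn => /orP[ab|ba].
    have [c hc] : exists c : 'I_r, b = c.+1 by apply: lab_ord; rewrite br (leq_ltn_trans (leq0n a) ab).
    rewrite hc tE_super_lt; last by rewrite -ltnS -hc.
    by rewrite scalerA (sgC C k) sg2 scale1r.
  have [c hc] : exists c : 'I_r, a = c.+1 by apply: lab_ord; rewrite ar (leq_ltn_trans (leq0n b) ba).
  by rewrite hc; apply: tE_super_lt; rewrite -ltnS -hc.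
- exact: tE_unit.
- move=> a i j k l ar; case: (posnP a) => [->|a0].
    apply/endoP => x; apply/ffunP => f.
    rewrite !(endoDE, endoZE, endoNE, endoME, ME) !tE0 !endo_apZ kE_rel.
    have e1 : (j == k)%:R * (tsg 0 i j f * tsg 0 k l f) = (j == k)%:R * tsg 0 i l f.
      by case: eqP => [<-|_]; rewrite ?mul0r // tsg_mul.
    have e2 : (l == i)%:R * (tsg 0 i j f * tsg 0 k l f) = (l == i)%:R * tsg 0 k j f.
      by case: eqP => [<-|_]; rewrite ?mul0r // [tsg 0 l j f * _]mulrC tsg_mul.
    transitivity ((tsg 0 i j f * tsg 0 k l f * sg i j k l) *: kE k l (kE i j (x f)) +
      (((j == k)%:R * (tsg 0 i j f * tsg 0 k l f)) *: kE i l (x f) -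
       (sg i j k l * ((l == i)%:R * (tsg 0 i j f * tsg 0 k l f))) *: kE k j (x f))).
      by lmod_ring.
    by rewrite e1 e2; lmod_ring.
  by rewrite !tE_unit ?a0 // scalerA addrCA -scalerBl subrr scale0r addr0.
- move=> a /lab_ord [c ->]; apply/endoP => x; apply/ffunP => f.
  rewrite endo_sumE sum_ffunE (bigD1 (f c)) //= big1 => [|i /negbTE h].
    by rewrite tES eqxx upd_id tsg_even // scale1r addr0.
  by rewrite tES eq_sym h scaler0.
Qed.

End TensorOperators.

Lemma sum_single (T : finType) (K : zmodType) (F : T -> K) (i : T) :
  (forall j, j != i -> F j = 0) -> \sum_j F j = F i.
Proof. by move=> h; rewrite (bigD1 i) //= big1 ?addr0. Qed.

(** * Coefficients of P at words with even letters *)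

Section LeadingTerms.
Variables (C : numFieldType) (m n r : nat) (p q : C) (K : lmodType C).
Notation I := 'I_(m + n).
Notation par := (@par m n).
Notation W := {ffun 'I_r -> I}.
Notation M := {ffun W -> K}.
Variable kE : I -> I -> endo K.
Hypothesis kE_rel : forall i j k l y,
  kE i j (kE k l y) = gl_sg C i j k l *: kE k l (kE i j y)
  + ((j == k)%:R *: kE i l y - (gl_sg C i j k l * (l == i)%:R) *: kE k j y).
Variable phi : {linear K -> {ffun {set (I * I)%type} -> C^o}}.
Hypothesis phi_E : forall i j y, phi (kE i j y) = mE p q i j (phi y).
Notation A := (@tE C m n r K kE).
Let H := tE_op r kE_rel.
Variable i0 : I.
Hypothesis i0_even : ~~ par i0.
Notation permop := (@permop C m n r M A).

Definition wcomp (f : W) (w : 'S_r) : W := [ffun c => f (w c)].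

Lemma wcomp1 f : wcomp f 1 = f.
Proof. by apply/ffunP => c; rewrite ffunE perm1. Qed.
Lemma wcompM f w w' : wcomp f (w * w') = wcomp (wcomp f w') w.
Proof. by apply/ffunP => c; rewrite !ffunE permM. Qed.

Lemma om_coef (a b : 'I_r) (f : W) : a != b -> exists k : nat, forall x : M,
  om A a.+1 b.+1 x f = (-1) ^+ k *: x (wcomp f (tperm a b)).
Proof.
move=> ab; have ba : b != a by rewrite eq_sym.
exists (par (f b) + (par (f a) + par (f b)) * nodd a.+1 f +
  (par (f b) + par (f a)) * nodd b.+1 (upd f a (f b)))%N => x.
have e : wcomp f (tperm a b) = upd (upd f a (f b)) b (f a).
  apply/ffunP => c; rewrite !ffunE; case: tpermP => [->|->|/eqP ca /eqP cb].
  - by rewrite (negbTE ab) eqxx.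
  - by rewrite eqxx.
  - by rewrite (negbTE cb) (negbTE ca).
rewrite endo_sumE sum_ffunE (sum_single (i := f a)) => [|i ia]; last first.
  rewrite endo_sumE sum_ffunE big1 // => j _.
  by rewrite endoZE MZ endoME tES eq_sym (negbTE ia) !scaler0.
rewrite endo_sumE sum_ffunE (sum_single (i := f b)) => [|j jb]; last first.
  rewrite endoZE MZ endoME tES eqxx tES (upd_other _ _ ba) eq_sym (negbTE jb).
  by rewrite !scaler0.
rewrite endoZE MZ endoME tES eqxx tES (upd_other _ _ ba) eqxx e !scalerA.
by congr (_ *: _); rewrite /sp /tsg -!exprD addnA.
Qed.

(** The sign depends on w and f but not on the vector; this suffices for every vanishing and
    independence argument below. *)
Lemma pi_coef (w : 'S_r) (f : W) : exists k : nat, forall x : M,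
  permop w x f = (-1) ^+ k *: x (wcomp f w).
Proof.
move: f; apply: (@adjacent_generate r 0 (fun w => forall f, exists k : nat, forall x : M,
  permop w x f = (-1) ^+ k *: x (wcomp f w))) => //.
- by move=> f; exists 0%N => x; rewrite (pi1 H i0_even) wcomp1 scale1r.
- move=> v v' hv hv' f; have [k hk] := hv' f; have [l hl] := hv (wcomp f v').
  by exists (k + l)%N => x; rewrite (piM H i0_even) endoME hk hl scalerA exprD wcompM.
- move=> i hi _ f; rewrite (pi_s H i0_even hi).
  have [a [b [ab -> ->]]] := s_perm_om A i0_even hi; rewrite tpermC; apply: om_coef.
  by rewrite eq_sym.
Qed.

Variable a : nat.
Hypothesis ar : (a <= r)%N.

Definition split_at (u : M) := forall f : W,
  (exists c : 'I_r, par (f c) != (c < a)%N) -> u f = 0.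

Definition oddpos (c : 'I_r) (x : M) := forall f : W, ~~ par (f c) -> x f = 0.

Lemma oddposP (c : 'I_r) (x : M) : oddpos c x <-> odd_at A c.+1 x.
Proof.
split=> h.
  move=> l o ho; apply/ffunP => f; rewrite tES [RHS]ffunE; case: eqP => _; last exact: scaler0.
  by rewrite h ?scaler0 // upd_same.
move=> f hf; have /ffunP/(_ f) := h (f c) (f c) hf.
by rewrite tES eqxx upd_id ffunE tsg_even // scale1r.
Qed.

Definition evenpos (c : 'I_r) (x : M) := forall f : W, par (f c) -> x f = 0.

Lemma evenposP (c : 'I_r) (x : M) : evenpos c x <-> evn A c.+1 x.
Proof.
split=> h.
  move=> l o ho; apply/ffunP => f; rewrite tES [RHS]ffunE; case: eqP => _; last exact: scaler0.
  by rewrite h ?scaler0 // upd_same.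
move=> f hf; have /ffunP/(_ f) := h (f c) (f c) hf.
by rewrite tES eqxx upd_id ffunE tsg_even // scale1r.
Qed.

Lemma P_A b (c : 'I_r) i j : (b <= c)%N -> Pp A p b * A c.+1 i j = A c.+1 i j * Pp A p b.
Proof.
elim: b => [|b IH] bc; first by rewrite mulr1 mul1r.
rewrite PS -mulrA IH ?(ltnW bc) // !mulrA; congr (_ * _).
apply/esym/commr_shift/esym/(X_A H) => //.
by rewrite ltnS bc /=.
Qed.

(** P_k leaves an odd letter in position k. A coefficient at a word with even letters up to position
    k therefore sees neither the shift p nor the flips with the positions before k; what remains is
    Omega with factor 0, which takes an odd j out of position k and lets E_j,(g k) act on K. *)
Lemma P_step (k : 'I_r) (g : W) : (k < a)%N -> (forall c : 'I_r, (c <= k)%N -> ~~ par (g c)) ->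
  exists e : I -> nat, forall u, split_at u -> Pp A p k.+1 u g =
    \sum_(j | par j) (-1) ^+ e j *: kE j (g k) (Pp A p k u (upd g k j)).
Proof.
move=> ka hg.
exists (fun j => ((par (g k) + par j) * nodd k.+1 g +
  (par j + par (g k)) * nodd 0 (upd g k j))%N) => u hu.
have ou : oddpos k (Pp A p k u).
  apply/oddposP => l o ho; rewrite -endoME -P_A // endoME.
  have /oddposP -> // : oddpos k u; last by rewrite endo_ap0.
  by move=> f hf; apply: hu; exists k; rewrite (negbTE hf) ka.
rewrite PS endoME endoDE endoZE endo1E MD MZ (ou g) ?hg // scaler0 addr0.
rewrite (X_jm H) ?ltn_ord // endoNE MN endo_sumE sum_ffunE big_ord_recl.
rewrite [X in _ + X]big1 ?addr0 => [|b _]; last first.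
  have hb : (b < r)%N by rewrite (ltn_trans (ltn_ord b)).
  have kb : k != Ordinal hb by rewrite -val_eqE /= gtn_eqF.
  have [e he] := om_coef g kb.
  rewrite -[lift _ _ : nat]/((Ordinal hb).+1) he ou ?scaler0 // ffunE tpermL hg //=.
  exact: ltnW.
rewrite endo_sumE sum_ffunE (sum_single (i := g k)) => [|i ik]; last first.
  rewrite endo_sumE sum_ffunE big1 // => j _.
  by rewrite endoZE MZ endoME tES eq_sym (negbTE ik) !scaler0.
rewrite endo_sumE sum_ffunE -sumrN [RHS]big_mkcond; apply: eq_bigr => j _.
rewrite endoZE MZ endoME tES eqxx tE0; case: ifP => hj; last first.
  by rewrite ou ?upd_same ?hj // endo_ap0 !scaler0 oppr0.
have sj : sp C j = -1 by rewrite /sp hj expr1.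
by rewrite !scalerA -scaleNr sj mulN1r opprK /tsg exprD.
Qed.

Hypothesis phi_lower : forall i j y, par i -> ~~ par j -> phi (kE i j y) = cr C (i, j) (phi y).

(** Each application of [P_step] creates a box (j, g c) in K, so the monomial S records the even
    letters in the positions where P has acted. *)
Lemma P_support k (g : W) u (S : {set I * I}) : (k <= a)%N -> split_at u ->
  (forall c : 'I_r, (c < k)%N -> ~~ par (g c)) -> phi (Pp A p k u g) S != 0 ->
  forall c : 'I_r, (c < k)%N -> exists j, (j, g c) \in S.
Proof.
elim: k g S => [//|k IH] g S ka hu hg nz c ck.
have kr : (k < r)%N by apply: leq_trans ar.
have [e he] := @P_step (Ordinal kr) g ka hg.
move: nz; rewrite he // linear_sum sum_ffunE => /eqP nz.
have [j hj nj] : exists2 j, par j &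
    phi ((-1) ^+ e j *: kE j (g (Ordinal kr)) (Pp A p k u (upd g (Ordinal kr) j))) S != 0.
  apply: contrapT => no; apply: nz; apply: big1 => j hj; apply/eqP.
  by apply: contrapT => /negP nj; apply: no; exists j.
move: nj; rewrite linearZ /= ffunE phi_lower ?hg //= ffunE; case: ifP => jS nj; last first.
  by move: nj; rewrite scaler0 eqxx.
have [ck'|kc] := ltnP c k; last first.
  have -> : c = Ordinal kr by apply/val_inj/anti_leq; rewrite kc -ltnS ck.
  by exists j.
have nk : c != Ordinal kr by rewrite -val_eqE /= ltn_eqF.
have [||o] := IH (upd g (Ordinal kr) j) (S :\ (j, g (Ordinal kr))) (ltnW ka) hu _ _ c ck'.
- by move=> d dk; rewrite upd_other ?hg ?ltnS ?(ltnW dk) // -val_eqE /= ltn_eqF.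
- by apply: contra_neq nj => ->; rewrite mulr0 scaler0.
by rewrite upd_other // => /setD1P[_ oS]; exists o.
Qed.

Variables f0 h : W.
Hypothesis f0_odd : forall c : 'I_r, par (f0 c) = (c < a)%N.
Hypothesis h_even : forall c : 'I_r, ~~ par (h c).
Hypothesis h_inj : forall c d : 'I_r, (c < a)%N -> h c = h d -> c = d.
Hypothesis h_f0 : forall c : 'I_r, (a <= c)%N -> h c = f0 c.

Definition mix k : W := [ffun c : 'I_r => if (c < k)%N then h c else f0 c].
Definition pairs k : {set I * I} := [set (f0 c, h c) | c in 'I_r & (c < k)%N].

Lemma mix_a : mix a = h.
Proof. by apply/ffunP => c; rewrite ffunE; case: ltnP => // /h_f0. Qed.

(** The letters h c being distinct, the box of [pairs] that contains h c can only come from the step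
    at position c, and it forces the odd letter f0 c there. A single path from [f0] to [mix k]
    remains. *)
Lemma P_leading k : (k <= a)%N -> exists e : nat, forall u, split_at u ->
  phi (Pp A p k u (mix k)) (pairs k) = (-1) ^+ e * phi (u f0) set0.
Proof.
elim: k => [_|k IH ka].
  exists 0%N => u _; rewrite mul1r; congr (phi (u _) _).
    by apply/ffunP => c; rewrite ffunE.
  by apply/setP => x; rewrite inE; apply/imsetP => -[c]; rewrite inE.
have [e he] := IH (ltnW ka); have kr : (k < r)%N by apply: leq_trans ar.
pose K0 := Ordinal kr.
have hg (c : 'I_r) : (c <= k)%N -> ~~ par (mix k.+1 c) by move=> hc; rewrite ffunE ltnS hc.
have [e' he'] := @P_step K0 (mix k.+1) ka hg.
have mk : mix k.+1 K0 = h K0 by rewrite ffunE ltnSn.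
have inS j : ((j, h K0) \in pairs k.+1) = (j == f0 K0).
  apply/imsetP/eqP => [[c] _ [-> /h_inj ->//]|->]; last by exists K0; rewrite // inE /=.
have Sk : pairs k.+1 :\ (f0 K0, h K0) = pairs k.
  apply/setP => -[i j]; rewrite inE; apply/andP/imsetP => [[+ /imsetP[c]]|[c]].
    rewrite inE ltnS leq_eqVlt => nc /orP[/eqP ck|ck] ec; last by exists c; rewrite ?inE.
    by case/negP: nc; rewrite ec inE (_ : c = K0) //; apply: val_inj.
  rewrite inE => ck [-> ->]; split; last by apply/imsetP; exists c; rewrite ?inE ?ltnS 1?ltnW.
  rewrite inE; apply/eqP => -[_ /h_inj e0]; have := e0 (leq_trans ck (ltnW ka)) => ec.
  by move: ck; rewrite ec ltnn.
have uk : upd (mix k.+1) K0 (f0 K0) = mix k.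
  apply/ffunP => c; rewrite !ffunE -val_eqE /= ltnS leq_eqVlt; case: eqP => //= ck.
  by rewrite ck ltnn; congr (f0 _); apply: val_inj.
have [s hs] : exists s : nat, forall u, split_at u ->
    phi (Pp A p k.+1 u (mix k.+1)) (pairs k.+1) = (-1) ^+ s * phi (Pp A p k u (mix k)) (pairs k).
  exists (e' (f0 K0) + nbefore (f0 K0, h K0) (pairs k.+1))%N => u hu.
  rewrite he' // linear_sum sum_ffunE (bigD1 (f0 K0)) ?f0_odd //= [X in _ + X]big1 ?addr0.
    rewrite linearZ /= ffunE phi_lower ?f0_odd ?hg // ffunE mk inS eqxx Sk uk.
    by rewrite regZ exprD mulrA.
  move=> j /andP[hj jf]; rewrite linearZ /= ffunE phi_lower ?hg // ffunE mk inS (negbTE jf).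
  by rewrite scaler0.
by exists (s + e)%N => u hu; rewrite hs // he // mulrA exprD.
Qed.

Hypothesis f0_h : forall c d : 'I_r, (a <= c)%N -> (d < a)%N -> f0 c != h d.

(** By [P_support] each h (w c) with c < a is the even entry of a box in [pairs a], hence some h d
    with d < a; this is impossible for w c >= a, where h agrees with f0. *)
Lemma P_not_preserving (w : 'S_r) u : split_at u -> ~ (forall k, (w k < a) = (k < a))%N ->
  phi (permop w (Pp A p a u) h) (pairs a) = 0.
Proof.
move=> hu hw; have [e ->] := pi_coef w h; rewrite linearZ /= ffunE.
apply/eqP; rewrite scaler_eq0; apply/orP; right; apply: contraT => nz; case: hw.
have sub (c : 'I_r) : (c < a)%N -> (w c < a)%N.
  have hc (d : 'I_r) : (d < a)%N -> ~~ par (wcomp h w d) by rewrite ffunE.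
  move=> ca; have [j /imsetP[d]] := P_support (leqnn a) hu hc nz ca.
  rewrite inE ffunE => da [_]; rewrite ltnNge => e1; apply/negP => ac.
  by have := f0_h ac da; rewrite -e1 h_f0 // eqxx.
have /eqP e2 : w @: [set c : 'I_r | (c < a)%N] == [set c : 'I_r | (c < a)%N].
  rewrite eqEcard card_imset ?leqnn ?andbT; last exact: perm_inj.
  by apply/subsetP => x /imsetP[c]; rewrite !inE => /sub ? ->.
move=> k; apply/idP/idP => [wk|/sub//].
have : w k \in w @: [set c : 'I_r | (c < a)%N] by rewrite e2 inE.
by case/imsetP => d; rewrite inE => da /perm_inj ->.
Qed.

End LeadingTerms.

(** * Tableaux and words *)

Definition bcomp (la : seq nat * seq nat) (c : bool) : seq nat := if c then la.2 else la.1.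

Lemma mem_row_cells c s b i j :
  ((b, i, j) \in row_cells c s) = (b == c) && (j < nth 0%N s i)%N.
Proof.
apply/allpairsPdep/andP => [[i' [j' []]]|[/eqP -> h]].
  by rewrite !mem_iota /= !add0n => hi hj [-> -> ->].
exists i, j; rewrite !mem_iota /= !add0n h; split=> //.
by rewrite ltnNge; apply: contraTN h => hs; rewrite nth_default.
Qed.

Lemma mem_rowread la c i j : ((c, i, j) \in rowread la) = (j < nth 0%N (bcomp la c) i)%N.
Proof. by rewrite mem_cat !mem_row_cells /bcomp; case: c; rewrite /= ?orbF. Qed.

Lemma part_mono s i j : is_part s -> (i <= j)%N -> (nth 0%N s j <= nth 0%N s i)%N.
Proof.
case/andP=> ss _ ij; have [js|sj] := ltnP j (size s); last by rewrite nth_default.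
have tr : transitive geq by move=> a b d h1 h2; exact: leq_trans h2 h1.
apply: (sorted_leq_nth tr leqnn 0%N ss) => //; rewrite inE //.
exact: leq_ltn_trans ij js.
Qed.

Lemma count_initial (P : pred nat) N : (forall i j, (i <= j)%N -> P j -> P i) ->
  [seq i <- iota 0 N | P i] = iota 0 (count P (iota 0 N)).
Proof.
move=> hP; elim: N => [//|N IH].
rewrite -addn1 iotaD add0n filter_cat count_cat IH /= addn0.
case: ifP => PN; last by rewrite addn0 cats0.
have -> : count P (iota 0 N) = N.
  rewrite -[RHS](size_iota 0); apply/eqP; rewrite -all_count.
  by apply/allP => i; rewrite mem_iota /= => /ltnW /hP; apply.
by rewrite addn1 -[iota 0 N.+1]/(iota 0 N.+1) -addn1 iotaD.
Qed.

Lemma nth_conj_part s i j : is_part s -> (j < nth 0%N (conj_part s) i)%N = (i < nth 0%N s j)%N.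
Proof.
move=> hs; have E : count (fun x => (i < x)%N) s = count (fun k => (i < nth 0%N s k)%N) (iota 0 (size s)).
  by rewrite -[in LHS](mkseq_nth 0%N s) count_map; apply: eq_count.
have mono a b : (a <= b)%N -> (i < nth 0%N s b)%N -> (i < nth 0%N s a)%N.
  by move=> ab h; apply: leq_trans h (part_mono hs ab).
have F := count_initial (size s) mono; rewrite -E in F.
have M : (j < count (fun x => (i < x)%N) s)%N = (i < nth 0%N s j)%N.
  have : (j \in [seq k <- iota 0 (size s) | (i < nth 0%N s k)%N]) =
     (j \in iota 0 (count (fun x => (i < x)%N) s)) by rewrite F.
  rewrite mem_filter !mem_iota !add0n /= => <-.
  have [js|sj] := ltnP j (size s); first by rewrite andbT.
  by rewrite nth_default ?andbF.
have [hi|hi] := ltnP i (head 0%N s); first by rewrite nth_mkseq.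
rewrite nth_default ?size_mkseq // ltn0; apply/esym/negbTE; rewrite -leqNgt.
exact: leq_trans (nth_le_head j hs) hi.
Qed.

Definition transp (x : node) : node := (~~ ncomp x, ncol x, nrow x).

Lemma transpK : involutive transp.
Proof. by move=> [[c i] j]; rewrite /transp /= negbK. Qed.

Lemma row_cells_conj c s : is_part s -> row_cells (~~ c) (conj_part s) = map transp (col_cells c s).
Proof.
move=> hs; rewrite /row_cells /col_cells size_mkseq.
rewrite map_flatten -map_comp; congr flatten; apply/eq_in_map => j.
rewrite mem_iota add0n => /= hj; rewrite -map_comp.
have mono a b : (a <= b)%N -> (j < nth 0%N s b)%N -> (j < nth 0%N s a)%N.
  by move=> ab h; apply: leq_trans h (part_mono hs ab).
rewrite (count_initial (size s) mono) nth_mkseq //; congr map; congr iota.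
by rewrite -[in LHS](mkseq_nth 0%N s) count_map; apply: eq_count.
Qed.

Lemma rowread_conj r (la : bipart r) : rowread (conj_bipart la) = map transp (colread la).
Proof.
case: la => [[s t] /= /and3P[hs ht _]].
by rewrite /rowread /colread /= map_cat -(row_cells_conj true ht) -(row_cells_conj false hs).
Qed.

Lemma bcomp_part r (la : bipart r) c : is_part (bcomp la c).
Proof. by case: la => [[s t] /= /and3P[hs ht _]]; case: c. Qed.

Lemma part_size s : is_part s -> (size s <= sumn s)%N.
Proof.
case/andP=> _; elim: s => [//|[|x] s IH] //=; rewrite inE /= => h.
by rewrite -addn1 addnC leq_add // IH.
Qed.

Lemma bcomp_sumn r (la : bipart r) : (sumn la.1 + sumn la.2 = r)%N.
Proof. by case: la => [[s t] /= /and3P[_ _ /eqP]]. Qed.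

(** * Tableaux and row stabilizers *)

Section GeneralTableaux.
Variables (r : nat) (mu : bipart r).
Notation cell := (cell mu).
Notation tab := (tableau mu).
Notation "t @@ x" := ((t : {ffun cell -> 'I_r}) x) (at level 10).
Notation e := (tab_row mu).

Lemma card_cell : #|cell| = r.
Proof.
rewrite card_seq_sub ?size_rowread // cat_uniq !uniq_row_cells andbT /=.
by apply/hasPn => -[[c i] j]; rewrite !mem_row_cells => /andP[/eqP -> _].
Qed.

Lemma tab_of_inj s (hs : perm_eq s (rowread mu)) : injective (tab_of hs : {ffun cell -> 'I_r}).
Proof.
move=> x y; rewrite !ffunE => -[] /(congr1 (nth (false, 0%N, 0%N) s)).
by rewrite !nth_index ?(perm_mem hs) ?ssvalP // => /val_inj.
Qed.

Lemma tab_surj (t : tab) : injective (t : {ffun cell -> 'I_r}) -> forall c, exists x, t @@ x = c.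
Proof.
move=> ti c; have /(inj_card_onto ti) h : (#|'I_r| <= #|cell|)%N by rewrite card_cell card_ord.
by have /codomP[x ->] := h c; exists x.
Qed.

Lemma tab_row_inj : injective (e : {ffun cell -> 'I_r}).
Proof. exact: tab_of_inj. Qed.

Definition row_surj := tab_surj tab_row_inj.

(** Both t and the initial tableau are bijections, so the search in [tab_perm] succeeds and its
    default value is never taken. *)
Lemma tab_permP (t : tab) : injective (t : {ffun cell -> 'I_r}) ->
  forall x, tab_perm t (e @@ x) = t @@ x.
Proof.
move=> ti; rewrite /tab_perm; case: pickP => [w /eqP <- x|no]; first by rewrite [RHS]ffunE.
pose g c : 'I_r := if [pick x | e @@ x == c] is Some x then t @@ x else c.
have ge x : g (e @@ x) = t @@ x.
  rewrite /g; case: pickP => [y /eqP /tab_row_inj ->|/(_ x)] //.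
  by rewrite eqxx.
have gi : injective g.
  move=> c d; have [x <-] := row_surj c; have [y <-] := row_surj d.
  by rewrite !ge => /ti ->.
have := no (perm gi); rewrite (_ : tab_act _ _ = t) ?eqxx //.
by apply/ffunP => x; rewrite [LHS]ffunE permE ge.
Qed.

Lemma row_stabP c (w : 'S_r) : reflect
  (forall x y, w (e @@ x) = e @@ y ->
     if ncomp (ssval x) == c then (ncomp (ssval y) == c) && (nrow (ssval y) == nrow (ssval x)) else x == y)
  (w \in row_stab mu c).
Proof.
rewrite inE; apply: (iffP forallP) => [h x y wxy|h x].
  by have /forallP/(_ y) := h x; rewrite wxy eqxx.
by apply/forallP => y; apply/implyP => /eqP; apply: h.
Qed.

Lemma row_stab1 c : 1%g \in row_stab mu c.
Proof.
apply/row_stabP => x y; rewrite perm1 => /tab_row_inj ->.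
by rewrite !eqxx; case: (_ == c).
Qed.

Lemma row_stabM c w w' : w \in row_stab mu c -> w' \in row_stab mu c -> (w * w')%g \in row_stab mu c.
Proof.
move=> /row_stabP h /row_stabP h'; apply/row_stabP => x y; rewrite permM.
have [z hz] := row_surj (w (e @@ x)); have := h x z (esym hz); rewrite -hz => h1 /h'.
case: ifP h1 => [_ /andP[-> /eqP ->]|hx /eqP <-] //.
by rewrite hx.
Qed.

Lemma row_stab_tperm x y : ncomp (ssval x) = ncomp (ssval y) -> nrow (ssval x) = nrow (ssval y) ->
  tperm (e @@ x) (e @@ y) \in row_stab mu (ncomp (ssval x)).
Proof.
move=> hc hr; apply/row_stabP => a b.
case: tpermP => [/tab_row_inj -> /tab_row_inj <-|/tab_row_inj -> /tab_row_inj <-|_ _ /tab_row_inj ->].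
- by rewrite hc hr !eqxx.
- by rewrite hc hr !eqxx.
- by rewrite !eqxx; case: (_ == _).
Qed.

Lemma row_stab_fix c w x : w \in row_stab mu c -> ncomp (ssval x) != c -> w (e @@ x) = e @@ x.
Proof.
move=> /row_stabP h hx; have [y hy] := row_surj (w (e @@ x)).
by have := h x y (esym hy); rewrite (negbTE hx) -hy => /eqP ->.
Qed.

Lemma row_stab_row c w x : w \in row_stab mu c -> exists y, [/\ w (e @@ x) = e @@ y,
  ncomp (ssval y) = ncomp (ssval x) & nrow (ssval y) = nrow (ssval x)].
Proof.
move=> /row_stabP h; have [y hy] := row_surj (w (e @@ x)); exists y; split=> //.
  by have := h x y (esym hy); case: ifP => [/eqP -> /andP[/eqP -> _]|_ /eqP ->].
by have := h x y (esym hy); case: ifP => [_ /andP[_ /eqP ->]|_ /eqP ->].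
Qed.

Lemma standardP (t : tab) : standard t -> [/\ injective (t : {ffun cell -> 'I_r}),
  forall x y, ncomp (ssval x) = ncomp (ssval y) -> nrow (ssval x) = nrow (ssval y) ->
     (ncol (ssval x) < ncol (ssval y))%N -> (t @@ x < t @@ y)%N &
  forall x y, ncomp (ssval x) = ncomp (ssval y) -> ncol (ssval x) = ncol (ssval y) ->
     (nrow (ssval x) < nrow (ssval y))%N -> (t @@ x < t @@ y)%N].
Proof.
case/and3P => /injectiveP ti /forallP h1 /forallP h2; split=> // x y hc hr hlt.
  by have /forallP/(_ y)/implyP := h1 x; apply; rewrite hc hr hlt !eqxx.
by have /forallP/(_ y)/implyP := h2 x; apply; rewrite hc hr hlt !eqxx.
Qed.

End GeneralTableaux.
Arguments row_surj {r} mu c.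
Arguments tab_row_inj {r mu x1 x2}.

Lemma lex_minimum (T : finType) (P : pred T) (N : nat) (F : T -> nat -> nat) (t0 : T) : P t0 ->
  exists2 s, P s & forall t, P t ->
    (forall c, (c < N)%N -> F t c = F s c) \/
    exists2 k, (k < N)%N & (forall c, (c < k)%N -> F t c = F s c) /\ (F s k < F t k)%N.
Proof.
move=> Pt0; elim: N => [|N [s Ps IH]]; first by exists t0 => // t _; left.
pose Q := [pred t | P t && [forall c : 'I_N, F t c == F s c]].
have Qs : Q s by rewrite /Q /= Ps; apply/forallP.
exists [arg min_(t < s | Q t) F t N] => [|t Pt]; case: (arg_minnP (F^~ N) Qs) => u /andP[Pu /forallP Au] Mu //.
have Eu c : (c < N)%N -> F u c = F s c by move=> h; apply/eqP/(Au (Ordinal h)).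
have [At|[k kN [A1 A2]]] := IH t Pt; last first.
  right; exists k; first (by rewrite ltnS ltnW); split=> [c ck|]; last by rewrite Eu.
  by rewrite A1 // Eu // (ltn_trans ck).
have Qt : Q t by rewrite /Q /= Pt; apply/forallP => c; rewrite At.
have := Mu t Qt; rewrite leq_eqVlt => /orP[/eqP E|L]; last first.
  by right; exists N => //; split=> // c cN; rewrite At // Eu.
left=> c; rewrite ltnS leq_eqVlt => /orP[/eqP -> //|cN]; by rewrite At // Eu.
Qed.

(** * Words of tableaux and the lattice condition *)

Section Letters.
Variables (m n r : nat).
Notation I := 'I_(m + n).
Notation par := (@par m n).
Notation W := {ffun 'I_r -> I}.

(** Conjugation swaps the components: a column of the first component of la' is a row of the second
    component of la, hence an odd letter, with index shifted by m. *)
Definition letter (x : node) : nat := if ncomp x then ncol x else (m + ncol x)%N.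

Definition cnt (g : W) (l k : nat) : nat := #|[set b : 'I_r | (b < k)%N && (g b == l :> nat)]|.

(** The Yamanouchi condition, imposed separately on the even and on the odd letters; prefixes are
    read from the tensor factor labelled 1. *)
Definition lattice (g : W) := forall k (i j : I), (i < j)%N -> par i = par j ->
  (cnt g j k <= cnt g i k)%N.

Lemma cntS g l (k : 'I_r) : cnt g l k.+1 = (cnt g l k + (g k == l :> nat))%N.
Proof.
rewrite /cnt (cardsD1 k) inE ltnSn addnC /=; congr (_ + _)%N.
apply: eq_card => b; rewrite !inE ltnS (leq_eqVlt b) -[(b == k :> nat)]/(b == k).
by case: (eqVneq b k) => [->|_] //=; rewrite ltnn.
Qed.

Lemma cnt_mono g l k k' : (k <= k')%N -> (cnt g l k <= cnt g l k')%N.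
Proof.
move=> h; apply/subset_leq_card/subsetP => b; rewrite !inE => /andP[bk ->].
by rewrite (leq_trans bk h).
Qed.

Lemma cnt_occ g l o k : (k <= r)%N -> (o < cnt g l k)%N -> exists c : 'I_r,
  g c = l :> nat /\ cnt g l c = o.
Proof.
elim: k => [_|k IH kr].
  by rewrite /cnt (_ : [set _ | _] = set0) ?cards0 //; apply/setP => b; rewrite !inE.
have [h _|h] := ltnP o (cnt g l k); first exact: IH (ltnW kr) h.
rewrite (cntS g l (Ordinal kr)) /=; case: eqP => [e|_]; rewrite ?addn0 ?addn1; last first.
  by move=> h'; have := leq_ltn_trans h h'; rewrite ltnn.
rewrite ltnS => h'; exists (Ordinal kr); split=> //=.
by apply/anti_leq; rewrite h h'.
Qed.

Section Words.
Variable la : bipart r.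
Hypothesis la1 : (size la.1 <= m)%N.
Hypothesis la2 : (size la.2 <= n)%N.
Notation mu := (conj_bipart la).
Notation cell := (cell mu).
Notation tab := (tableau mu).
Notation "t @@ x" := ((t : {ffun cell -> 'I_r}) x) (at level 10).
Variable i0 : I.

Lemma mem_conj c i j : ((c, i, j) \in rowread mu) = (i < nth 0%N (bcomp la (~~ c)) j)%N.
Proof.
rewrite mem_rowread /bcomp; have := bcomp_part la (~~ c).
by case: c => /= h; apply: nth_conj_part.
Qed.

Lemma cell_bound (x : cell) : (ncol (ssval x) < if ncomp (ssval x) then m else n)%N.
Proof.
have := ssvalP x; case: (ssval x) => [[c i] j]; rewrite mem_conj /ncol /ncomp /=.
have size_nth (s : seq nat) : (i < nth 0 s j)%N -> (j < size s)%N.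
  by move=> h; rewrite ltnNge; apply: contraTN h => h; rewrite -leqNgt nth_default.
by case: c => /= /size_nth h; apply: leq_trans h _.
Qed.

Lemma letter_bound (x : cell) : (letter (ssval x) < m + n)%N.
Proof.
by have := cell_bound x; rewrite /letter; case: ifP => _ h; rewrite ?ltn_add2l // ltn_addr.
Qed.

Lemma letter_par (x : cell) : (m <= letter (ssval x))%N = ~~ ncomp (ssval x).
Proof.
have := cell_bound x; rewrite /letter; case: ifP => _ h; last by rewrite leq_addr.
by rewrite leqNgt h.
Qed.

Lemma letter_inj (x y : cell) : letter (ssval x) = letter (ssval y) ->
  ncomp (ssval x) = ncomp (ssval y) /\ ncol (ssval x) = ncol (ssval y).
Proof.
move=> e; have c : ncomp (ssval x) = ncomp (ssval y).
  by apply: negb_inj; rewrite -!letter_par e.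
by split=> //; move: e; rewrite /letter c; case: ifP => // _ /addnI.
Qed.

Definition word (t : tab) : W :=
  [ffun c => if [pick x | t @@ x == c] is Some x then insubd i0 (letter (ssval x)) else i0].

Lemma wordE (t : tab) x : injective (t : {ffun cell -> 'I_r}) ->
  word t (t @@ x) = letter (ssval x) :> nat.
Proof.
move=> ti; rewrite ffunE; case: pickP => [y /eqP /ti ->|/(_ x)]; last by rewrite eqxx.
by rewrite insubdK // -topredE /= letter_bound.
Qed.

Lemma word_uniq (t : tab) (f : W) : injective (t : {ffun cell -> 'I_r}) ->
  (forall x, f (t @@ x) = letter (ssval x) :> nat) -> f = word t.
Proof.
move=> ti h; apply/ffunP => c; have [x <-] := tab_surj ti c.
by apply: val_inj; rewrite /= h wordE.
Qed.

Lemma cell_eq (x y : cell) : ncomp (ssval x) = ncomp (ssval y) ->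
  nrow (ssval x) = nrow (ssval y) -> ncol (ssval x) = ncol (ssval y) -> x = y.
Proof.
move=> h1 h2 h3; apply: val_inj; move: h1 h2 h3.
by case: x y => [[[c i] j] hx] [[[c' i'] j'] hy]; rewrite /ncomp /nrow /ncol /= => -> -> ->.
Qed.

(** The entries of a column of a standard tableau increase downwards, so the column is the ordered
    list of the positions of its letter and can be recovered from the word. *)
Lemma word_inj (s t : tab) : standard s -> standard t -> word s = word t -> s = t.
Proof.
move=> /standardP[si _ sc] /standardP[ti _ tc] E.
have half (a b : tab) (x : cell) : injective (a : {ffun cell -> 'I_r}) -> injective (b : {ffun cell -> 'I_r}) ->
    (forall x y, ncomp (ssval x) = ncomp (ssval y) -> ncol (ssval x) = ncol (ssval y) ->
     (nrow (ssval x) < nrow (ssval y))%N -> (b @@ x < b @@ y)%N) -> word a = word b ->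
    (forall y, (nrow (ssval y) < nrow (ssval x))%N -> a @@ y = b @@ y) -> (b @@ x <= a @@ x)%N.
  move=> ai bi bc ab IH; rewrite leqNgt; apply/negP => lt.
  have [z hz] := tab_surj bi (a @@ x).
  have /letter_inj[zc zl] : letter (ssval z) = letter (ssval x).
    by rewrite -(wordE z bi) hz -ab wordE.
  have [hr|hr|hr] := ltngtP (nrow (ssval z)) (nrow (ssval x)).
  - by have := IH z hr; rewrite hz => /ai e; move: hr; rewrite e ltnn.
  - by have := bc x z (esym zc) (esym zl) hr; rewrite hz ltnNge (ltnW lt).
  - by move: lt; rewrite -hz (cell_eq zc hr zl) ltnn.
apply/ffunP => x; have [k] := ubnP (nrow (ssval x)); elim: k x => // k IH x hk.
have IH' y : (nrow (ssval y) < nrow (ssval x))%N -> s @@ y = t @@ y.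
  by move=> h; apply: IH; apply: leq_trans h _; rewrite -ltnS.
apply/val_inj/anti_leq; rewrite (half t s) ?(half s t) // => y hy; exact/esym/IH'.
Qed.

(* The letters of word t in the positions occupied by a row of s are those of
   that row, and word s places them in increasing order. *)
Lemma word_le (s t : tab) (w d : 'S_r) : standard s -> standard t ->
    (forall x, exists y, [/\ w (tab_row mu @@ x) = tab_row mu @@ y,
       ncomp (ssval y) = ncomp (ssval x) & nrow (ssval y) = nrow (ssval x)]) ->
    (forall x, d (tab_row mu @@ x) = s @@ x) ->
    (forall c, word t (d (w c)) = word (tab_row mu) c) ->
  forall k : 'I_r, (forall c : 'I_r, (c < k)%N -> word s c = word t c) ->
    (word s k <= word t k)%N.
Proof.
move=> /standardP[si sr _] /standardP[ti _ _] hw hd hf k hk.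
have [x' ex] := tab_surj si k.
have [x wx] : exists x, w (tab_row mu @@ x) = tab_row mu @@ x'.
  have [x hx] := row_surj mu ((w^-1)%g (tab_row mu @@ x')).
  by exists x; rewrite hx permKV.
have E y y' : w (tab_row mu @@ y) = tab_row mu @@ y' -> word t (s @@ y') = letter (ssval y) :> nat.
  by move=> h; rewrite -hd -h hf wordE //; exact: (@tab_row_inj r mu).
have R y y' : w (tab_row mu @@ y) = tab_row mu @@ y' ->
    ncomp (ssval y') = ncomp (ssval y) /\ nrow (ssval y') = nrow (ssval y).
  by move=> h; have [z [hz h1 h2]] := hw y; move: hz; rewrite h => /tab_row_inj ->.
have [xc xr] := R x x' wx.
have le : (ncol (ssval x') <= ncol (ssval x))%N.
  rewrite leqNgt; apply/negP => lt.
  have lt' := sr x x' (esym xc) (esym xr) lt; rewrite ex in lt'.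
  have [x2 wx2] : exists x2, w (tab_row mu @@ x2) = tab_row mu @@ x.
    have [x2 hx2] := row_surj mu ((w^-1)%g (tab_row mu @@ x)).
    by exists x2; rewrite hx2 permKV.
  have [x2c x2r] := R x2 x wx2.
  have /letter_inj[_ x2l] : letter (ssval x2) = letter (ssval x).
    by rewrite -(E x2 x wx2) -hk // wordE.
  have e2 : x2 = x by apply: cell_eq.
  by move: wx lt; rewrite -{1}e2 wx2 => /tab_row_inj ->; rewrite ltnn.
rewrite -ex wordE // (E x x' wx) /letter xc.
by case: ifP => _ //; rewrite leq_add2l.
Qed.

(** The cell in row o of a column receives the position of occurrence number o, counted from 0, of
    its letter. Columns then increase automatically, and the lattice condition gives the increase
    along rows. *)
Lemma lattice_standard (g : W) : lattice g -> (forall i : I, cnt g i r = part_at la i) ->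
  exists2 t : tab, standard t & word t = g.
Proof.
move=> lg cg.
have ex (x : cell) : exists c : 'I_r, g c = letter (ssval x) :> nat /\
    cnt g (letter (ssval x)) c = nrow (ssval x).
  apply: (@cnt_occ g _ _ r) => //.
  rewrite (cg (Ordinal (letter_bound x))) /part_at /Defs.par /= letter_par.
  have := ssvalP x; case: (ssval x) => [[c i] j]; rewrite mem_conj /letter /ncomp /nrow /ncol /=.
  by case: c => //=; rewrite addKn.
pose t : tab := [ffun x => projT1 (cid (ex x))].
have tg x : g (t @@ x) = letter (ssval x) :> nat by rewrite ffunE; case: (projT2 (cid (ex x))).
have tn x : cnt g (letter (ssval x)) (t @@ x) = nrow (ssval x).
  by rewrite ffunE; case: (projT2 (cid (ex x))).
have ti : injective (t : {ffun cell -> 'I_r}).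
  move=> x y e; have el : letter (ssval x) = letter (ssval y) by rewrite -!tg e.
  by have [h1 h2] := letter_inj el; apply: cell_eq => //; rewrite -!tn e el.
exists t; last by apply/esym/word_uniq.
apply/and3P; split; first exact/injectiveP.
  apply/forallP => x; apply/forallP => y; apply/implyP => /and3P[/eqP hc /eqP hr hlt].
  rewrite ltnNge leq_eqVlt; apply/negP => /orP[/eqP /val_inj/ti e|lt].
    by move: hlt; rewrite e ltnn.
  have ll : (letter (ssval x) < letter (ssval y))%N.
    by rewrite /letter hc; case: ifP => _ //; rewrite ltn_add2l.
  have := lg (t @@ y).+1 (Ordinal (letter_bound x)) (Ordinal (letter_bound y)) ll.
  rewrite /Defs.par /= !letter_par hc => /(_ erefl).
  rewrite cntS tn tg eqxx addn1 -hr -tn => h.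
  by have := leq_trans h (cnt_mono g _ lt); rewrite ltnn.
apply/forallP => x; apply/forallP => y; apply/implyP => /and3P[/eqP hc /eqP hr hlt].
have el : letter (ssval x) = letter (ssval y) by rewrite /letter hc hr.
rewrite ltnNge; apply: contraTN hlt => h; rewrite -leqNgt -!tn el.
exact: cnt_mono.
Qed.

End Words.
End Letters.

Lemma nth_filter_pos s i : sorted geq s -> nth 0%N [seq x <- s | 0 < x]%N i = nth 0%N s i.
Proof.
elim: s i => [//|x s IH] i ss /=.
have ss' : sorted geq s := path_sorted ss.
case: ltnP => [x0|]; first by case: i => [//|i] /=; apply: IH.
rewrite leqn0 => /eqP x0; rewrite IH //.
have tr : transitive geq by move=> a b d h1 h2; exact: leq_trans h2 h1.
have z j : nth 0%N s j = 0%N.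
  have [js|sj] := ltnP j (size s); last by rewrite nth_default.
  have := order_path_min tr ss => /allP/(_ _ (mem_nth 0%N js)).
  by rewrite /= x0 leqn0 => /eqP.
by case: i => [|i] /=; rewrite z.
Qed.

Lemma sumn_filter_pos s : sumn [seq x <- s | 0 < x]%N = sumn s.
Proof. by elim: s => //= -[|x] s IH /=; rewrite IH. Qed.

Lemma filter_pos_part s : sorted geq s -> is_part [seq x <- s | 0 < x]%N.
Proof.
move=> ss; have tr : transitive geq by move=> a b d h1 h2; exact: leq_trans h2 h1.
by rewrite /is_part sorted_filter //= mem_filter.
Qed.

Lemma sumn_mkseq f k : sumn (mkseq f k) = (\sum_(i < k) f i)%N.
Proof. by rewrite sumnE big_map -(big_mkord xpredT) /index_iota subn0. Qed.

Lemma flatten_nseq_rows c s (F : nat -> nat) k : (size s <= k)%N ->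
  flatten [seq nseq (nth 0%N s i) (F i) | i <- iota 0 k] =
  [seq F (nrow x) | x <- row_cells c s].
Proof.
move=> sk; rewrite -(subnKC sk) iotaD map_cat flatten_cat.
have -> : flatten [seq nseq (nth 0%N s i) (F i) | i <- iota (0 + size s) (k - size s)] = [::].
  have h : all (fun i => (size s <= i)%N) (iota (0 + size s) (k - size s)).
    by apply/allP => i; rewrite mem_iota => /andP[].
  elim: (iota _ _) h => //= i l IH /andP[hi hl].
  by rewrite IH // cats0 nth_default.
rewrite cats0 /row_cells map_flatten -map_comp; congr flatten; apply: eq_map => i /=.
rewrite -map_comp; move: (iota 0 _) (size_iota 0 (nth 0%N s i)) => l <-.
by elim: l => //= a l ->.
Qed.

(** * The bipartition of a lattice word and the initial word *)

Section Readings.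
Variables (m n r : nat).
Notation I := 'I_(m + n).
Notation par := (@par m n).
Notation W := {ffun 'I_r -> I}.

Lemma sum_cnt (g : W) : (\sum_(l : I) cnt g l r = r)%N.
Proof.
rewrite -[RHS]card_ord -sum1_card (partition_big g xpredT) //=.
apply: eq_bigr => l _; rewrite sum1dep_card; apply: eq_card => b.
by rewrite !inE ltn_ord.
Qed.

(** Over the whole word the counts of the letters decrease within each parity; zero counts are
    dropped because [is_part] excludes them. *)
Lemma lattice_bipart (g : W) : lattice g -> exists la : bipart r,
  [/\ size la.1 <= m, size la.2 <= n & forall i : I, part_at la i = cnt g i r]%N.
Proof.
move=> lg; pose s1 := mkseq (fun l => cnt g l r) m; pose s2 := mkseq (fun l => cnt g (m + l) r) n.
have ss1 : sorted geq s1.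
  apply/(sortedP 0%N) => i; rewrite size_mkseq => hi; rewrite /= !nth_mkseq //; last exact: ltnW.
  have h1 : (i.+1 < m + n)%N by rewrite ltn_addr.
  have h := lg r (Ordinal (ltnW h1)) (Ordinal h1) (ltnSn i).
  by move: h; rewrite /Defs.par /= !(leqNgt m) hi (ltnW hi); apply.
have ss2 : sorted geq s2.
  apply/(sortedP 0%N) => i; rewrite size_mkseq => hi; rewrite /= !nth_mkseq //; last exact: ltnW.
  have h1 : (m + i.+1 < m + n)%N by rewrite ltn_add2l.
  have h2 : (m + i < m + n)%N by rewrite ltn_add2l ltnW.
  have := lg r (Ordinal h2) (Ordinal h1).
  by rewrite /Defs.par /= ltn_add2l !leq_addr; apply.
have P : [&& is_part [seq x <- s1 | 0 < x]%N, is_part [seq x <- s2 | 0 < x]%N &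
    sumn [seq x <- s1 | 0 < x] + sumn [seq x <- s2 | 0 < x] == r]%N.
  rewrite !filter_pos_part // !sumn_filter_pos !sumn_mkseq /=.
  by rewrite -[X in _ == X](sum_cnt g) big_split_ord.
exists (Bipart (bp := ([seq x <- s1 | 0 < x], [seq x <- s2 | 0 < x])%N) P).
split=> [||i]; rewrite /= ?(leq_trans (size_filter_le _ _)) ?size_filter ?(leq_trans (count_size _ _)) ?size_mkseq //.
rewrite /part_at /= !nth_filter_pos // /Defs.par; case: ifP => hi.
  rewrite nth_mkseq ?subnKC //; have := ltn_ord i; lia.
by rewrite nth_mkseq // ltnNge hi.
Qed.

Section Fixed.
Variable la : bipart r.
Hypothesis la1 : (size la.1 <= m)%N.
Hypothesis la2 : (size la.2 <= n)%N.
Notation mu := (conj_bipart la).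
Notation "t @@ x" := ((t : {ffun _ -> 'I_r}) x) (at level 10).

Lemma val_i_seq : map val (i_seq m n la) = [seq letter m (transp x) | x <- rowread la].
Proof.
rewrite /i_seq map_flatten -map_comp.
rewrite (eq_map (g := (fun k => nseq (if (m <= k)%N then nth 0%N la.2 (k - m) else nth 0%N la.1 k) k) \o val)); last first.
  by move=> i; rewrite /= map_nseq.
rewrite map_comp val_enum_ord iotaD map_cat flatten_cat map_cat; congr (_ ++ _).
  have -> : [seq letter m (transp x) | x <- row_cells false la.1] = [seq nrow x | x <- row_cells false la.1].
    by apply/eq_in_map => -[[c i] j]; rewrite mem_row_cells => /andP[/eqP -> _].
  rewrite -(flatten_nseq_rows false id la1); congr flatten; apply/eq_in_map => k.
  by rewrite mem_iota add0n /= => hk; rewrite leqNgt hk.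
have -> : [seq letter m (transp x) | x <- row_cells true la.2] = [seq (m + nrow x)%N | x <- row_cells true la.2].
  by apply/eq_in_map => -[[c i] j]; rewrite mem_row_cells => /andP[/eqP -> _].
rewrite -(flatten_nseq_rows true (addn m) la2); congr flatten.
rewrite addnC iotaDl -map_comp; apply: eq_map => k /=.
by rewrite leq_addr addKn.
Qed.

Lemma codom_i_seq (f : W) : (codom f = i_seq m n la) <->
  forall y : cell la, f (tab_row la @@ y) = letter m (transp (ssval y)) :> nat.
Proof.
pose x0 : node := (false, 0%N, 0%N).
have C (c : 'I_r) : nth 0%N (map val (codom f)) c = f c.
  rewrite /codom /image_mem -map_comp (nth_map c) ?size_enum_ord ?ltn_ord //=.
  by rewrite nth_ord_enum.
have L (y : cell la) : nth 0%N [seq letter m (transp x) | x <- rowread la] (tab_row la @@ y) = letter m (transp (ssval y)).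
  by rewrite ffunE /= (nth_map x0) ?nth_index ?index_mem ?ssvalP.
split=> [e y|h].
  by rewrite -L -val_i_seq -e C.
apply: (inj_map val_inj); rewrite val_i_seq; apply: (@eq_from_nth _ 0%N).
  by rewrite size_map size_codom size_map size_rowread card_ord.
move=> i; rewrite size_map size_codom card_ord => hi.
have [y hy] := row_surj la (Ordinal hi).
by have := C (Ordinal hi); rewrite -[in RHS]hy h -L hy.
Qed.

Variable i0 : I.

(** Transposed, t_la is the initial tableau of la', so w_la carries the word of v_tilde to the word
    of that tableau. *)
Lemma codom_col (f : W) :
  codom (wcomp f (tab_perm (tab_col la))) = i_seq m n la <-> f = word i0 (tab_row mu).
Proof.
have ci : injective (tab_col la : {ffun _ -> 'I_r}) by apply: tab_of_inj.
have tr (y : cell la) : transp (ssval y) \in rowread mu.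
  rewrite rowread_conj map_f // (perm_mem (colread_perm la)); exact: ssvalP.
have E (y : cell la) : tab_row mu @@ (SeqSub (tr y) : cell mu) = tab_col la @@ y.
  apply: val_inj; rewrite !ffunE /= rowread_conj index_map //.
  exact: can_inj transpK.
have S (x : cell mu) : exists y : cell la, x = (SeqSub (tr y) : cell mu).
  have h : transp (ssval x) \in rowread la.
    move: (ssval x) (ssvalP x) => z; rewrite rowread_conj => /mapP[y hy ->].
    by rewrite transpK -(perm_mem (colread_perm la)).
  by exists (SeqSub h : cell la); apply: val_inj; rewrite /= transpK.
split=> [/(iffLR (codom_i_seq _)) h|->]; last (apply: (iffRL (codom_i_seq _)) => y).
  apply: word_uniq => // [|x]; first exact: tab_of_inj.
  by have [y ->] := S x; have := h y; rewrite [wcomp _ _ _]ffunE tab_permP // -E.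
rewrite [wcomp _ _ _]ffunE tab_permP // -E wordE //; exact: tab_of_inj.
Qed.

Lemma cnt_i_seq (f : W) (i : I) : codom f = i_seq m n la -> cnt f i r = part_at la i.
Proof.
move=> e; transitivity (count (pred1 i) (codom f)).
  rewrite /codom /image_mem count_map enumT /cnt cardE /enum_mem size_filter.
  by apply: eq_count => b; rewrite !inE ltn_ord.
rewrite e /i_seq count_flatten -map_comp sumnE big_map big_enum (bigD1 i) //= big1 ?addn0.
  by rewrite count_nseq /= eqxx mul1n.
by move=> j ji; rewrite /= count_nseq /= (negbTE ji).
Qed.

End Fixed.
End Readings.

(** * Highest weight vectors and their independence *)

Lemma leq_nth_sumn s i : (nth 0%N s i <= sumn s)%N.
Proof.
elim: s i => [|x s IH] [|i] //=; first exact: leq_addr.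
exact: leq_trans (IH i) (leq_addl _ _).
Qed.

Lemma eq_opp0 (C : numFieldType) (V : lmodType C) (x : V) : x = - x -> x = 0.
Proof.
move/eqP; rewrite -subr_eq0 opprK -mulr2n -scaler_nat scaler_eq0 pnatr_eq0 /=.
by move/eqP.
Qed.

Lemma wcompE m n r (f : {ffun 'I_r -> 'I_(m + n)}) w c : wcomp f w c = f (w c).
Proof. by rewrite ffunE. Qed.

Section HighestWeight.
Variables (C : numFieldType) (m n r : nat) (p q : C) (K : lmodType C).
Notation I := 'I_(m + n).
Notation par := (@par m n).
Notation W := {ffun 'I_r -> I}.
Notation M := {ffun W -> K}.
Variables (kE : I -> I -> endo K) (v : K).
Hypothesis kE_rel : forall i j k l y,
  kE i j (kE k l y) = gl_sg C i j k l *: kE k l (kE i j y)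
  + ((j == k)%:R *: kE i l y - (gl_sg C i j k l * (l == i)%:R) *: kE k j y).
Hypothesis kE_v : forall i j, ~~ (par i && ~~ par j) ->
  kE i j v = ((i == j)%:R * lam_pq p q i) *: v.
Notation A := (@tE C m n r K kE).
Let H := tE_op r kE_rel.
Variable i0 : I.
Hypothesis i0_even : ~~ par i0.
Notation permop := (@permop C m n r M A).
Variable la : bipart r.
Hypothesis la1 : (size la.1 <= m)%N.
Hypothesis la2 : (size la.2 <= n)%N.
Notation mu := (conj_bipart la).
Notation cell := (cell mu).
Notation "t @@ x" := ((t : {ffun _ -> 'I_r}) x) (at level 10).
Notation e := (tab_row mu).
Notation word := (@word m n r la i0).
Notation f0 := (word e).
Notation a := (sumn mu.1).
Notation P := (Pp A p a).

Let e_inj : injective (e : {ffun cell -> 'I_r}). Proof. exact: (@tab_row_inj r mu). Qed.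

Lemma f0E (x : cell) : f0 (e @@ x) = letter m (ssval x) :> nat.
Proof. exact: wordE. Qed.

Lemma a_le_r : (a <= r)%N.
Proof. by rewrite -[X in (_ <= X)%N](bcomp_sumn mu) leq_addr. Qed.

Lemma tab_row_lt (x : cell) : (e @@ x < a)%N = ~~ ncomp (ssval x).
Proof.
rewrite ffunE /= /rowread index_cat; case: ifP; rewrite -?(size_row_cells false mu.1).
  rewrite index_mem => h; rewrite h; move: h.
  by case: (ssval x) => [[c i] j]; rewrite mem_row_cells => /andP[/eqP ->].
move=> h; rewrite ltnNge leq_addr /=; apply/esym/negbTE; rewrite negbK.
have := ssvalP x; rewrite {1}/rowread mem_cat h /=.
by case: (ssval x) {h} => [[c i] j]; rewrite mem_row_cells => /andP[/eqP ->].
Qed.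

Lemma f0_par (c : 'I_r) : par (f0 c) = (c < a)%N.
Proof. by have [x <-] := row_surj mu c; rewrite /par f0E (letter_par la1 la2) // tab_row_lt. Qed.

Lemma row_stab_pres c (w : 'S_r) : w \in row_stab mu c -> forall k, (w k < a)%N = (k < a)%N.
Proof.
move=> hw k; have [x <-] := row_surj mu k.
by have [y [-> hc _]] := row_stab_row x hw; rewrite !tab_row_lt hc.
Qed.

Definition vt : M := [ffun f : W => if codom f == i_seq m n la then v else 0].
Definition vu : M := permop (tab_perm (tab_col la)) vt.
Definition Ysym : endo M := \sum_(w in row_stab mu false) permop w.
Definition Yalt : endo M := \sum_(w in row_stab mu true) (-1) ^+ w *: permop w.
Definition vz : M := Yalt (Ysym vu).
Definition vv (t : tableau mu) : M := permop (tab_perm t) (Yalt (Ysym (P vu))).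

Lemma vu_f0 : exists k : nat, vu f0 = (-1) ^+ k *: v.
Proof.
have [k h] := pi_coef kE_rel i0_even (tab_perm (tab_col la)) f0.
exists k; rewrite h ffunE.
by rewrite (iffRL (codom_col la1 la2 i0 f0) erefl) eqxx.
Qed.

Lemma vu_supp f : f != f0 -> vu f = 0.
Proof.
move=> nf; have [k h] := pi_coef kE_rel i0_even (tab_perm (tab_col la)) f.
rewrite [LHS]h ffunE; case: eqP => [/(iffLR (codom_col la1 la2 i0 f)) ef|_]; last exact: scaler0.
by rewrite ef eqxx in nf.
Qed.

(** Row permutations preserve the set of the first a positions, so P commutes with the symmetrizers
    and may act last, on [vz], whose words have odd letters exactly in those positions. *)
Lemma Pz : P (Yalt (Ysym vu)) = Yalt (Ysym (P vu)).
Proof.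
have h c (w : 'S_r) : w \in row_stab mu c -> P * permop w = permop w * P.
  by move=> hw; rewrite (pi_P p H i0_even a_le_r) //; apply: row_stab_pres hw.
suff /endoP/(_ vu) : P * (Yalt * Ysym) = Yalt * Ysym * P by rewrite !endoME.
rewrite mulrA; have -> : P * Yalt = Yalt * P.
  rewrite /Yalt mulr_sumr mulr_suml; apply: eq_bigr => w hw.
  by rewrite endoZr endoZl (h _ _ hw).
rewrite -!mulrA; congr (_ * _).
by rewrite /Ysym mulr_sumr mulr_suml; apply: eq_bigr => w hw; rewrite (h _ _ hw).
Qed.

Lemma vvE t : vv t = permop (tab_perm t) (P vz).
Proof. by rewrite /vz Pz. Qed.

Lemma vz_sum f : vz f = \sum_(w2 in row_stab mu true) (-1) ^+ w2 *:
  \sum_(w1 in row_stab mu false) permop w2 (permop w1 vu) f.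
Proof.
rewrite /vz /Yalt endo_sumE sum_ffunE; apply: eq_bigr => w2 _.
rewrite endoZE MZ /Ysym endo_sumE endo_apsum sum_ffunE.
by congr (_ *: _); apply: eq_bigr.
Qed.

Lemma vz_term f w1 w2 : wcomp (wcomp f w2) w1 != f0 -> permop w2 (permop w1 vu) f = 0.
Proof.
have [k2 ->] := pi_coef kE_rel i0_even w2 f.
have [k1 ->] := pi_coef kE_rel i0_even w1 (wcomp f w2).
by move=> h; rewrite vu_supp ?scaler0.
Qed.

Lemma vz_supp f : vz f != 0 -> exists w1 w2, [/\ w1 \in row_stab mu false,
  w2 \in row_stab mu true & wcomp (wcomp f w2) w1 = f0].
Proof.
move=> nz; apply: contrapT => no; move/eqP: nz; apply; rewrite vz_sum.
apply: big1 => w2 h2; rewrite big1 ?scaler0 // => w1 h1; apply: vz_term.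
by apply/eqP => h; apply: no; exists w1, w2.
Qed.

Lemma row_word_inj (x y : cell) : nrow (ssval x) = nrow (ssval y) ->
  f0 (e @@ x) = f0 (e @@ y) -> x = y.
Proof.
move=> hr /(congr1 (@nat_of_ord _)); rewrite !f0E => /(letter_inj la1 la2)[h1 h2].
exact: cell_eq.
Qed.

(** The letters of f0 in a row are distinct, so of all products of row permutations only the
    identity returns f0. *)
Lemma vz_f0 : exists k : nat, vz f0 = (-1) ^+ k *: v.
Proof.
have [k hk] := vu_f0; exists k; rewrite -hk vz_sum.
rewrite (bigD1 1%g) ?row_stab1 //= [X in _ + X]big1 ?addr0 => [|w2 /andP[h2 n2]].
  rewrite odd_perm1 expr0 scale1r (bigD1 1%g) ?row_stab1 //= [X in _ + X]big1 ?addr0.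
    by rewrite (pi1 H i0_even).
  move=> w1 /andP[h1 n1]; apply: vz_term; rewrite wcomp1; apply: contra_neq n1 => E.
  apply/permP => c; rewrite perm1; have [x <-] := row_surj mu c.
  have [y [hy hc hr]] := row_stab_row x h1; rewrite hy; congr (_ @@ _).
  by apply: row_word_inj => //; rewrite -hy -[in RHS]E wcompE.
rewrite big1 ?scaler0 // => w1 h1; apply: vz_term; apply: contra_neq n2 => E.
apply/permP => c; rewrite perm1; have [x <-] := row_surj mu c.
case: (boolP (ncomp (ssval x))) => hx; last by rewrite (row_stab_fix h2) // (negbTE hx).
have [y [hy hc hr]] := row_stab_row x h2; rewrite hy; congr (_ @@ _).
apply: row_word_inj => //; rewrite -hy -[in RHS]E !wcompE (row_stab_fix h1) ?hx //.
Qed.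

Lemma vz_split : split_at a vz.
Proof.
move=> f [c hc]; apply/eqP; apply: contraT => /vz_supp[w1 [w2 [h1 h2 E]]].
have pr k : (w2 (w1 k) < a)%N = (k < a)%N by rewrite (row_stab_pres h2) (row_stab_pres h1).
move/eqP: hc; case.
have [d <-] : exists d, w2 (w1 d) = c by exists ((w1^-1)%g ((w2^-1)%g c)); rewrite !permKV.
by rewrite pr -f0_par -E !wcompE.
Qed.

Lemma base_permop w x : base p q A x -> base p q A (permop w x).
Proof. by move=> bx i j hij; rewrite -endoME -(pi_A0 H i0_even) endoME bx // endo_apZ. Qed.

Lemma base_vu : base p q A vu.
Proof.
apply: base_permop => i j hij; apply/ffunP => f; rewrite tE0 MZ !ffunE.
case: ifP => _; last by rewrite endo_ap0 !scaler0.
rewrite kE_v // scalerA; case: (eqVneq i j) => [->|_]; last by rewrite !mul0r mulr0.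
by rewrite tsg_even // mul1r.
Qed.

Lemma base_vz : base p q A vz.
Proof.
have hs (S : {set 'S_r}) (F : 'S_r -> M) : (forall w, base p q A (F w)) -> base p q A (\sum_(w in S) F w).
  move=> bF i j hij; rewrite endo_apsum scaler_sumr; apply: eq_bigr => w _; exact: bF.
have hZ c x : base p q A x -> base p q A (c *: x).
  by move=> bx i j hij; rewrite endo_apZ bx // !scalerA mulrC.
rewrite /vz /Yalt /Ysym endo_sumE; apply: (hs) => w; rewrite endoZE; apply/hZ/base_permop.
by rewrite endo_sumE; apply: (hs) => w'; apply/base_permop/base_vu.
Qed.

Lemma vv_g1 t i j : ~~ par i -> par j -> Dd A r.+1 i j (vv t) = 0.
Proof.
move=> hi hj; rewrite vvE -endoME -(pi_D H i0_even) endoME.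
rewrite (g1_kill H a_le_r hi hj base_vz) ?endo_ap0 //.
  move=> k /andP[k0 ka]; case: k k0 ka => // k _ ka.
  have kr : (k < r)%N := leq_trans ka a_le_r.
  apply/(oddposP kE (Ordinal kr)) => f hf; apply: vz_split; exists (Ordinal kr).
  by rewrite (negbTE hf) ka.
move=> k /andP[ak kr]; case: k ak kr => // k ak kr.
apply/(evenposP kE (Ordinal kr)) => f hf; apply: vz_split; exists (Ordinal kr).
by rewrite hf /= ltnNge -ltnS ak.
Qed.

Lemma row_stab_tpermM c (x y : cell) w : ncomp (ssval x) = c -> ncomp (ssval y) = c ->
  nrow (ssval x) = nrow (ssval y) ->
  ((tperm (e @@ x) (e @@ y) * w)%g \in row_stab mu c) = (w \in row_stab mu c).
Proof.
move=> hx hy hr; have ht : tperm (e @@ x) (e @@ y) \in row_stab mu c.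
  by rewrite -hx; apply: row_stab_tperm; rewrite ?hx ?hy.
apply/idP/idP => h; last exact: row_stabM.
by have := row_stabM ht h; rewrite mulgA tperm2 mul1g.
Qed.

(* A vector with a repeated letter in a row is multiplied by -1 under the
   transposition of two equal odd letters and fixed under that of two equal
   even letters, hence is killed by the row symmetrizers. *)
Lemma Y_repeat (x y : cell) (i : I) (z : M) : x != y ->
    ncomp (ssval x) = ncomp (ssval y) -> nrow (ssval x) = nrow (ssval y) ->
    par i = ~~ ncomp (ssval x) -> A (e @@ x).+1 i i z = z -> A (e @@ y).+1 i i z = z ->
  Yalt (Ysym z) = 0.
Proof.
move=> xy hc hr hi zx zy; set t := tperm (e @@ x) (e @@ y).
have exy : e @@ x != e @@ y by rewrite (inj_eq e_inj).
have tz : permop t z = sp C i *: z.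
  by rewrite (pi_tperm H i0_even exy) (om_same H (l := i)) ?ltn_ord ?eqSS.
case: (boolP (ncomp (ssval x))) => hx.
  have S : Ysym * permop t = permop t * Ysym.
    rewrite /Ysym mulr_suml mulr_sumr; apply: eq_bigr => w hw.
    rewrite -!(piM H i0_even); congr permop.
    have := tpermJ (e @@ x) (e @@ y) w.
    rewrite (row_stab_fix hw) ?hx // (row_stab_fix hw) -?hc ?hx // -/t => E.
    by rewrite conjgC E.
  have L : Yalt * permop t = - Yalt.
    rewrite /Yalt mulr_suml -sumrN [RHS](reindex_inj (mulgI t)) /=.
    apply: eq_big => w; first by rewrite row_stab_tpermM // -hc hx.
    move=> hw; rewrite odd_permM odd_tperm exy signr_addb expr1 mulN1r scaleNr opprK.
    by rewrite endoZl -(piM H i0_even).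
  apply: eq_opp0.
  have tz' : permop t z = z by rewrite tz /sp hi hx /= scale1r.
  by rewrite -[in LHS]tz' -[Ysym _]endoME S endoME -[Yalt _]endoME L endoNE.
have S : Ysym * permop t = Ysym.
  rewrite /Ysym mulr_suml [RHS](reindex_inj (mulgI t)) /=.
  apply: eq_big => w; first by rewrite row_stab_tpermM // -?hc (negbTE hx).
  by move=> hw; rewrite -(piM H i0_even).
suff -> : Ysym z = 0 by rewrite endo_ap0.
apply: eq_opp0; rewrite -[in LHS]S endoME tz /sp hi hx expr1 scaleN1r.
by rewrite endo_apN.
Qed.

Lemma vu_fix (c : 'I_r) (i : I) : f0 c = i -> A c.+1 i i vu = vu.
Proof.
move=> hc; apply/ffunP => f; rewrite tES tsg_even // scale1r.
case: eqP => [<-|nf]; first by rewrite upd_id.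
by apply/esym/vu_supp/eqP => ef; apply: nf; rewrite ef.
Qed.

(** A row of the conjugate bipartition lists consecutive letters starting with the first of its
    parity. If position c holds j, its row already contains i, and raising makes i occur twice. *)
Lemma Y_raise (c : 'I_r) (i j : I) : (i < j)%N -> par i = par j ->
  Yalt (Ysym (A c.+1 i j vu)) = 0.
Proof.
move=> ij pij; case: (eqVneq (f0 c) j) => [hj|nj]; last first.
  suff -> : A c.+1 i j vu = 0 by rewrite !endo_ap0.
  apply/ffunP => f; rewrite tES [RHS]ffunE; case: eqP => [_|_]; last exact: scaler0.
  rewrite vu_supp ?scaler0 //; apply: contra_neq nj => <-; exact: upd_same.
have [x hx] := row_surj mu c; rewrite -hx in hj *.
have lx : letter m (ssval x) = j by rewrite -hj f0E.
have px : par j = ~~ ncomp (ssval x) by rewrite /par -lx (letter_par la1 la2).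
have [y [yc yr yl]] : exists y : cell, [/\ ncomp (ssval y) = ncomp (ssval x),
    nrow (ssval y) = nrow (ssval x) & letter m (ssval y) = i].
  have := ssvalP x; move: lx px; rewrite -pij.
  case: (ssval x) => [[[] o] l]; rewrite /letter /ncomp /nrow /ncol /= => lx px.
    rewrite mem_rowread => ll.
    have h : (true, o, nat_of_ord i) \in rowread mu by rewrite mem_rowread (leq_trans ij) // -lx ltnW.
    by exists (SeqSub h).
  rewrite mem_rowread => ll; have mi : (m <= i)%N by move: px; rewrite /Defs.par.
  have h : (false, o, (i - m)%N) \in rowread mu.
    by rewrite mem_rowread; apply: leq_trans ll; rewrite ltnS; lia.
  by exists (SeqSub h); split=> //=; rewrite subnKC.
have xy : x != y by apply: contraTneq ij => exy; rewrite -yl -exy lx ltnn.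
have hi : f0 (e @@ y) = i by apply: val_inj; rewrite /= f0E.
have exy : (e @@ y).+1 != (e @@ x).+1 by rewrite eqSS (inj_eq val_inj) (inj_eq e_inj) eq_sym.
have lr (d : 'I_r) : (0 < d.+1 <= r)%N by rewrite ltn_ord.
apply: (@Y_repeat x y i) => //; first by rewrite pij.
  by rewrite -endoME (op_unit H) // eqxx scale1r.
rewrite -endoME (op_super H) ?ltn_ord // sg_even // scale1r endoME vu_fix //.
Qed.

Lemma Dd_lift (E : endo M) c : (forall w, permop w * E = E * permop w) -> P * E = E * P ->
  Yalt (Ysym (E vu)) = c *: vz -> forall t, E (vv t) = c *: vv t.
Proof.
move=> hE hP h t; rewrite vvE -endoME -hE endoME -[E _]endoME -hP endoME.
have -> : E vz = Yalt (Ysym (E vu)).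
  suff /endoP/(_ vu) : E * (Yalt * Ysym) = Yalt * Ysym * E by rewrite /vz !endoME.
  rewrite mulrA; have -> : E * Yalt = Yalt * E.
    rewrite /Yalt mulr_sumr mulr_suml; apply: eq_bigr => w hw.
    by rewrite endoZr endoZl hE.
  rewrite -!mulrA; congr (_ * _).
  by rewrite /Ysym mulr_sumr mulr_suml; apply: eq_bigr => w hw; rewrite hE.
by rewrite h !endo_apZ.
Qed.

Let Dd_comm i j : (forall w, permop w * Dd A r.+1 i j = Dd A r.+1 i j * permop w) /\
  P * Dd A r.+1 i j = Dd A r.+1 i j * P.
Proof. by split=> [w|]; [exact: (pi_D H i0_even)|apply: (P_D H p _ _ a_le_r)]. Qed.

Lemma vv_raise t (i j : I) : (i < j)%N -> Dd A r.+1 i j (vv t) = 0.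
Proof.
move=> ij; case: (eqVneq (par i) (par j)) => [pij|pij]; last first.
  apply: vv_g1; first by apply: contra_neqN pij => hi; rewrite hi /Defs.par (leq_trans hi (ltnW ij)).
  apply: contra_neqT pij => hj; rewrite (negbTE hj); apply: contraNF hj => hi.
  exact: leq_trans hi (ltnW ij).
have [h1 h2] := Dd_comm i j; rewrite (Dd_lift (c := 0) h1 h2) ?scale0r //.
have -> : Dd A r.+1 i j vu = \sum_(b < r.+1) A b i j vu by rewrite /Dd endo_sumE.
rewrite !endo_apsum big_ord_recl base_vu ?pij ?andbN //.
have -> : (i == j) = false by apply/negbTE; rewrite -val_eqE /= ltn_eqF.
by rewrite mul0r scale0r !endo_ap0 add0r big1 // => b _; rewrite lift0 Y_raise.
Qed.

Lemma vv_weight t i : Dd A r.+1 i i (vv t) = bar_weight m n p q la i *: vv t.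
Proof.
have [h1 h2] := Dd_comm i i; apply: Dd_lift => //.
have -> : Dd A r.+1 i i vu = bar_weight m n p q la i *: vu; last by rewrite !endo_apZ.
rewrite /vu -endoME -h1 endoME -endo_apZ; congr endo_fun.
apply/ffunP => f; rewrite /Dd endo_sumE sum_ffunE big_ord_recl tE0 tsg_even // scale1r.
rewrite MZ ffunE [X in _ = X *: _]ffunE.
have E (b : 'I_r) : A (lift ord0 b) i i vt f = (f b == i)%:R *: vt f.
  rewrite lift0 tES tsg_even // scale1r; case: eqP => [<-|_]; last by rewrite scale0r.
  by rewrite upd_id scale1r.
rewrite (eq_bigr (fun b : 'I_r => (f b == i)%:R *: vt f)); last by move=> b _; exact: E.
rewrite -scaler_suml /vt ffunE; case: eqP => [hf|_]; last by rewrite endo_ap0 !scaler0 addr0.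
rewrite kE_v ?andbN // eqxx mul1r -scalerDl -(cnt_i_seq i hf) /cnt -natr_sum.
congr ((_ + _%:R) *: _); rewrite -sum1_card [RHS]big_mkcond /=; apply: eq_bigr => b _.
by rewrite inE ltn_ord /= -val_eqE; case: (_ == _).
Qed.

Variable phi : {linear K -> {ffun {set (I * I)%type} -> C^o}}.
Hypothesis phi_E : forall i j y, phi (kE i j y) = mE p q i j (phi y).
Hypothesis phi_v : phi v = bas C set0.
Hypothesis rm : (r <= m)%N.

Let phi_lower i j y : par i -> ~~ par j -> phi (kE i j y) = cr C (i, j) (phi y).
Proof. by move=> hi hj; rewrite phi_E /mE hi (negbTE hj). Qed.

(** The first a positions get r - a, ..., r - 1: even letters because r <= m, and new ones because
    the even letters of f0 lie below r - a, the size of the second component. *)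
Definition fresh : W := [ffun c : 'I_r => if (c < a)%N then insubd i0 (r - a + c)%N else f0 c].

Lemma freshE (c : 'I_r) : (c < a)%N -> fresh c = (r - a + c)%N :> nat.
Proof.
move=> ca; rewrite ffunE ca insubdK // -topredE.
suff : (r - a + c < m + n)%N by [].
by move: a_le_r ca rm; move: (sumn _) => b; lia.
Qed.

Lemma fresh_f0 (c : 'I_r) : (a <= c)%N -> fresh c = f0 c.
Proof. by move=> ac; rewrite ffunE ltnNge ac. Qed.

Lemma f0_small (c : 'I_r) : (a <= c)%N -> (f0 c < r - a)%N.
Proof.
have [x <-] := row_surj mu c; rewrite leqNgt tab_row_lt negbK f0E => hx.
have -> : (r - a = sumn mu.2)%N by rewrite -[X in (X - _)%N](bcomp_sumn mu) addKn.
have := ssvalP x; move: hx; case: (ssval x) => [[c' o] l]; rewrite /ncomp /letter /ncol /= => ->.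
by rewrite mem_rowread => h; apply: leq_trans h (leq_nth_sumn _ _).
Qed.

Lemma fresh_even c : ~~ par (fresh c).
Proof.
case: (ltnP c a) => ca; last by rewrite fresh_f0 // f0_par -leqNgt.
rewrite /Defs.par freshE // -ltnNge.
by move: a_le_r ca rm; move: (sumn _) => b; lia.
Qed.

Lemma fresh_inj (c d : 'I_r) : (c < a)%N -> fresh c = fresh d -> c = d.
Proof.
move=> ca; case: (ltnP d a) => da /(congr1 (@nat_of_ord _)).
  by rewrite !freshE // => /addnI /val_inj.
by rewrite freshE // fresh_f0 // => E; have := f0_small da; rewrite -E ltnNge leq_addr.
Qed.

Lemma f0_fresh (c d : 'I_r) : (a <= c)%N -> (d < a)%N -> f0 c != fresh d.
Proof.
move=> ac da; apply/eqP => /(congr1 (@nat_of_ord _)); rewrite freshE // => E.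
by have := f0_small ac; rewrite E ltnNge leq_addr.
Qed.

Lemma vz_word (s t : tableau mu) : standard s -> standard t ->
  permop (tab_perm s) vz (word t) != 0 ->
  forall k : 'I_r, (forall c : 'I_r, (c < k)%N -> word s c = word t c) ->
    (word s k <= word t k)%N.
Proof.
move=> hs ht; have [k ->] := pi_coef kE_rel i0_even (tab_perm s) (word t).
rewrite scaler_eq0 negb_or => /andP[_ /vz_supp[w1 [w2 [h1 h2 E]]]].
have [si _ _] := standardP hs.
apply: (@word_le _ _ _ _ la1 la2 _ s t (w1 * w2)%g (tab_perm s)) => // [x||c].
- have [y [hy yc yr]] := row_stab_row x h1; have [z [hz zc zr]] := row_stab_row y h2.
  by exists z; rewrite permM hy hz zc zr yc yr.
- exact: tab_permP.
- by rewrite -E !wcompE permM.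
Qed.

(** Among the t with nonzero coefficient choose s with the lexicographically least word, move it
    back by the inverse of its permutation, and read the coefficient at [fresh] and the monomial
    [pairs]. *)
Lemma vv_free (cf : tableau mu -> C) : \sum_(t | standard t) cf t *: vv t = 0 ->
  forall t, standard t -> cf t = 0.
Proof.
move=> S0 t0 st0; apply/eqP; apply: contraT => nt0.
pose Q := [pred t | standard t & cf t != 0].
pose F (t : tableau mu) (k : nat) : nat :=
  if insub k is Some c then word t (c : 'I_r) else 0%N.
have FE (t : tableau mu) (c : 'I_r) : F t c = word t c by rewrite /F valK.
have Q0 : Q t0 by rewrite /Q /= st0.
have [s /andP[ss ns] min] := lex_minimum r F Q0.
have [si _ _] := standardP ss.
have only t : Q t -> permop (tab_perm t) vz (word s) != 0 -> t = s.
  move=> /[dup] /min + /andP[st _] nz; have le := vz_word st ss nz.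
  case=> [E|[k kr [E lt]]].
    apply: (word_inj la1 la2 st ss (i0 := i0)); apply/ffunP => c; apply: val_inj.
    by rewrite /= -!FE E.
  have := le (Ordinal kr); rewrite -!FE => /(_ _)/wrap[] // => [c ck|].
    by apply: val_inj; rewrite /= -!FE E.
  by rewrite leqNgt lt.
have : phi (permop (tab_perm s)^-1%g (\sum_(t | standard t) cf t *: vv t) fresh) (pairs f0 fresh a) = 0.
  by rewrite S0 endo_ap0 [X in phi X]ffunE linear0 ffunE.
rewrite endo_apsum sum_ffunE linear_sum sum_ffunE.
have [e0 he0] := P_leading p kE_rel a_le_r phi_lower f0_par fresh_even fresh_inj (leqnn a).
rewrite (mix_a fresh_f0) in he0.
have term t : standard t ->
    phi (permop (tab_perm s)^-1%g (cf t *: vv t) fresh) (pairs f0 fresh a) =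
    (t == s)%:R * (cf s * ((-1) ^+ e0 * phi (vz f0) set0)).
  move=> st; rewrite endo_apZ MZ linearZ /= ffunE vvE -endoME -(piM H i0_even).
  (* If w mixes the first a positions with the others, [P_not_preserving] gives 0. Otherwise w
     passes through P, and up to sign the term is the vacuum coefficient at f_s of the permuted
     [vz], which by minimality of s is nonzero only for t = s. *)
  set w := (_ * _)%g; case: (pselect (forall k, (w k < a)%N = (k < a)%N)) => hw; last first.
    rewrite (P_not_preserving p kE_rel i0_even a_le_r phi_lower fresh_even fresh_f0 f0_fresh vz_split hw).
    rewrite scaler0; case: eqP => [E|]; last by rewrite mul0r.
    by case: hw => k; rewrite /w E mulgV perm1.
  rewrite -[permop w _]endoME (pi_P p H i0_even a_le_r hw) endoME he0; last first.
    move=> f [c hc]; have [k ->] := pi_coef kE_rel i0_even w f.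
    rewrite vz_split ?scaler0 //; exists ((w^-1)%g c); rewrite wcompE permKV.
    by rewrite -(hw (w^-1 c))%g permKV.
  case: (eqVneq t s) => [ets|nts].
    by rewrite mul1r /w ets mulgV (pi1 H i0_even) endo1E.
  rewrite mul0r; case: (eqVneq (cf t) 0) => [->|nc]; first by rewrite scale0r.
  suff -> : permop w vz f0 = 0 by rewrite linear0 ffunE mulr0 scaler0.
  rewrite /w (piM H i0_even) endoME; have [k ->] := pi_coef kE_rel i0_even ((tab_perm s)^-1)%g f0.
  have -> : wcomp f0 (tab_perm s)^-1 = word s.
    apply: word_uniq => // x; rewrite wcompE -(tab_permP si) permK f0E //.
  apply/eqP; rewrite scaler_eq0; apply/orP; right; apply: contraT => nz.
  by move/eqP: nts; case; apply: only nz; rewrite /Q /= st.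
rewrite (eq_bigr _ term) (bigD1 s) //= eqxx mul1r big1 ?addr0 => [|t /andP[_ /negbTE ->]]; last by rewrite mul0r.
have [k ->] := vz_f0; rewrite linearZ /= ffunE phi_v ffunE eqxx => /eqP.
by rewrite regZ !mulf_eq0 (negbTE ns) !signr_eq0 oner_eq0.
Qed.

Lemma vv_neq0 t : vv t != 0.
Proof.
apply/eqP => /(congr1 (permop (tab_perm t)^-1%g)); rewrite endo_ap0 vvE -endoME -(piM H i0_even).
rewrite mulgV (pi1 H i0_even) endo1E => P0.
have [e0 he0] := P_leading p kE_rel a_le_r phi_lower f0_par fresh_even fresh_inj (leqnn a).
have := he0 vz vz_split; rewrite P0 (_ : (0 : M) _ = 0) ?ffunE // linear0 [LHS]ffunE.
have [k ->] := vz_f0; rewrite linearZ /= ffunE phi_v ffunE eqxx => /esym/eqP.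
by rewrite regZ !mulf_eq0 !signr_eq0 oner_eq0.
Qed.

End HighestWeight.

(** * Singular vectors and lattice words *)

Section DominantWords.
Variables (C : numClosedFieldType) (m n r : nat).
Notation I := 'I_(m + n).
Notation par := (@par m n).
Notation W := {ffun 'I_r -> I}.
Implicit Types (f g : W) (k : nat).

Definition raise k (i j : I) (y : W -> C) f : C :=
  \sum_(b < r | (b < k)%N) (if f b == i then y (upd f b j) else 0).

(** The cross terms in the squared norm of [raise k i j z]. Being symmetric in i and j, they drop
    out when the norms for (i, j) and (j, i) are compared. *)
Definition off k (i j : I) (z : W -> C) : C :=
  \sum_(b < r | (b < k)%N) \sum_(b' < r | (b' < k)%N && (b' != b))
    \sum_(f : W | (f b == j) && (f b' == i)) z f * (z (wcomp f (tperm b b')))^*.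

Lemma off_sym k i j z : off k i j z = off k j i z.
Proof.
rewrite /off pair_big_dep [RHS]pair_big_dep /=.
rewrite (reindex_inj (inv_inj (f := fun u : 'I_r * 'I_r => (u.2, u.1)) _)) /=; last by case.
apply: eq_big => [[b b']|[b b'] _] /=; first by rewrite andbCA eq_sym andbA andbC [(b < k)%N && _]andbC andbA.
by apply: eq_big => f; rewrite 1?andbC // tpermC.
Qed.

Lemma norm_raise k (i j : I) (z : W -> C) : i != j ->
  \sum_f raise k i j z f * (raise k i j z f)^* =
  \sum_f (cnt f j k)%:R * (z f * (z f)^*) + off k i j z.
Proof.
move=> ij.
transitivity (\sum_(b < r | (b < k)%N) \sum_(b' < r | (b' < k)%N)
    \sum_(f : W | (f b == i) && (f b' == i)) z (upd f b j) * (z (upd f b' j))^*).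
  rewrite (eq_bigr (fun f => \sum_(b < r | (b < k)%N) \sum_(b' < r | (b' < k)%N)
     (if (f b == i) && (f b' == i) then z (upd f b j) * (z (upd f b' j))^* else 0))).
    rewrite exchange_big; apply: eq_bigr => b _; rewrite exchange_big; apply: eq_bigr => b' _.
    by rewrite -big_mkcond.
  move=> f _; rewrite /raise rmorph_sum mulr_suml; apply: eq_bigr => b _.
  rewrite mulr_sumr; apply: eq_bigr => b' _.
  by case: (f b == i); case: (f b' == i); rewrite ?rmorph0 ?mulr0 ?mul0r.
(* Replacing the letter i in position b by j turns the first factor into z f; for b' different from
   b the second becomes z at f with the letters in b and b' exchanged. *)
transitivity (\sum_(b < r | (b < k)%N) \sum_(b' < r | (b' < k)%N)
    \sum_(f : W | (f b == j) && ((b' == b) || (f b' == i)))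
      z f * (z (if b' == b then f else wcomp f (tperm b b')))^*).
  apply: eq_bigr => b _; apply: eq_bigr => b' _.
  rewrite (reindex_onto (fun f : W => upd f b i) (fun f => upd f b j)) /=; last first.
    by move=> f /andP[/eqP fb _]; rewrite upd_upd -fb upd_id.
  have back f : (upd (upd f b i) b j == f) = (f b == j).
    rewrite upd_upd; apply/eqP/eqP => [<-|<-]; first exact: upd_same.
    exact: upd_id.
  apply: eq_big => [f|f].
    rewrite back upd_same eqxx /=; case: (eqVneq b' b) => [->|nb].
      by rewrite upd_same eqxx /= andbT.
    by rewrite upd_other //= andbC.
  rewrite back upd_same => /andP[/andP[_ hb'] /eqP fb].
  rewrite upd_upd -{1}fb upd_id; congr (_ * (z _)^*).
  case: (eqVneq b' b) hb' => [-> _|nb]; first by rewrite upd_upd -fb upd_id.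
  rewrite upd_other // => /eqP fb'.
  apply/ffunP => c; rewrite wcompE ffunE; case: tpermP => [->|->|/eqP cb /eqP cb'].
  - by rewrite eq_sym (negbTE nb) upd_same fb'.
  - by rewrite eqxx fb.
  - by rewrite (negbTE cb') upd_other.
have -> : \sum_f (cnt f j k)%:R * (z f * (z f)^*) =
    \sum_(b < r | (b < k)%N) \sum_(f : W | f b == j) z f * (z f)^*.
  rewrite (exchange_big_dep predT) //=; apply: eq_bigr => f _.
  rewrite sumr_const mulr_natl; congr (_ *+ _); apply: eq_card => b.
  by rewrite !inE.
rewrite /off -big_split; apply: eq_bigr => b bk /=.
rewrite (bigD1 b) //= eqxx; congr (_ + _).
  by apply: eq_bigl => f; rewrite orTb andbT.
by apply: eq_bigr => b' /andP[_ /negbTE nb]; rewrite nb.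
Qed.

Lemma cnt_split f l k : cnt f l r = (cnt f l k + #|[set b : 'I_r | (k <= b)%N && (f b == l :> nat)]|)%N.
Proof.
rewrite /cnt -(cardsID [set b : 'I_r | (b < k)%N]); congr (_ + _)%N; apply: eq_card => b.
  by rewrite !inE ltn_ord andbC.
by rewrite !inE ltn_ord -leqNgt.
Qed.

Variable y : W -> C.
Hypothesis y_raise : forall (i j : I) f, (i < j)%N -> par i = par j -> raise r i j y f = 0.
Hypothesis y_cnt : forall f g (i : I), y f != 0 -> y g != 0 -> cnt f i r = cnt g i r.

(** With the letters in positions >= k frozen as in g, y restricts to a singular vector in the first
    k positions. *)
Definition singular_slice k g := forall f, (forall c : 'I_r, (k <= c)%N -> f c = g c) ->
  forall i j : I, (i < j)%N -> par i = par j -> raise k i j y f = 0.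

Lemma singular_slices k g0 : y g0 != 0 -> (k <= r)%N -> exists2 g, y g != 0 &
  forall l, (r - k <= l <= r)%N -> singular_slice l g.
Proof.
move=> y0; elim: k => [_|k IH kr].
  exists g0 => // l; rewrite subn0 => hl; have -> : l = r by apply/anti_leq; rewrite andbC.
  by move=> f _ i j ij pij; apply: y_raise.
have [g yg hg] := IH (ltnW kr).
have hk : (r - k.+1 < r)%N by lia.
pose c0 := Ordinal hk.
pose Q := [pred f : W | (y f != 0) && [forall c : 'I_r, (c0 < c)%N ==> (f c == g c)]].
have Qg : Q g by rewrite /Q /= yg; apply/forallP => c; rewrite eqxx implybT.
case: (arg_maxnP (fun f : W => f c0 : nat) Qg) => g' /andP[yg' /forallP ag] max.
have {}ag (c : 'I_r) : (c0 < c)%N -> g' c = g c by move=> h; have := ag c; rewrite h => /eqP.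
exists g' => // l /andP[]; rewrite leq_eqVlt => /orP[/eqP <- _|hl lr]; last first.
  move=> f hf i j ij pij; apply: (hg l) => // [|c lc]; first by rewrite lr andbT; lia.
  by rewrite hf // ag //; apply: leq_trans hl lc.
move=> f hf i j ij pij.
have hfg (c : 'I_r) : (c0 < c)%N -> f c = g c by move=> h; rewrite hf ?ag // ltnW.
(* The term of position c0 reads y at a word with the larger letter j there, which the maximality of
   g' excludes; what is left is the raising operator of the shorter slice. *)
have := hg c0.+1 _ f hfg i j ij pij; rewrite /raise (bigD1 c0) /=; last by rewrite ltnS.
case: eqP => [fc|_].
  suff -> : y (upd f c0 j) = 0.
    rewrite add0r => h; rewrite -[RHS]h; last by rewrite /=; lia.
    by apply: eq_bigl => b; rewrite ltnS -val_eqE /= (leq_eqVlt b); case: eqP => [->|] /=; rewrite ?ltnn ?andbT.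
  apply/eqP; apply: contraT => yu; have hq : Q (upd f c0 j).
    rewrite /Q /= yu; apply/forallP => c; apply/implyP => hc.
    by rewrite upd_other ?hfg // -val_eqE /= gtn_eqF.
  by have := max _ hq; rewrite upd_same -hf ?leqnn // fc /geq /= leqNgt ij.
rewrite add0r => h; rewrite -[RHS]h; last by rewrite /=; lia.
by apply: eq_bigl => b; rewrite ltnS -val_eqE /= (leq_eqVlt b); case: eqP => [->|] /=; rewrite ?ltnn ?andbT.
Qed.

Lemma slice_dominant k g (i j : I) : y g != 0 -> singular_slice k g ->
  (i < j)%N -> par i = par j -> (cnt g j k <= cnt g i k)%N.
Proof.
move=> yg hg ij pij; have nij : i != j by rewrite -val_eqE ltn_eqF.
pose ag f := [forall c : 'I_r, (k <= c)%N ==> (f c == g c)].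
have agP f : ag f -> forall c : 'I_r, (k <= c)%N -> f c = g c.
  by move=> /forallP h c hc; have := h c; rewrite hc => /eqP.
pose z f : C := if ag f then y f else 0.
have ag_upd f (b : 'I_r) l : (b < k)%N -> ag (upd f b l) = ag f.
  move=> bk; apply: eq_forallb => c; case: (leqP k c) => //= kc.
  by rewrite upd_other // -val_eqE gtn_eqF // (leq_trans bk).
have z0 f : raise k i j z f = 0.
  case: (boolP (ag f)) => af; last first.
    by rewrite /raise big1 // => b bk; rewrite /z ag_upd // (negbTE af); case: ifP.
  rewrite -(hg f (agP f af) i j ij pij) /raise; apply: eq_bigr => b bk.
  by rewrite /z ag_upd // af.
pose S := \sum_f z f * (z f)^*.
(* All words in the support of the slice have the same total weight and the same frozen letters,
   hence the weight of g on the first k positions. *)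
have zc (l : I) : \sum_f (cnt f l k)%:R * (z f * (z f)^*) = (cnt g l k)%:R * S.
  rewrite /S mulr_sumr; apply: eq_bigr => f _; rewrite /z; case: ifP => af; last by rewrite mul0r !mulr0.
  case: (eqVneq (y f) 0) => [->|yf]; first by rewrite mul0r !mulr0.
  congr (_%:R * _); have := y_cnt l yf yg; rewrite !(cnt_split _ _ k).
  rewrite (_ : #|[set b : 'I_r | (k <= b)%N && (f b == l :> nat)]| =
     #|[set b : 'I_r | (k <= b)%N && (g b == l :> nat)]|); first by move/addIn.
  apply: eq_card => b; rewrite !inE; case: (leqP k b) => //= kb.
  by rewrite (agP f af).
have S0 : 0 < S.
  rewrite /S (bigD1 g) //= ltr_wpDr //; first by apply: sumr_ge0 => f _; rewrite mul_conjC_ge0.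
  have -> : z g = y g by rewrite /z ifT //; apply/forallP => c; rewrite eqxx implybT.
  by rewrite mul_conjC_gt0.
have N1 := norm_raise k z nij.
have N2 := norm_raise k z (i := j) (j := i); rewrite eq_sym in N2; have {}N2 := N2 nij.
rewrite big1 in N1; last by move=> f _; rewrite z0 mul0r.
rewrite zc off_sym in N1; rewrite zc in N2.
have : 0 <= (cnt g i k)%:R * S + off k j i z.
  by rewrite -N2; apply: sumr_ge0 => f _; rewrite mul_conjC_ge0.
have -> : off k j i z = - ((cnt g j k)%:R * S) by apply/eqP; rewrite -addr_eq0 addrC -N1.
by rewrite subr_ge0 ler_pM2r // ler_nat.
Qed.

Lemma lattice_coef g0 : y g0 != 0 -> exists2 g, y g != 0 & lattice g.
Proof.
move=> y0; have [g yg hg] := singular_slices y0 (leqnn r).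
exists g => // k i j ij pij; case: (leqP k r) => kr.
  by apply: slice_dominant => //; apply: hg; rewrite subnn.
have E (l : nat) : cnt g l k = cnt g l r.
  by apply: eq_card => b; rewrite !inE ltn_ord (ltn_trans (ltn_ord b) kr).
by rewrite !E; apply: slice_dominant => //; apply: hg; rewrite subnn leqnn.
Qed.

End DominantWords.

Lemma bipart_sizes m n r (la : bipart r) : (r <= m)%N -> (r <= n)%N ->
  (size la.1 <= m)%N /\ (size la.2 <= n)%N.
Proof.
have h1 := part_size (bcomp_part la false); have h2 := part_size (bcomp_part la true).
by have := bcomp_sumn la; move: h1 h2; rewrite /bcomp; lia.
Qed.

(** * Highest weight vectors through their vacuum coefficients *)

Section Assembly.
Variables (C : numClosedFieldType) (m n r : nat) (p q : C) (K : lmodType C).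
Notation I := 'I_(m + n).
Notation par := (@par m n).
Notation W := {ffun 'I_r -> I}.
Notation M := {ffun W -> K}.
Variables (kE : I -> I -> endo K) (v : K).
Hypothesis kE_rel : forall i j k l y,
  kE i j (kE k l y) = gl_sg C i j k l *: kE k l (kE i j y)
  + ((j == k)%:R *: kE i l y - (gl_sg C i j k l * (l == i)%:R) *: kE k j y).
Hypothesis kE_v : forall i j, ~~ (par i && ~~ par j) ->
  kE i j v = ((i == j)%:R * lam_pq p q i) *: v.
Variable phi : {linear K -> {ffun {set (I * I)%type} -> C^o}}.
Hypothesis phi_E : forall i j y, phi (kE i j y) = mE p q i j (phi y).
Hypothesis phi_v : phi v = bas C set0.
Hypothesis phi_supp : forall y (S : {set (I * I)%type}), phi y S != 0 -> S \subset lower m n.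
Hypothesis phi_inj : forall y, phi y = 0 -> y = 0.
Hypothesis typical : forall a b : nat, (a < n)%N -> (b < m)%N -> p - q - a%:R + b%:R != 0.
Notation A := (@tE C m n r K kE).
Notation D := (Dd A r.+1).
Let H := tE_op r kE_rel.

Definition hwv (xi : {ffun I -> C}) (x : M) : Prop :=
  (forall i : I, D i i x = xi i *: x) /\ (forall i j : I, (i < j)%N -> D i j x = 0).

Lemma D_coef i j (x : M) f : D i j x f = tsg C 0 i j f *: kE i j (x f) +
  \sum_(b < r) tsg C b.+1 i j f *: (if f b == i then x (upd f b j) else 0).
Proof.
rewrite /Dd endo_sumE sum_ffunE big_ord_recl tE0; congr (_ + _).
by apply: eq_bigr => b _; rewrite lift0 tES.
Qed.

Definition rho (x : M) (f : W) : C := phi (x f) set0.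

(** Take a word f with x f nonzero and as few even letters as possible. Raising inside the tensor
    factors would read x at words with fewer even letters, so x f itself is killed by g_1, and
    typicality makes its vacuum coefficient nonzero. *)
Lemma rho_neq0 (x : M) : x != 0 ->
  (forall i j, ~~ par i -> par j -> D i j x = 0) -> exists f, rho x f != 0.
Proof.
move=> nx hx; have [f xf] : exists f, x f != 0.
  apply: contrapT => no; move/eqP: nx; apply; apply/ffunP => f; rewrite [RHS]ffunE.
  by apply/eqP; apply: contraT => h; case: no; exists f.
pose nev (f : W) := #|[set c | ~~ par (f c)]|.
case: (arg_minnP nev (P := fun f => x f != 0) xf) => {xf}f xf min; exists f.
apply: contraNneq xf => r0; apply/eqP/phi_inj/(typical_singular typical) => //.
  by move=> S; apply: phi_supp.
move=> i j hi hj; rewrite -phi_E; have := congr1 (fun y : M => y f) (hx i j hi hj).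
rewrite D_coef [RHS]ffunE big1 ?addr0.
  move=> /eqP; rewrite scaler_eq0 (negbTE (tsg_neq0 _ _ _ _ _)) /= => /eqP ->.
  exact: linear0.
move=> b _; case: eqP => [fb|_]; last exact: scaler0.
suff -> : x (upd f b j) = 0 by rewrite scaler0.
apply/eqP; apply: contraT => /min; rewrite leqNgt; case/negP; apply: proper_card.
apply/properP; split.
  apply/subsetP => c; rewrite !inE; case: (eqVneq c b) => [->|cb]; first by rewrite upd_same hj.
  by rewrite upd_other.
by exists b; rewrite !inE ?fb ?upd_same ?hj.
Qed.

Lemma cr_set0 u (g : {ffun {set (I * I)%type} -> C^o}) : cr C u g set0 = 0.
Proof. by rewrite ffunE inE. Qed.

Lemma mE_set0 i j g : par i = par j -> mE p q i j g set0 = ((i == j)%:R * lam_pq p q i) * g set0.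
Proof.
move=> pij; have n0 : num0 C i j g set0 = 0.
  by rewrite /num0 endo_sumE sum_ffunE big1 // => o _; rewrite endoME cr_set0.
have n1 : num1 C i j g set0 = 0.
  by rewrite /num1 endo_sumE sum_ffunE big1 // => o _; rewrite endoME cr_set0.
rewrite /mE /lam_pq -pij; case: (par i).
  rewrite endoDE endoZE endo1E ffunE n1 addr0 ffunE.
  by rewrite regZ [_%:R * _]mulrC.
rewrite endoDE endoNE endoZE endo1E ffunE [X in _ + X]ffunE n0 oppr0 addr0 ffunE.
by rewrite regZ [_%:R * _]mulrC.
Qed.

(** Even elements preserve the degree in the Grassmann algebra, so on vacuum coefficients they act
    through the weight of the vacuum and the scalar tensor space. *)
Lemma rho_D i j x f : par i = par j ->
  rho (D i j x) f = ((i == j)%:R * lam_pq p q i) * rho x f + raise r i j (rho x) f.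
Proof.
move=> pij; rewrite /rho D_coef tsg_even // scale1r linearD [LHS]ffunE phi_E mE_set0 //.
congr (_ + _); rewrite linear_sum sum_ffunE /raise.
apply: eq_big => [b|b _]; first by rewrite ltn_ord.
by rewrite tsg_even // scale1r; case: ifP => // _; rewrite linear0 ffunE.
Qed.

Lemma raise_diag i (y : W -> C) f : raise r i i y f = (cnt f i r)%:R * y f.
Proof.
rewrite /raise /cnt -sum1_card natr_sum mulr_suml [RHS]big_mkcond [LHS]big_mkcond /=.
apply: eq_bigr => b _; rewrite inE ltn_ord /= -val_eqE /=.
case: eqP => [fb|_] //; rewrite mul1r.
by rewrite (_ : upd f b i = f) // -[RHS](upd_id f b); congr upd; apply: val_inj.
Qed.

Lemma hwv_lattice xi x : x != 0 -> hwv xi x -> exists g,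
  [/\ rho x g != 0, lattice g & forall i, xi i = lam_pq p q i + (cnt g i r)%:R].
Proof.
move=> nx [hw hr]; have [f0 rf0] : exists f, rho x f != 0.
  apply: rho_neq0 => // i j hi hj; apply: hr.
  by move: hi hj; rewrite /Defs.par -ltnNge; apply: leq_trans.
have wt f i : rho x f != 0 -> xi i = lam_pq p q i + (cnt f i r)%:R.
  move=> nf; have := rho_D (i := i) (j := i) x f erefl; rewrite hw eqxx mul1r raise_diag -mulrDl.
  by rewrite {1}/rho MZ linearZ /= ffunE => /(mulIf nf).
have [g rg lg] : exists2 g, rho x g != 0 & lattice g.
  apply: (lattice_coef (y := rho x)) rf0 => [i j f ij pij|f g i nf ng].
    have := rho_D x f pij; rewrite hr //; have -> : (i == j) = false by rewrite -val_eqE ltn_eqF.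
    by rewrite !mul0r add0r => <-; rewrite /rho ffunE linear0 ffunE.
  by have := wt f i nf; rewrite (wt g i ng) => /addrI/eqP; rewrite eqr_nat => /eqP.
by exists g; split=> // i; apply: wt.
Qed.

Lemma hwvD xi x y : hwv xi x -> hwv xi y -> hwv xi (x + y).
Proof.
move=> [h1 h2] [h3 h4]; split=> [i|i j ij]; rewrite endo_apD; first by rewrite h1 h3 scalerDr.
by rewrite h2 // h4 // addr0.
Qed.

Lemma hwvZ xi c x : hwv xi x -> hwv xi (c *: x).
Proof.
move=> [h1 h2]; split=> [i|i j ij]; rewrite endo_apZ; first by rewrite h1 !scalerA mulrC.
by rewrite h2 // scaler0.
Qed.

Lemma hwv0 xi : hwv xi 0.
Proof. by split=> *; rewrite endo_ap0 ?scaler0. Qed.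

Lemma hwv_sum xi (T : finType) (Q : pred T) (F : T -> M) :
  (forall t, Q t -> hwv xi (F t)) -> hwv xi (\sum_(t | Q t) F t).
Proof.
move=> h; elim/big_rec: _ => [|t x qt hx]; first exact: hwv0.
by apply: hwvD => //; apply: h.
Qed.

Variable i0 : I.
Hypothesis i0_even : ~~ par i0.
Hypothesis rm : (r <= m)%N.
Hypothesis rn : (r <= n)%N.

Section Basis.
Variable la : bipart r.
Let la1 : (size la.1 <= m)%N := (bipart_sizes la rm rn).1.
Let la2 : (size la.2 <= n)%N := (bipart_sizes la rm rn).2.
Notation vv := (@vv C m n r p K kE v la).
Notation xi := (bar_weight m n p q la).

Lemma hwv_vv t : hwv xi (vv t).
Proof.
split=> [i|i j ij]; first exact: (vv_weight kE_rel kE_v i0_even).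
exact: (vv_raise kE_rel kE_v i0_even la1 la2).
Qed.

Definition std := [set t : tableau (conj_bipart la) | standard t].
Notation N := #|std|.

Definition coefs (c : 'rV[C]_N) (t : tableau (conj_bipart la)) : C :=
  \sum_(j < N) (enum_val j == t)%:R * c 0 j.

Lemma coefs_sum c : \sum_(t | standard t) coefs c t *: vv t = \sum_j c 0 j *: vv (enum_val j).
Proof.
rewrite (eq_bigr (fun t => \sum_j ((enum_val j == t)%:R * c 0 j) *: vv t)); last first.
  by move=> t _; rewrite scaler_suml.
rewrite exchange_big; apply: eq_bigr => j _.
have sj : standard (enum_val j) by have := enum_valP j; rewrite inE.
rewrite (bigD1 (enum_val j)) //= eqxx mul1r big1 ?addr0 // => t /andP[_ nt].
by rewrite eq_sym (negbTE nt) mul0r scale0r.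
Qed.

Lemma coefs_val c j : coefs c (enum_val j) = c 0 j.
Proof.
rewrite /coefs (bigD1 j) //= eqxx mul1r big1 ?addr0 // => k kj.
by rewrite (inj_eq enum_val_inj) (negbTE kj) mul0r.
Qed.

Definition readout (x : M) : 'rV[C]_N := \row_j rho x (word i0 (enum_val j)).

Lemma readout_inj x : hwv xi x -> readout x = 0 -> x = 0.
Proof.
move=> hx r0; apply/eqP; apply: contraT => nx.
have [g [rg lg cg]] := hwv_lattice nx hx.
have [i|t st tg] := lattice_standard la1 la2 i0 lg.
  by have := cg i; rewrite ffunE => /addrI/eqP; rewrite eqr_nat eq_sym => /eqP.
have ts : t \in std by rewrite inE.
have := congr1 (fun w : 'rV[C]_N => w 0 (enum_rank_in ts t)) r0.
by rewrite !mxE enum_rankK_in // tg => /eqP; rewrite (negbTE rg).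
Qed.

Lemma readoutB x y : readout (x - y) = readout x - readout y.
Proof. by apply/rowP => j; rewrite !mxE /rho MD MN linearB !ffunE. Qed.

Lemma vv_basis : is_basis_of (fun t : tableau (conj_bipart la) => standard t) vv (hwv xi).
Proof.
split=> [t _|c|x hx]; first exact: hwv_vv.
  exact: (vv_free kE_rel i0_even la1 la2 phi_E phi_v rm).
pose B : 'M[C]_N := \matrix_(i, j) rho (vv (enum_val i)) (word i0 (enum_val j)).
have RB (c : 'rV[C]_N) : readout (\sum_j c 0 j *: vv (enum_val j)) = c *m B.
  apply/rowP => j; rewrite !mxE /rho sum_ffunE linear_sum sum_ffunE; apply: eq_bigr => k _.
  by rewrite MZ linearZ /= ffunE mxE.
have hw (c : 'rV[C]_N) : hwv xi (\sum_j c 0 j *: vv (enum_val j)).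
  by apply: hwv_sum => j _; apply/hwvZ/hwv_vv.
(* A row vector killed by B yields a highest weight combination of the v_t with zero readout; it
   vanishes by [readout_inj], and its coefficients vanish by [vv_free]. *)
have UB : B \in unitmx.
  rewrite -row_free_unit -kermx_eq0; apply/rowV0P => w /sub_kermxP wB.
  have := readout_inj (hw w); rewrite RB wB => /(_ erefl); rewrite -coefs_sum => S0.
  apply/rowP => j; rewrite [RHS]mxE -coefs_val.
  apply: (vv_free kE_rel i0_even la1 la2 phi_E phi_v rm S0).
  by have := enum_valP j; rewrite inE.
(* These coefficients give a combination with the readout of x, so the difference is a highest
   weight vector with readout 0. *)
exists (coefs (readout x *m invmx B)); rewrite coefs_sum; apply/eqP; rewrite -subr_eq0; apply/eqP.
apply: readout_inj; first by rewrite -scaleN1r; apply: hwvD => //; apply/hwvZ/hw.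
by rewrite readoutB RB mulmxKV // subrr.
Qed.

End Basis.

Lemma hwv_bar_weight xi x : x != 0 -> hwv xi x -> exists la : bipart r, bar_weight m n p q la = xi.
Proof.
move=> nx hx; have [g [_ lg cg]] := hwv_lattice nx hx.
have [la [_ _ h]] := lattice_bipart lg; exists la.
by apply/ffunP => i; rewrite ffunE h cg.
Qed.

Lemma bar_weight_hwv (la : bipart r) : exists x, x != 0 /\ hwv (bar_weight m n p q la) x.
Proof.
have [la1 la2] := bipart_sizes la rm rn.
exists (@vv C m n r p K kE v la (tab_row _)); split; last exact: hwv_vv.
exact: (vv_neq0 kE_rel i0_even la1 la2 phi_E phi_v rm).
Qed.

End Assembly.

Lemma part_inj s t : is_part s -> is_part t -> (forall i, nth 0%N s i = nth 0%N t i) -> s = t.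
Proof.
move=> /andP[_ hs] /andP[_ ht] h.
have le (a b : seq nat) : 0%N \notin b -> (forall i, nth 0%N a i = nth 0%N b i) -> (size b <= size a)%N.
  move=> hb hab; rewrite leqNgt; apply: contra hb => lt.
  by have := mem_nth 0%N lt; rewrite -hab nth_default.
apply: (@eq_from_nth _ 0%N) => // .
by apply: anti_leq; rewrite (le t s) // (le s t).
Qed.

Lemma bar_weight_inj (C : numFieldType) m n r (p q : C) : (r <= m)%N -> (r <= n)%N ->
  injective (@bar_weight C m n r p q).
Proof.
move=> rm rn la la' /ffunP E.
have P (i : 'I_(m + n)) : part_at la i = part_at la' i.
  by have := E i; rewrite !ffunE => /addrI/eqP; rewrite eqr_nat => /eqP.
have [h1 h2] := bipart_sizes la rm rn; have [h1' h2'] := bipart_sizes la' rm rn.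
have e1 : la.1 = la'.1.
  apply: part_inj => [||l]; [exact: (bcomp_part la false)|exact: (bcomp_part la' false)|].
  case: (ltnP l m) => lm; last by rewrite !nth_default // (leq_trans _ lm).
  have lmn : (l < m + n)%N by rewrite ltn_addr.
  by have := P (Ordinal lmn); rewrite /part_at /Defs.par /= leqNgt lm.
have e2 : la.2 = la'.2.
  apply: part_inj => [||l]; [exact: (bcomp_part la true)|exact: (bcomp_part la' true)|].
  case: (ltnP l n) => ln; last by rewrite !nth_default // (leq_trans _ ln).
  have lmn : (m + l < m + n)%N by rewrite ltn_add2l.
  by have := P (Ordinal lmn); rewrite /part_at /Defs.par /= leq_addr addKn.
by apply: val_inj; move: e1 e2; case: la {E P h1 h2} => -[? ?] ?; case: la' {h1' h2'} => -[? ?] ? /= -> ->.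
Qed.

(** * Comparison with the operators of the statement *)

Section Operators.
Variables (C : numFieldType) (m n r : nat) (p q : C).
Notation I := 'I_(m + n).
Notation K := (kac m n p q).
Notation M := {ffun {ffun 'I_r -> I} -> K}.
Notation kE := (@kE C m n p q).
Notation A := (@tE C m n r K kE).

Lemma E_atE a i j (x : M) : E_at a i j x = A a i j x.
Proof. by []. Qed.

Lemma gactE i j (x : M) : Defs.gact i j x = Dd A r.+1 i j x.
Proof. by rewrite /Defs.gact /Dd endo_sumE; apply: eq_bigr => a _; exact: E_atE. Qed.

Lemma Omega_atE a b (x : M) : Omega_at a b x = om A a b x.
Proof.
rewrite /Omega_at /om endo_sumE; apply: eq_bigr => i _; rewrite endo_sumE.
by apply: eq_bigr => j _; rewrite endoZE endoME.
Qed.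

Lemma s_opE i (x : M) : s_op i x = Sx A i x.
Proof. exact: Omega_atE. Qed.

Lemma x_opE i (x : M) : x_op i x = Xx A i x.
Proof.
case: i => [//|i]; elim: i x => [|i IH] x; first by rewrite endoNE -Omega_atE.
by rewrite [LHS]/= [Xx _ _]/= endoDE endoNE !endoME -!s_opE -IH.
Qed.

Lemma perm_opE w (x : M) : perm_op w x = permop A w x.
Proof.
rewrite /perm_op /permop /wd -[in LHS](endo1E x).
elim: (s_word w) 1 => //= i u IH T.
by rewrite s_opE -endoME IH.
Qed.

Lemma sym_opE (S : {set 'S_r}) (x : M) : sym_op S x = (\sum_(w in S) permop A w) x.
Proof. by rewrite endo_sumE; apply: eq_bigr => w _; rewrite perm_opE. Qed.

Lemma alt_opE (S : {set 'S_r}) (x : M) :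
  alt_op S x = (\sum_(w in S) (-1) ^+ w *: permop A w) x.
Proof.
rewrite endo_sumE; apply: eq_bigr => w _; rewrite endoZE.
exact: congr1 (perm_opE w x).
Qed.

Lemma P_opE k (x : M) :
  foldl (fun y i => x_op i y + p *: y) x (iota 1 k) = Pp A p k x.
Proof.
elim: k => [|k IH]; first by rewrite endo1E.
have -> : iota 1 k.+1 = rcons (iota 1 k) k.+1 by rewrite -cats1 -{1}(addn1 k) iotaD add1n.
rewrite foldl_rcons IH PS endoME endoDE endoZE endo1E.
by rewrite x_opE.
Qed.

Lemma y_opE (mu : bipart r) (x : M) : y_op mu x =
  (\sum_(w in row_stab mu true) (-1) ^+ w *: permop A w)
    ((\sum_(w in row_stab mu false) permop A w) (Pp A p (sumn mu.1) x)).
Proof. by rewrite -alt_opE -sym_opE -P_opE. Qed.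

Lemma v_tabE (la : bipart r) (t : tableau (conj_bipart la)) :
  v_tab m n p q la t = vv p kE (v_pq m n p q) t.
Proof.
have E : v_tilde m n p q la = vt m n (v_pq m n p q) la by [].
by rewrite /v_tab perm_opE y_opE perm_opE E.
Qed.

End Operators.

Lemma hw_spaceE (C : numClosedFieldType) m n r (p q : C) xi
    (x : {ffun {ffun 'I_r -> 'I_(m + n)} -> kac m n p q}) :
  hw_space r p q xi x <-> hwv (@kE C m n p q) xi x.
Proof.
split=> -[h1 h2]; split=> [i|i j ij].
- by rewrite -gactE.
- by rewrite -gactE h2.
- by rewrite gactE.
- by rewrite gactE h2.
Qed.

(** A vanishing scalar means c = a - b, which is an integer strictly between -m and n. *)
Lemma typical_of_int (C : numFieldType) (m n : nat) (c : C) :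
  ~ (exists z : int, c = z%:~R) \/ c <= - m%:R \/ c >= n%:R ->
  forall a b : nat, (a < n)%N -> (b < m)%N -> c - a%:R + b%:R != 0.
Proof.
move=> hc a b an bm; apply/eqP => h.
have ec : c = a%:R - b%:R.
  by apply/eqP; rewrite -subr_eq0 opprB addrA addrAC h.
case: hc => [[]|[]].
- by exists (a%:Z - b%:Z); rewrite ec rmorphB.
- rewrite ec -subr_ge0 (_ : _ - _ = b%:R - (m + a)%:R :> C); last by rewrite natrD; ring.
  by rewrite subr_ge0 ler_nat; lia.
- by rewrite ec lerBrDr -natrD ler_nat; lia.
Qed.

Local Open Scope classical_set_scope.
Local Open Scope ring_scope.

Theorem theorem5p7 (R : realType) (m n r : nat) (p q : R[i])
    (hm : (0 < m)%N) (hn : (0 < n)%N) (hr : (0 < r)%N)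
    (hrmn : (r <= minn m n)%N)
    (hpq : ~ (exists z : int, p - q = z%:~R) \/
           p - q <= - m%:R \/ p - q >= n%:R) :
  set_bij [set: bipart r]
          [set xi : {ffun 'I_(m + n) -> R[i]} | dominant_weight r p q xi]
          (bar_weight m n p q)
  /\
  forall la : bipart r,
    is_basis_of (fun t : tableau (conj_bipart la) => standard t)
                (v_tab m n p q la)
                (hw_space r p q (bar_weight m n p q la)).
Proof.
have typ := typical_of_int hpq.
have rm : (r <= m)%N by apply: leq_trans hrmn (geq_minl _ _).
have rn : (r <= n)%N by apply: leq_trans hrmn (geq_minr _ _).
have h0 : (0 < m + n)%N by rewrite ltn_addr.
pose i0 : 'I_(m + n) := Ordinal h0.
have i0e : ~~ par i0 by rewrite /par -ltnNge.
have krel := @kE_relP R[i] m n p q.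
have kv := @kE_v R[i] m n p q.
have kind := @kac_ind R[i] m n p q.
have kpv := @kphi_v R[i] m n p q.
have kpE := @kphi_E R[i] m n p q.
have ksupp := @phi_supp R[i] m n p q _ _ _ _ krel kv kind kpv kpE.
have kinj := @phi_inj R[i] m n p q _ _ _ _ krel kv kind kpv kpE.
split.
  split.
  - move=> la _; have [x [nx /hw_spaceE hx]] := bar_weight_hwv krel kv kpE kpv i0e rm rn la.
    by exists x.
  - move=> la la' _ _; exact: bar_weight_inj.
  - move=> xi [x [nx /hw_spaceE hx]].
    by have [la E] := hwv_bar_weight kpE ksupp kinj typ nx hx; exists la.
move=> la; have [b1 b2 b3] := vv_basis krel kv kpE kpv ksupp kinj typ i0e rm rn la.
split=> [t st|c S0 t st|x /hw_spaceE/b3[c ->]].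
- by apply/hw_spaceE; rewrite v_tabE; apply: b1.
- by apply: (b2 c) st; rewrite -[RHS]S0; apply: eq_bigr => s _; rewrite v_tabE.
- by exists c; apply: eq_bigr => s _; rewrite v_tabE.
Qed.
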